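(* Let $I=(a,b)$ be an open interval of $\mathbb{R}$, $m$ a fully supported Radon measure on $I$, $\mathtt{s}$ a scaling function on $I$, and let $(\mathcal{E},\mathcal{F})=(\mathcal{E}^{(\mathtt{s},m)},\mathcal{F}^{(\mathtt{s},m)}_0)$ be the Dirichlet form on $L^2(I,m)$ of the minimal diffusion process on $I$ with scaling function $\mathtt{s}$, speed measure $m$ and no killing inside. Assume $C_c^\infty(I)\subset\mathcal{F}$. Let $(\bar{\mathcal{E}},\bar{\mathcal{F}})$ be the smallest closed extension of $(\mathcal{E},C_c^\infty(I))$ in $(\mathcal{E},\mathcal{F})$. Then the absolutely continuous part $\bar{\mathtt{s}}$ of $\mathtt{s}$ is the scaling function of the regular Dirichlet form $(\bar{\mathcal{E}},\bar{\mathcal{F}})$, i.e. $(\bar{\mathcal{E}},\bar{\mathcal{F}})=(\mathcal{E}^{(\bar{\mathtt{s}},m)},\mathcal{F}^{(\bar{\mathtt{s}},m)}_0)$. In particular, $C_c^\infty(I)$ is a special standard core of $(\mathcal{E},\mathcal{F})$ if and only if its scaling function $\mathtt{s}$ is absolutely continuous.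
   Context: A scaling function on $I$ is a strictly increasing continuous function $\mathtt{s}:I\to\mathbb{R}$, normalized by $\mathtt{s}(e)=0$ at a fixed point $e\in I$. Absolute continuity of a function on an open interval means absolute continuity on each compact subinterval. Put $J:=\mathtt{s}(I)$. A function $u$ on $I$ is absolutely continuous with respect to $\mathtt{s}$ if $u=\varphi\circ\mathtt{s}$ with $\varphi$ absolutely continuous on $J$, and then $\frac{du}{d\mathtt{s}}:=\varphi'\circ\mathtt{s}$. Set $\mathcal{E}^{(\mathtt{s},m)}(u,v):=\frac12\int_I\frac{du}{d\mathtt{s}}\frac{dv}{d\mathtt{s}}\,d\mathtt{s}$, and let $\mathcal{F}^{(\mathtt{s},m)}_0$ be the closure of $\{\varphi\circ\mathtt{s}:\varphi\in C_c^\infty(J)\}$ with respect to the norm $\|u\|_{\mathcal{E}_1}=(\mathcal{E}^{(\mathtt{s},m)}(u,u)+\|u\|^2_{L^2(I,m)})^{1/2}$. This is a regular, strongly local Dirichlet form on $L^2(I,m)$. The absolutely continuous part: let $d\mathtt{s}=g\cdot\lambda_I+\kappa$ with $\kappa\perp\lambda_I$ be the Lebesgue decomposition of the Stieltjes measure $d\mathtt{s}$ with respect to Lebesgue measure $\lambda_I$ on $I$; then $\bar{\mathtt{s}}(x):=\int_e^x g(y)\,dy$. When $C_c^\infty(I)\subset\mathcal{F}$, $g>0$ a.e., so $\bar{\mathtt{s}}$ is again a scaling function. The smallest closed extension of $C_c^\infty(I)$ in $(\mathcal{E},\mathcal{F})$ is: $\bar{\mathcal{F}}$ is the $\|\cdot\|_{\mathcal{E}_1}$-closure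 of $C_c^\infty(I)$ in $\mathcal{F}$ and $\bar{\mathcal{E}}$ is the restriction of $\mathcal{E}$ to $\bar{\mathcal{F}}$. Since $C_c^\infty(I)$ always has the algebraic and uniform-density properties of a special standard core, it is a special standard core of $(\mathcal{E},\mathcal{F})$ exactly when it is contained in $\mathcal{F}$ and $\|\cdot\|_{\mathcal{E}_1}$-dense in $\mathcal{F}$. *)

(* Defs.v *)
From HB Require Import structures.
From mathcomp Require Import all_boot all_order all_algebra.
From mathcomp Require Import all_classical all_reals all_analysis measurable_realfun.

Set Implicit Arguments.
Unset Strict Implicit.
Unset Printing Implicit Defensive.

Import Order.TTheory GRing.Theory Num.Theory.
Import numFieldNormedType.Exports.

Local Open Scope classical_set_scope.
Local Open Scope ring_scope.

Definition open_itv {R : realType} (a b : \bar R) : set R :=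
  [set x : R | (a < x%:E < b)%E].

(* Measures on I are represented by Borel measures on R of which only the values
   on Borel subsets of I are ever used. *)
Definition radon_on {R : realType} (I : set R)
    (m : {measure set (measurableTypeR R) -> \bar R}) : Prop :=
  forall K : set R, compact K -> K `<=` I -> (m K < +oo)%E.

Definition fully_supported {R : realType} (I : set R)
    (m : {measure set (measurableTypeR R) -> \bar R}) : Prop :=
  forall U : set R, open U -> U `<=` I -> U !=set0 -> (0 < m U)%E.

Definition scaling_function {R : realType} (I : set R) (e : R) (s : R -> R) :
    Prop :=
  [/\ {in I &, {homo s : x y / x < y}}, {within I, continuous s} & s e = 0].

Definition abs_continuous_cc {R : realType} (x y : R) (f : R -> R) : Prop :=
  forall eps : R, 0 < eps -> exists2 delta : R, 0 < delta &
    forall (n : nat) (p q : 'I_n -> R),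
      (forall i, [/\ x <= p i, p i <= q i & q i <= y]) ->
      trivIset setT (fun i => `]p i, q i[%classic) ->
      \sum_(i < n) (q i - p i) < delta ->
      \sum_(i < n) `|f (q i) - f (p i)| < eps.

Definition abs_continuous_on {R : realType} (U : set R) (f : R -> R) : Prop :=
  forall x y : R, x <= y -> `[x, y]%classic `<=` U -> abs_continuous_cc x y f.

Definition tsupp {R : realType} (f : R -> R) : set R :=
  closure [set x | f x != 0].

Definition Cc {R : realType} (U : set R) : set (R -> R) :=
  [set f | [/\ continuous f, compact (tsupp f) & tsupp f `<=` U]].

Definition Cc_smooth {R : realType} (U : set R) : set (R -> R) :=
  [set f | [/\ forall (n : nat) (x : R), derivable (derive1n n f) x 1,
               compact (tsupp f) & tsupp f `<=` U]].

Definition is_stieltjes_measure {R : realType} (I : set R) (s : R -> R)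
    (mu : {measure set (measurableTypeR R) -> \bar R}) : Prop :=
  mu (~` I) = 0%E /\
  forall x y : R, I x -> I y -> x <= y -> mu `]x, y]%classic = (s y - s x)%:E.

(* The library's lebesgue_stieltjes_measure needs a cumulative function on all of
   R, while s may blow up at the ends of I; [stieltjesP] below shows that the
   default value mzero is not used for a scaling function. *)
Definition stieltjes {R : realType} (I : set R) (s : R -> R) :
    {measure set (measurableTypeR R) -> \bar R} :=
  if pselect (exists mu, is_stieltjes_measure I s mu) is left h
  then projT1 (cid h) else mzero.

Section stieltjes_existence.
Context {R : realType}.
Variables (a b : \bar R) (e : R) (s : R -> R).
Let I := open_itv a b.
Hypothesis ss : scaling_function I e s.

Let I_itv x y z : I x -> I y -> x <= z <= y -> I z.
Proof.
move=> /andP[ax _] /andP[_ yb] /andP[xz zy]; apply/andP; split.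
  by rewrite (lt_le_trans ax)// lee_fin.
by rewrite (le_lt_trans _ yb)// lee_fin.
Qed.

Let s_lt x y : I x -> I y -> x < y -> s x < s y.
Proof. by case: ss => h _ _ Ix Iy; apply: h; rewrite inE. Qed.

Let s_le x y : I x -> I y -> (s x <= s y) = (x <= y).
Proof.
move=> Ix Iy; apply/idP/idP => [|].
  by apply: contraTT; rewrite -!ltNge; exact: s_lt.
by rewrite le_eqVlt => /predU1P[->//|/(s_lt Ix Iy)/ltW].
Qed.

Let s_inj : {in I &, injective s}.
Proof.
move=> x y /[!inE] Ix Iy sxy; apply/eqP; rewrite eq_le.
by rewrite -(s_le Ix Iy) -(s_le Iy Ix) sxy lexx.
Qed.

Let J := s @` I.

Let J_itv : is_interval J.
Proof.
move=> _ _ [x Ix <-] [y Iy <-] z /andP[xz zy].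
have xy : x <= y by rewrite -s_le// (le_trans xz).
have sub : `[x, y]%classic `<=` I.
  by move=> t /=; rewrite in_itv/=; exact: I_itv.
have cs : {within `[x, y], continuous s}.
  by case: ss => _ cs _; exact: continuous_subspaceW cs.
have [|t txy <-] := IVT xy cs (v := z).
  by rewrite ge_min le_max xz zy orbT.
by exists t => //; apply: sub.
Qed.

Let mJ : measurable (J : set (measurableTypeR R)).
Proof. exact: is_interval_measurable. Qed.

Let pinv_s x : I x -> pinv I s (s x) = x.
Proof. by move=> Ix; rewrite (pinvKV _ s_inj)// inE. Qed.

Let mpinv : measurable_fun (J : set (measurableTypeR R))
  (pinv I s : measurableTypeR R -> measurableTypeR R).
Proof.
apply: (measurability (@RGenCInfty.G R)) => [|/= _ [_] [r] -> <-].
  exact: RGenCInfty.measurableE.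
apply: is_interval_measurable => y1 y2 [[x Ix <-] /=].
rewrite in_itv/= andbT pinv_s// => rx [[y Iy <-] _] z /andP[xz zy].
have [t It tz] : J z.
  by apply: (@J_itv (s x) (s y)); [exists x|exists y|apply/andP].
split; first by exists t.
rewrite /= in_itv/= andbT -tz pinv_s//.
by rewrite (le_trans rx)// -s_le// tz.
Qed.

Let h : measurableTypeR R -> measurableTypeR R := pinv I s \_ J.

Let mh : measurable_fun setT h.
Proof. exact/(measurable_restrictT _ mJ). Qed.

Lemma stieltjesP : is_stieltjes_measure I s (stieltjes I s).
Proof.
rewrite /stieltjes; case: pselect => [?|[]]; first by case: cid.
exists (pushforward (mrestr lebesgue_measure mJ) h); split.
  rewrite /= /pushforward /mrestr.
  rewrite (_ : h @^-1` (~` I) `&` J = set0) ?measure0//.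
  apply/seteqP; split=> // y [/= hy [x Ix xy]]; apply: hy.
  by rewrite /h patchE -xy mem_set ?pinv_s//; exists x.
move=> x y Ix Iy xy; rewrite /= /pushforward /mrestr.
rewrite (_ : h @^-1` `]x, y] `&` J = `]s x, s y]%classic); last first.
  apply/seteqP; split=> z /=.
    move=> [/[swap]] [t It <-]; rewrite /h patchE mem_set ?pinv_s//; last by exists t.
    by rewrite !in_itv/= !ltNge !s_le.
  rewrite in_itv/= => /andP[xz zy].
  have [t It tz] : J z.
    by apply: (@J_itv (s x) (s y)); [exists x|exists y|rewrite (ltW xz)].
  split; last by exists t.
  rewrite /h patchE -tz mem_set ?pinv_s//; last by exists t.
  by rewrite in_itv/= ltNge -s_le// -ltNge -(s_le It Iy) tz xz.
rewrite lebesgue_measure_itv/= lte_fin.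
case: ltP => [_|]; first by rewrite EFinB.
rewrite s_le// => yx; have -> : x = y by apply/eqP; rewrite eq_le xy.
by rewrite subrr.
Unshelve. exact: mh.
Qed.

End stieltjes_existence.

Definition ac_wrt {R : realType} (I : set R) (s u : R -> R) : Prop :=
  exists2 phi : R -> R, abs_continuous_on (s @` I) phi &
    forall x, I x -> u x = phi (s x).

(* If u = phi \o s on I, then phi = u \o s^-1 on the open interval s(I), hence
   phi' \o s is computed from u \o s^-1.  Where phi is not derivable, derive1 takes
   a default value; for ac_wrt functions this concerns a null set of ds only. *)
Definition scale_derive {R : realType} (I : set R) (s u : R -> R) : R -> R :=
  fun x => derive1 (u \o pinv I s) (s x).

Definition energy {R : realType} (I : set R) (s u v : R -> R) : R :=
  2^-1 * \int[stieltjes I s]_(x in I) (scale_derive I s u x * scale_derive I s v x).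

Definition E1_norm {R : realType} (I : set R) (s : R -> R)
    (m : {measure set (measurableTypeR R) -> \bar R}) (u : R -> R) : R :=
  Num.sqrt (energy I s u u + \int[m]_(x in I) (u x ^+ 2)).

(* Elements of L^2(I, m) with an s-absolutely continuous version are represented
   by that version (a function on R whose values outside I are irrelevant).  It is
   continuous on I, hence unique when m is fully supported.  All functions
   integrated here are Borel on I. *)
Definition finite_E1 {R : realType} (I : set R) (s : R -> R)
    (m : {measure set (measurableTypeR R) -> \bar R}) : set (R -> R) :=
  [set u | [/\ ac_wrt I s u,
    (\int[stieltjes I s]_(x in I) (scale_derive I s u x ^+ 2)%:E < +oo)%E &
    (\int[m]_(x in I) (u x ^+ 2)%:E < +oo)%E]].

Definition norm_closure {R : realType} (N : (R -> R) -> R)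
    (F C : set (R -> R)) : set (R -> R) :=
  [set u | F u /\ forall eps : R, 0 < eps ->
     exists2 f, C f & N (u \- f) < eps].

Definition minimal_domain {R : realType} (I : set R) (s : R -> R)
    (m : {measure set (measurableTypeR R) -> \bar R}) : set (R -> R) :=
  norm_closure (E1_norm I s m) (finite_E1 I s m)
    [set phi \o s | phi in Cc_smooth (s @` I)].

Definition lebesgue_decomposition {R : realType} (I : set R)
    (mu : {measure set (measurableTypeR R) -> \bar R}) (g : R -> R)
    (kappa : {measure set (measurableTypeR R) -> \bar R}) : Prop :=
  [/\ measurable_fun (I : set (measurableTypeR R)) g,
      (forall x, I x -> 0 <= g x),
      (forall A : set (measurableTypeR R), measurable A -> A `<=` I ->
         mu A = (\int[lebesgue_measure]_(x in A) (g x)%:E + kappa A)%E) &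
      exists N : set (measurableTypeR R), [/\ measurable N, N `<=` I,
        lebesgue_measure N = 0%E & kappa (I `\` N) = 0%E]].

Definition oriented_integral {R : realType} (g : R -> R) (e x : R) : R :=
  if e <= x then \int[lebesgue_measure]_(y in `[e, x]) g y
  else - \int[lebesgue_measure]_(y in `[x, e]) g y.

Record dirichlet_core {R : realType} (I : set R) (N : (R -> R) -> R)
    (F C : set (R -> R)) : Prop := {
  core_dom : C `<=` F;
  core_Cc : C `<=` Cc I;
  core_E1_dense : F `<=` norm_closure N F C;
  core_unif_dense : forall f, Cc I f -> forall eps : R, 0 < eps ->
    exists2 h, C h & forall x, `|f x - h x| < eps
}.

(* Standard core and special standard core in the sense of Fukushima, Oshima and
   Takeda, Dirichlet Forms and Symmetric Markov Processes, Section 1.1. *)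
Record standard_core {R : realType} (I : set R) (N : (R -> R) -> R)
    (F C : set (R -> R)) : Prop := {
  standard_is_core : dirichlet_core I N F C;
  standard_lin : forall (k : R) f h, C f -> C h -> C (k \*o f \+ h);
  standard_contraction : forall eps : R, 0 < eps -> exists phi : R -> R,
    [/\ forall t, 0 <= t <= 1 -> phi t = t,
        forall t, - eps <= phi t <= 1 + eps,
        forall t t', t < t' -> 0 <= phi t' - phi t <= t' - t &
        forall f, C f -> C (phi \o f)]
}.

Record special_standard_core {R : realType} (I : set R) (N : (R -> R) -> R)
    (F C : set (R -> R)) : Prop := {
  special_is_standard : standard_core I N F C;
  special_mul : forall f h, C f -> C h -> C (f \* h);
  special_cutoff : forall K G : set R, compact K -> open G -> K `<=` G ->
    compact (closure G) -> closure G `<=` I ->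
    exists f, [/\ C f, forall x, 0 <= f x,
      forall x, K x -> f x = 1 & forall x, ~ G x -> f x = 0]
}.

(* Main.v *)
(* A function u has an s-derivative h exactly when u(y) - u(x) is the integral
   of h over ]x, y] with respect to ds; call h its ds-density.  Let N be the
   Lebesgue-null set carrying the singular part of ds: the measures ds and dsbar
   agree off N, and dsbar does not charge N.  Hence a function with a
   dsbar-density has a ds-density vanishing on N, and the two energies agree
   on it.

   Testing the hypothesis on a smooth function equal to x on an interval gives a
   density k in L^2(ds) with k g = 1 almost everywhere, so that g > 0 a.e. and
   1/g is locally integrable.  A test function f then has the dsbar-density f'/g.
   Densities that vanish on N still do so in the energy limit, so the closure of
   the test functions consists of functions with a dsbar-density.  Conversely a
   compactly supported function with dsbar-density l is approximated by test
   functions f, because its Lebesgue density l g can be approximated by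
   derivatives f' in L^2(dx/g).

   If test functions are dense then functions of s equal to s on an interval are
   in the closure, hence absolutely continuous with respect to Lebesgue measure.
   If s is absolutely continuous then ds does not charge N, and the
   approximation by test functions applies to the whole domain. *)

Require Import Defs.
From HB Require Import structures.
From mathcomp Require Import all_boot all_order all_algebra.
From mathcomp Require Import all_classical all_reals all_analysis measurable_realfun.
From mathcomp Require Import ring lra.

Set Implicit Arguments.
Unset Strict Implicit.
Unset Printing Implicit Defensive.

Import Order.TTheory GRing.Theory Num.Theory.
Import numFieldNormedType.Exports.

Local Open Scope classical_set_scope.
Local Open Scope ring_scope.

(** * Total variation of absolutely continuous functions *)

(** Densities are the working notion because [scale_derive] is defined pointwise, with default
    values and without a measurability statement, while a density may be altered on null sets, in
    particular set to 0 on N. The link between the two is the Lebesgue theory of absolutely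
    continuous functions, established on the line and transported by s, under which ds becomes
    Lebesgue measure on the image of I. The L^2(I, m) part of the norm is unrelated to ds, and m is
    finite on compact subsets of I. It is therefore controlled by uniform convergence on a fixed
    compact interval. The approximants must then be close in energy, be uniformly close, and vanish
    at both ends of the interval, which is why the approximating derivative is corrected to have
    integral 0. One approximation result with a weight w serves twice: with w = 1 in the scale
    coordinate, and with w = 1/g in the original one. *)

Lemma lebesgue_itv_oc {R : realType} (x y : R) : x <= y ->
  lebesgue_measure (`]x, y]%classic : set (measurableTypeR R)) = (y - x)%:E.
Proof.
move=> xy; rewrite lebesgue_measure_itv/= lte_fin; case: ltP => // yx.
by have -> : x = y; [apply/eqP; rewrite eq_le xy yx|rewrite subrr].
Qed.

Section variation.
Context {R : realType}.
Implicit Types (x y z : R) (f : R -> R).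

Definition subdivision_of (T : finType) x y (p q : T -> R) :=
  (forall i, [/\ x <= p i, p i <= q i & q i <= y]) /\
  trivIset setT (fun i => `]p i, q i[%classic).

Definition increments (T : finType) f (p q : T -> R) : R :=
  \sum_i `|f (q i) - f (p i)|.

(* Subdivisions are indexed by arbitrary finite types, so that concatenating two
   of them is a disjoint sum of index types. *)
Definition variations x y f : set R :=
  [set v | exists (T : finType) (p q : T -> R),
     subdivision_of x y p q /\ v = increments f p q].

Lemma sum_enum_val (V : nmodType) (T : finType) (F : T -> V) :
  \sum_i F i = \sum_(i < #|T|) F (enum_val i).
Proof. by rewrite (eq_bigl (mem T)) //= big_enum_val. Qed.

(** Absolute continuity is defined with index sets ['I_n]; enumerating [T] transports it to any
    finite index type. *)
Lemma abs_continuous_fin x y f eps : abs_continuous_cc x y f -> 0 < eps ->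
  exists2 delta, 0 < delta & forall (T : finType) (p q : T -> R),
    subdivision_of x y p q -> \sum_i (q i - p i) < delta ->
    increments f p q < eps.
Proof.
move=> acf e0; have [d d0 H] := acf _ e0; exists d => // T p q [pq tpq].
rewrite /increments (sum_enum_val (fun i => q i - p i)).
rewrite (sum_enum_val (fun i => `|f (q i) - f (p i)|)) => dl.
apply: (H _ (fun i => p (enum_val i)) (fun i => q (enum_val i))) dl.
- by move=> i; exact: pq.
- by move=> i j _ _ pqij; apply: enum_val_inj; exact: tpq.
Qed.

(** The open intervals are disjoint subsets of [x, y], so Lebesgue measure gives the inequality. *)
Lemma sum_length_le x y (T : finType) (p q : T -> R) : x <= y ->
  subdivision_of x y p q -> \sum_i (q i - p i) <= y - x.
Proof.
move=> xy [pq tpq].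
rewrite -lee_fin -sumEFin.
have -> : (y - x)%:E = lebesgue_measure (`[x, y]%classic : set (measurableTypeR R)).
  rewrite lebesgue_measure_itv/= lte_fin; case: ltP => // yx.
  have -> : x = y by apply/eqP; rewrite eq_le xy yx.
  by rewrite subrr.
rewrite (eq_bigr (fun i => lebesgue_measure (`]p i, q i[%classic : set (measurableTypeR R)))); last first.
  move=> i _; rewrite lebesgue_measure_itv/= lte_fin; case: ltP => // yx.
  have -> : p i = q i by have [_ h _] := pq i; apply/eqP; rewrite eq_le h yx.
  by rewrite subrr.
rewrite (sum_enum_val (fun i => lebesgue_measure _)) -(@measure_bigsetU_ord _ _ _ lebesgue_measure _ xpredT
  (fun i => `]p (enum_val i), q (enum_val i)[%classic))//; last first.
  by move=> i j _ _ pqij; apply: enum_val_inj; exact: tpq.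
apply: le_measure; rewrite ?inE//.
  by apply: bigsetU_measurable => i _; exact: measurable_itv.
rewrite -bigcup_seq => t [i _] /=; rewrite !in_itv/= => /andP[pt tq].
have [xp _ qy] := pq (enum_val i); apply/andP; split.
  exact: le_trans xp (ltW pt).
exact: le_trans (ltW tq) qy.
Qed.

Lemma variations0 x y f : variations x y f 0.
Proof.
exists void, (fun=> x), (fun=> x); split; first by split => -[].
by rewrite /increments big1// => -[].
Qed.

Lemma variations1 x y f : x <= y -> variations x y f `|f y - f x|.
Proof.
move=> xy; exists unit, (fun=> x), (fun=> y); split.
  by split=> // -[] [].
by rewrite /increments (big_pred1 tt)//; case.
Qed.

Lemma variationsS x y x' y' f : x' <= x -> y <= y' ->
  variations x y f `<=` variations x' y' f.
Proof.
move=> xx yy v [T [p [q [[pq tpq] ->]]]]; exists T, p, q; split=> //.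
split=> // i; have [h1 h2 h3] := pq i.
by split=> //; [exact: le_trans h1|exact: le_trans yy].
Qed.

Lemma variationsD x y z f v w : variations x y f v -> variations y z f w ->
  x <= y <= z -> variations x z f (v + w).
Proof.
move=> [T [p [q [[pq tpq] ->]]]] [U [p' [q' [[pq' tpq'] ->]]]] /andP[xy yz].
exists (T + U)%type, (fun i => match i with inl i => p i | inr i => p' i end),
  (fun i => match i with inl i => q i | inr i => q' i end).
split; last first.
  by rewrite /increments big_sumType.
split.
  case=> i.
    by have [h1 h2 h3] := pq i; split => //; exact: le_trans yz.
  by have [h1 h2 h3] := pq' i; split => //; exact: le_trans h1.
case=> i [] j _ _ /= [t [/=]]; rewrite !in_itv/= => /andP[a1 a2] /andP[a3 a4].
- by congr inl; apply: tpq => //; exists t; rewrite /= !in_itv/= a1 a2 a3 a4.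
- exfalso; have [_ _ h1] := pq i; have [h2 _ _] := pq' j; lra.
- exfalso; have [_ _ h1] := pq j; have [h2 _ _] := pq' i; lra.
- by congr inr; apply: tpq' => //; exists t; rewrite /= !in_itv/= a1 a2 a3 a4.
Qed.

(** Every interval is cut at [y] by [min] and [max]. An interval lying on one side of [y] leaves a
    degenerate interval, of increment 0, on the other side. *)
Lemma variations_split x z y f v : x <= y <= z -> variations x z f v ->
  exists v1 v2, [/\ variations x y f v1, variations y z f v2 & v <= v1 + v2].
Proof.
move=> /andP[xy yz] [T [p [q [[pq tpq] ->]]]].
exists (increments f (fun i => Num.min (p i) y) (fun i => Num.min (q i) y)).
exists (increments f (fun i => Num.max (p i) y) (fun i => Num.max (q i) y)).
split.
- exists T, (fun i => Num.min (p i) y), (fun i => Num.min (q i) y); split=> //.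
  split.
    by move=> i; have [h1 h2 h3] := pq i; rewrite /Num.min; do 2 case: ifP => ?; split; lra.
  move=> i j _ _ [t [/=]]; rewrite !in_itv/= => /andP[a1 a2] /andP[a3 a4].
  apply: tpq => //; exists t; rewrite /= !in_itv/=.
  move: a1 a2 a3 a4; rewrite !lt_min !gt_min => /orP a1 /andP[-> b2] /orP a3 /andP[-> _].
  by split; rewrite andbT; [case: a1|case: a3] => //; rewrite ltNge (ltW b2).
- exists T, (fun i => Num.max (p i) y), (fun i => Num.max (q i) y); split=> //.
  split.
    by move=> i; have [h1 h2 h3] := pq i; rewrite /Num.max; do 2 case: ifP => ?; split; lra.
  move=> i j _ _ [t [/=]]; rewrite !in_itv/= => /andP[a1 a2] /andP[a3 a4].
  apply: tpq => //; exists t; rewrite /= !in_itv/=.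
  move: a1 a2 a3 a4; rewrite !gt_max !lt_max => /andP[-> b2] /orP a2 /andP[-> _] /orP a4.
  by split=> /=; [case: a2|case: a4] => //; rewrite ltNge (ltW b2).
- rewrite /increments -big_split/=; apply: ler_sum => i _.
  have [_ h _] := pq i.
  apply: (@le_trans _ _ `|(f (Num.min (q i) y) - f (Num.min (p i) y)) +
    (f (Num.max (q i) y) - f (Num.max (p i) y))|); last exact: ler_normD.
  rewrite le_eqVlt; apply/orP; left; apply/eqP; congr (`| _ |).
  rewrite /Num.min /Num.max; case: ifP => h1; case: ifP => h2; ring.
Qed.

(** If [d] answers the bound 1, the variation on an interval of length at most d / 2 is at most 1.
    Induction on the number of such pieces, splitting off the last one, bounds the variation on
    [x, y]. *)
Lemma variations_bounded x z f : abs_continuous_cc x z f ->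
  exists M, forall y, x <= y <= z -> ubound (variations x y f) M.
Proof.
move=> /abs_continuous_fin/(_ ltr01)[d d0 H].
have bnd (n : nat) y : x <= y <= z -> y <= x + n%:R * (d / 2) ->
    ubound (variations x y f) n%:R.
  elim: n y => [|n IH] y /andP[xy yz] yn.
    have -> : y = x by lra.
    move=> v [T [p [q [[pq tpq] ->]]]]; rewrite /increments big1// => i _.
    have [h1 h2 h3] := pq i.
    by rewrite (_ : q i = p i) ?subrr ?normr0//; lra.
  set y' := Num.min y (x + n%:R * (d / 2)).
  have nd : 0 <= n%:R * (d / 2) by rewrite mulr_ge0// ltW// divr_gt0.
  have y'1 : x <= y' <= y by rewrite le_min ge_min lexx xy/= lerDl nd.
  have y'2 : y' <= x + n%:R * (d / 2) by rewrite ge_min lexx orbT.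
  have y'3 : y - y' <= d / 2.
    rewrite /y' /Num.min; case: ifP => h; first by lra.
    by move: yn; rewrite -natr1; lra.
  move=> v /(variations_split y'1)[v1 [v2 [h1 h2 h3]]].
  rewrite (le_trans h3)// -natr1 lerD//.
    by apply: (IH y') => //; lra.
  case: h2 => T [p [q [pq ->]]]; apply/ltW/H.
    case: pq => pq tpq; split => // i; have [k1 k2 k3] := pq i; split; lra.
  by apply: le_lt_trans (sum_length_le _ pq) _; lra.
exists (Num.truncn ((z - x) / (d / 2))).+1%:R => y /andP[xy yz].
apply: bnd; first by rewrite xy yz.
have /ltW : (z - x) / (d / 2) < (Num.truncn ((z - x) / (d / 2))).+1%:R.
  by rewrite truncnS_gt.
by rewrite ler_pdivrMr ?divr_gt0//; lra.
Qed.

(** [F t] is the total variation of [f] on [x, t]. Its increments are variations of [f] on the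
    intervals concerned. Nearly optimal subdivisions of disjoint intervals together form one
    subdivision of the same total length at most, to which the absolute continuity of [f]
    applies. *)
Lemma variation_function x z f : abs_continuous_cc x z f ->
  exists2 F : R -> R, abs_continuous_cc x z F & forall s t,
    x <= s -> s <= t -> t <= z -> `|f t - f s| <= F t - F s.
Proof.
move=> acf; have [M bM] := variations_bounded acf.
have bV s t : x <= s -> s <= t -> t <= z -> ubound (variations s t f) M.
  move=> xs st tz v vst; apply: (bM t); first by rewrite (le_trans xs).
  exact: variationsS vst.
have hs s t : x <= s -> s <= t -> t <= z -> has_sup (variations s t f).
  move=> xs st tz; split; first by exists 0; exact: variations0.
  by exists M; exact: bV.
pose V s t := sup (variations s t f).
have Vle s t v : x <= s -> s <= t -> t <= z -> variations s t f v -> v <= V s t.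
  by move=> xs st tz vv; apply: ub_le_sup => //; case: (hs _ _ xs st tz).
have V_le s t c : x <= s -> s <= t -> t <= z -> ubound (variations s t f) c ->
    V s t <= c.
  by move=> xs st tz vv; apply: ge_sup => //; case: (hs _ _ xs st tz).
have V1 s t : x <= s -> s <= t -> t <= z -> `|f t - f s| <= V x t - V x s.
  move=> xs st tz; rewrite lerBrDr addrC -lerBrDr.
  apply: V_le; rewrite ?(le_trans st)// => v vv; rewrite lerBrDr.
  apply: Vle => //; first exact: le_trans st.
  apply: variationsD vv _ _; last by rewrite xs st.
  exact: variations1.
have V2 s t : x <= s -> s <= t -> t <= z -> V x t - V x s <= V s t.
  move=> xs st tz; rewrite lerBlDr.
  apply: V_le => //; first exact: le_trans st.
  move=> v; have xst : x <= s <= t by rewrite xs st.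
  move=> /(variations_split xst)[v1 [v2 [h1 h2 h3]]].
  rewrite (le_trans h3)// addrC lerD// Vle//.
  exact: le_trans tz.
exists (V x); last exact: V1.
move=> eps e0; have e20 : 0 < eps / 2 by rewrite divr_gt0.
have [d d0 H] := abs_continuous_fin acf e20.
exists d => // n p q pq tpq dl.
have [xz|zx] := leP x z; last first.
  rewrite big1// => i _; have [] := pq i; lra.
(* Each of the [n] variations is approximated up to [eta], so the total loss is at most eps / 2;
   [n.+1] also covers n = 0. *)
pose eta := eps / 2 / n.+1%:R.
have eta0 : 0 < eta by rewrite divr_gt0.
pose fam := {T : finType & ((T -> R) * (T -> R))%type}.
have [W HW] : {W : 'I_n -> fam & forall i,
    subdivision_of (p i) (q i) (projT2 (W i)).1 (projT2 (W i)).2 /\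
    V (p i) (q i) - eta < increments f (projT2 (W i)).1 (projT2 (W i)).2}.
  apply: (@choice 'I_n fam (fun i w =>
    subdivision_of (p i) (q i) (projT2 w).1 (projT2 w).2 /\
    V (p i) (q i) - eta < increments f (projT2 w).1 (projT2 w).2)) => i.
  have [h1 h2 h3] := pq i.
  have [v [T [p' [q' [pq' ->]]]] ev] := sup_adherent eta0 (hs _ _ h1 h2 h3).
  by exists (existT _ T (p', q')).
(* The dependent sum of the index types concatenates the chosen subdivisions. *)
pose T := {i : 'I_n & projT1 (W i)}.
pose p' (u : T) := (projT2 (W (tag u))).1 (tagged u).
pose q' (u : T) := (projT2 (W (tag u))).2 (tagged u).
have pq' : subdivision_of x z p' q'.
  split=> [[i j]|[i j] [i' j'] _ _]; rewrite /p' /q'/=.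
    have [[/(_ j)[h1 h2 h3] _] _] := HW i; have [k1 k2 k3] := pq i.
    by split => //; [exact: le_trans h1|exact: le_trans k3].
  move=> [t [/=]]; rewrite !in_itv/= => /andP[a1 a2] /andP[a3 a4].
  have [[/(_ j)[b1 b2 b3] tij] _] := HW i.
  have [[/(_ j')[c1 c2 c3] _] _] := HW i'.
  have ii : i = i'.
    apply: tpq => //; exists t; split; rewrite /= in_itv/=; apply/andP; split.
    - exact: le_lt_trans b1 a1.
    - exact: lt_le_trans a2 b3.
    - exact: le_lt_trans c1 a3.
    - exact: lt_le_trans a4 c3.
  subst i'; congr Tagged; apply: tij => //.
  by exists t; rewrite /= !in_itv/= a1 a2 a3 a4.
have sumT (G : forall i, projT1 (W i) -> R) :
    \sum_(u : T) G (tag u) (tagged u) = \sum_i \sum_j G i j.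
  by rewrite sig_big_dep.
have /(H _ _ _ pq') : \sum_u (q' u - p' u) < d.
  rewrite (sumT (fun i j => (projT2 (W i)).2 j - (projT2 (W i)).1 j)).
  apply: le_lt_trans dl; apply: ler_sum => i _.
  by have [_ h _] := pq i; apply: sum_length_le => //; have [] := HW i.
rewrite {1}/increments.
rewrite (sumT (fun i j => `|f ((projT2 (W i)).2 j) - f ((projT2 (W i)).1 j)|)).
move=> incl; apply: (@le_lt_trans _ _ (\sum_(i < n)
    (increments f (projT2 (W i)).1 (projT2 (W i)).2 + eta))).
  apply: ler_sum => i _; have [h1 h2 h3] := pq i; have [_ /ltW] := HW i.
  rewrite ger0_norm; last by apply: le_trans (V1 _ _ h1 h2 h3).
  by rewrite lerBlDr; exact: le_trans (V2 _ _ h1 h2 h3).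
rewrite big_split/= sumr_const card_ord.
rewrite (splitr eps) ltr_leD//.
rewrite -(mulr_natr eta) /eta (mulrAC (eps / 2)) ler_pdivrMr// ler_pM2l// ler_nat.
exact: leqnSn.
Qed.

End variation.

(** * Lebesgue densities of absolutely continuous functions *)

Section density_of_increasing.
Context {R : realType}.
Notation mR := (measurableTypeR R).
Notation leb := (@lebesgue_measure R).

Variables (x z : R) (s : R -> R).
Hypothesis xz : x < z.
Hypothesis ac : abs_continuous_cc x z s.
Variable nu : {measure set mR -> \bar R}.
Hypothesis nuE : forall u v, u <= v -> nu `]u, v]%classic = (s v - s u)%:E.

Let c n k : R := x + (z - x) * k%:R / n.+1%:R.

Let c0 n : c n 0 = x. Proof. by rewrite /c mulr0 mul0r addr0. Qed.
Let cn n : c n n.+1 = z. Proof. by rewrite /c mulfK// addrCA subrr addr0. Qed.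
Let c_le n k l : (k <= l)%N -> c n k <= c n l.
Proof.
by move=> kl; rewrite lerD2l ler_pM2r ?invr_gt0// ler_pM2l ?subr_gt0// ler_nat.
Qed.
Let cS n k : c n k.+1 - c n k = (z - x) / n.+1%:R.
Proof. by rewrite /c opprD addrACA subrr add0r -mulrBl -mulrBr -natr1 addrAC subrr add0r mulr1. Qed.

Let cell n k : set R := `]c n k, c n k.+1]%classic.

Let cell_disj n k l t : cell n k t -> cell n l t -> k = l.
Proof.
rewrite /cell /= !in_itv/= => /andP[h1 h2] /andP[h3 h4].
apply/eqP; rewrite eqn_leq; apply/andP; split; rewrite leqNgt; apply/negP => kl.
  by have := lt_le_trans (lt_le_trans h1 h4) (c_le n kl); rewrite ltxx.
by have := lt_le_trans (lt_le_trans h3 h2) (c_le n kl); rewrite ltxx.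
Qed.

Let cell_ex n t : x < t <= z -> exists2 k, (k < n.+1)%N & cell n k t.
Proof.
move=> /andP[xt tz]; have ex : exists k, t <= c n k by exists n.+1; rewrite cn.
case: (ex_minnP ex) => -[|k]; first by rewrite c0 leNgt xt.
move=> tk kmin; exists k.
  by rewrite -ltnS; apply: leq_ltn_trans (kmin n.+1 _) _; rewrite ?cn.
rewrite /cell /= in_itv/= tk andbT ltNge; apply/negP => /kmin.
by rewrite ltnn.
Qed.

(* U is exhausted by the half-open cells contained in U of the grid of mesh
   (z - x) / (n + 1), to which the absolute continuity of s applies. *)
Let small (eps : R) : 0 < eps -> exists2 delta : R, 0 < delta &
  forall U : set mR, open (U : set R) -> (leb U < delta%:E)%E ->
    (nu (U `&` `]x, z]%classic) <= eps%:E)%E.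
Proof.
move=> e0; have [d d0 H] := abs_continuous_fin ac e0.
exists d => // U oU Ud.
pose p n (k : 'I_n.+1) := c n k.
(* A cell not contained in [U] is collapsed to an empty interval, so that the index type remains
   ['I_n.+1]. *)
pose q n (k : 'I_n.+1) := if `[< cell n k `<=` U >] then c n k.+1 else c n k.
pose V n (k : 'I_n.+1) : set mR := `]p n k, q n k]%classic.
pose W n : set mR := \big[setU/set0]_(k < n.+1) V n k.
have pq n k : p n k <= q n k by rewrite /p /q; case: ifP => // _; exact: c_le.
have Vcell n k : V n k `<=` cell n k.
  by move=> t; rewrite /V /cell /p /q/= !in_itv/=; case: ifP => // _ /andP[h1 /(lt_le_trans h1)]; rewrite ltxx.
have tV n : trivIset setT (V n).
  move=> k l _ _ [t [/Vcell kt /Vcell lt]]; apply/val_inj.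
  exact: cell_disj kt lt.
have mV n k : measurable (V n k) by exact: measurable_itv.
have mW n : measurable (W n) by apply: bigsetU_measurable.
have VU n k : V n k `<=` U.
  move=> t; rewrite /V/= in_itv/= /q; case: asboolP => [h|_ /andP[h1 /(lt_le_trans h1)]]; last by rewrite ltxx.
  by move=> tk; apply: h; rewrite /cell/= in_itv.
have mU : measurable U by exact: open_measurable.
have nuW n : (nu (W n) <= eps%:E)%E.
  rewrite /W measure_bigsetU_ord//.
  rewrite (eq_bigr (fun k => (s (q n k) - s (p n k))%:E)); last first.
    by move=> k _; exact/nuE/pq.
  rewrite sumEFin lee_fin.
  have spq : subdivision_of x z (p n) (q n).
    split=> [k|k l _ _ [t [/= h1 h2]]]; first split=> //.
    - by rewrite -(c0 n); apply: c_le.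
    - rewrite -(cn n) /q; case: ifP => _; apply: c_le; last exact: ltnW.
      exact: ltn_ord.
    - apply: (tV n) => //; exists t; split; apply: subset_itv_oo_oc => //.
  apply/ltW; apply: le_lt_trans (H _ _ _ spq _).
    by apply: ler_sum => k _; exact: ler_norm.
  rewrite -lte_fin; apply: le_lt_trans Ud.
  apply: (@le_trans _ _ (leb (W n))); last first.
    by apply: le_measure; rewrite ?inE// /W -bigcup_seq => t [k _ /VU].
  rewrite /W measure_bigsetU_ord// -sumEFin; apply: lee_sum => k _.
  by apply: (@le_trans _ _ (leb `]p n k, q n k]%classic)) => //; rewrite lebesgue_itv_oc.
(* The grids are not nested, so [W] need not be monotone; these intersections are, and continuity
   from below applies to them. *)
pose G N : set mR := \bigcap_(n in [set n | (N <= n)%N]) W n.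
have mG N : measurable (G N) by apply: bigcap_measurable => //; exists N => /=.
have ndG : nondecreasing_seq G.
  move=> N M NM; apply/subsetPset => t Gt n/= Mn; apply: Gt => /=.
  exact: leq_trans Mn.
have sub : U `&` `]x, z]%classic `<=` \bigcup_N G N.
  move=> t [Ut /=]; rewrite in_itv/= => xtz.
  have /nbhs_ballP[r /= r0 rU] : nbhs (t : R) (U : set R) by exact: open_nbhs_nbhs.
  (* From this index on the mesh is smaller than [r], so the cell containing [t] lies in the ball of
     radius [r] around [t], hence in [U]. *)
  pose N := Num.truncn ((z - x) / r).
  have zr : (z - x) / r < N.+1%:R by rewrite truncnS_gt.
  exists N => // n/= Nn.
  have [k kn kt] := cell_ex n xtz.
  rewrite /W -bigcup_seq; exists (Ordinal kn); first by rewrite /= mem_index_enum.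
  rewrite /V/= /q/= asboolT// => u.
  move: kt; rewrite /cell/= !in_itv/= => /andP[h1 h2] /andP[h3 h4].
  apply: rU; rewrite /ball/= ltr_norml.
  have h5 := cS n k.
  have : (z - x) / n.+1%:R < r.
    rewrite ltr_pdivrMr// mulrC -ltr_pdivrMr//.
    by apply: lt_le_trans zr _; rewrite ler_nat.
  have key (a b t0 u0 : R) : a < t0 -> t0 <= b -> a < u0 -> u0 <= b ->
    b - a < r -> - r < t0 - u0 < r by move=> *; apply/andP; split; lra.
  by rewrite -h5; exact: key.
apply: (@le_trans _ _ (nu (\bigcup_N G N))).
  apply: le_measure; rewrite ?inE//; first exact: measurableI.
  exact: bigcup_measurable.
have cG : (nu \o G) n @[n --> \oo] --> nu (\bigcup_n G n).
  by apply: nondecreasing_cvg_mu => //; exact: bigcup_measurable.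
rewrite -(cvg_lim _ cG)//; apply: lime_le; first by apply/cvg_ex; eexists; exact: cG.
apply: nearW => N /=; apply: le_trans (nuW N).
by apply: le_measure; rewrite ?inE// => t; apply => /=.
Qed.

Let D : set mR := `]x, z]%classic.
Let mD : measurable D. Proof. exact: measurable_itv. Qed.
Let nuD : (nu D < +oo)%E. Proof. by rewrite nuE ?ltW// ltry. Qed.
Let nuR : {finite_measure set mR -> \bar R} := mfrestr mD nuD.

(** Outer regularity covers a Lebesgue null subset of [D] by an open set of small Lebesgue measure,
    whose trace on [D] has small [nu]-measure by [small]. *)
Let nuR_dom : nuR `<< leb.
Proof.
apply/null_content_dominatesP => A mA A0.
apply/eqP; rewrite eq_le measure_ge0 andbT.
apply/lee_addgt0Pr => eps e0; rewrite add0e.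
have [d d0 H] := small e0.
have mAD : measurable (A `&` D) by exact: measurableI.
have AD0 : leb (A `&` D) = 0%E.
  apply/eqP; rewrite eq_le measure_ge0 andbT -A0.
  by apply: le_measure; rewrite ?inE//; exact: subIsetl.
have [|U [oU AU Ud]] := @lebesgue_regularity_outer R (A `&` D) d mAD _ d0.
  by apply: le_lt_trans (ltry 0); rewrite le_eqVlt; apply/orP; left; apply/eqP.
have mU : measurable (U : set mR) by exact: open_measurable.
apply: le_trans (H U oU _).
  change (nu (A `&` D) <= nu (U `&` `]x, z]%classic))%E.
  apply: le_measure; rewrite ?inE//; first exact: measurableI.
  by move=> t [At Dt]; split => //; apply: AU.
apply: le_lt_trans Ud; rewrite -[leRHS]adde0 -AD0.
apply: le_trans (measureU2 _ _ _) => //; last exact: measurableD.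
apply: le_measure; rewrite ?inE//; first by apply: measurableU => //; exact: measurableD.
by move=> t Ut; have [|] := pselect ((A `&` D) t); [right|left].
Qed.

Lemma increasing_density : exists2 h : R -> R, leb.-integrable D (EFin \o h) &
  forall u v, x <= u -> u <= v -> v <= z ->
    s v - s u = \int[leb]_(t in `]u, v]) h t.
Proof.
have [f [f0 ffin intf fE]] := radon_nikodym_sigma_finite nuR_dom.
have fh : f = EFin \o (fine \o f) by apply/funext => t /=; rewrite fineK.
exists (fine \o f); first by rewrite -fh; exact: integrableS intf.
move=> u v xu uv vz; rewrite /Rintegral.
rewrite (_ : (fun t => ((fine \o f) t)%:E) = f) // -fE//.
rewrite /nuR /= /mfrestr /mrestr setIidl ?nuE//.
move=> t /=; rewrite /D /= !in_itv/= => /andP[h1 h2].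
by rewrite (le_lt_trans xu) //= (le_trans h2).
Qed.

End density_of_increasing.

Section density_of_ac.
Context {R : realType}.
Notation mR := (measurableTypeR R).
Notation leb := (@lebesgue_measure R).

Lemma integrable_cst_oc (x y c : R) : x <= y ->
  leb.-integrable (`]x, y]%classic : set mR) (EFin \o cst c).
Proof.
move=> xy; apply: (@measurable_bounded_integrable _ mR) => //.
  by have := ltry (y - x); rewrite -(lebesgue_itv_oc xy).
exists `|c|; split; first exact: num_real.
by move=> M cM t _ /=; rewrite ltW.
Qed.

Lemma integral_cst_oc (x y c : R) : x <= y ->
  (\int[leb]_(t in `]x, y]) c%:E = (c * (y - x))%:E)%E.
Proof.
move=> xy; rewrite integral_cst// EFinM; congr (_ * _)%E.
exact: lebesgue_itv_oc.
Qed.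

Lemma Rintegral_cst_oc (x y c : R) : x <= y ->
  \int[leb]_(t in `]x, y]) c = c * (y - x).
Proof.
move=> xy; rewrite Rintegral_cst//; congr (_ * _).
exact: (congr1 fine (lebesgue_itv_oc xy)).
Qed.

Lemma ac_shift (x z : R) f c : abs_continuous_cc x z f ->
  abs_continuous_cc x z (fun t => f t + c).
Proof.
move=> H eps e0; have [d d0 Hd] := H _ e0; exists d => // n p q pq tpq dl.
by under eq_bigr do rewrite opprD addrACA subrr addr0; exact: Hd.
Qed.

Lemma ac_id (x z : R) : abs_continuous_cc x z idfun.
Proof.
move=> eps e0; exists eps => // n p q pq tpq dl.
rewrite (eq_bigr (fun i => q i - p i))// => i _.
by have [_ h _] := pq i; rewrite ger0_norm// subr_ge0.
Qed.

Lemma acD (x z : R) f g : abs_continuous_cc x z f -> abs_continuous_cc x z g ->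
  abs_continuous_cc x z (f \+ g).
Proof.
move=> H1 H2 eps e0; have e20 : 0 < eps / 2 by rewrite divr_gt0.
have [d1 d10 {}H1] := H1 _ e20; have [d2 d20 {}H2] := H2 _ e20.
exists (Num.min d1 d2); first by rewrite lt_min d10.
move=> n p q pq tpq; rewrite lt_min => /andP[dl1 dl2].
rewrite (splitr eps); apply: le_lt_trans (ltrD (H1 n p q pq tpq dl1) (H2 n p q pq tpq dl2)).
rewrite -big_split/=; apply: ler_sum => i _.
by rewrite opprD addrACA; exact: ler_normD.
Qed.

Lemma acN (x z : R) f : abs_continuous_cc x z f ->
  abs_continuous_cc x z (fun t => - f t).
Proof.
move=> H eps e0; have [d d0 Hd] := H _ e0; exists d => // n p q pq tpq dl.
by under eq_bigr do rewrite -opprD normrN; exact: Hd.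
Qed.

Lemma ac_continuous (x z : R) f : abs_continuous_cc x z f ->
  forall eps, 0 < eps -> exists2 d, 0 < d & forall u v,
    x <= u <= z -> x <= v <= z -> `|u - v| < d -> `|f u - f v| < eps.
Proof.
move=> H eps e0; have [d d0 Hd] := H _ e0; exists d => //.
have hw u v : x <= u -> u <= v -> v <= z -> `|u - v| < d -> `|f u - f v| < eps.
  move=> xu uv vz dd.
  have := Hd 1%N (fun=> u) (fun=> v); rewrite !big_ord1 (distrC (f u)); apply => //.
    by move=> i j _ _ _; rewrite !ord1.
  by move: dd; rewrite distrC ger0_norm// subr_ge0.
move=> u v /andP[xu uz] /andP[xv vz] dd; have [uv|/ltW vu] := leP u v.
  exact: hw.
by rewrite distrC; apply: hw => //; rewrite distrC.
Qed.

Lemma nondecreasing_ac_density (x z : R) F : x < z ->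
  abs_continuous_cc x z F ->
  (forall u v, x <= u -> u <= v -> v <= z -> F u <= F v) ->
  exists2 h : R -> R, leb.-integrable (`]x, z]%classic : set mR) (EFin \o h) &
  forall u v, x <= u -> u <= v -> v <= z ->
    F v - F u = \int[leb]_(t in `]u, v]) h t.
Proof.
move=> xz acF ndF; have xz' := ltW xz.
(* Projection onto [x, z]: composing [F] with it extends [F] to a continuous nondecreasing function
   on the whole line. *)
pose cl t := Num.max x (Num.min z t).
have clE t : x <= t <= z -> cl t = t.
  by move=> /andP[h1 h2]; rewrite /cl /Num.max /Num.min; case: ifP; case: ifP; lra.
have clb t : x <= cl t <= z.
  by rewrite /cl /Num.max /Num.min; do 2 case: ifP; lra.
have cl_le u v : u <= v -> cl u <= cl v.
  by rewrite /cl /Num.max /Num.min; do 4 case: ifP; lra.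
have cl1 u v : `|cl u - cl v| <= `|u - v|.
  wlog uv : u v / u <= v => [hw|].
    by have [/hw//|/ltW/hw] := leP u v; rewrite distrC (distrC v).
  rewrite distrC (distrC u) !ger0_norm ?subr_ge0 ?cl_le//.
  by move: uv; rewrite /cl /Num.max /Num.min; do 4 case: ifP; lra.
(* Adding the identity makes F strictly increasing, hence a scaling function with
   a Stieltjes measure. *)
pose s t := F (cl t) + t - F (cl 0).
have s_lt u v : u < v -> s u < s v.
  move=> uv; have /ndF : x <= cl u by case/andP: (clb u).
  move=> /(_ (cl v) (cl_le _ _ (ltW uv))); have /andP[_ ->] := clb v.
  by rewrite /s => /(_ isT); lra.
have FC : continuous (fun t => F (cl t)).
  move=> t; apply/cvgrPdist_lt => eps e0.
  have [d d0 Hd] := ac_continuous acF e0.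
  near=> u; apply: Hd => //; apply: le_lt_trans (cl1 _ _) _.
  by near: u; exists d.
have sc : continuous s.
  move=> t; rewrite /s; apply: cvgB; last exact: cvg_cst.
  apply: cvgD; [exact: FC|exact: cvg_id].
pose I := @open_itv R -oo%E +oo%E.
have IT t : I t by rewrite /I /open_itv/= ltNyr ltry.
have scf : scaling_function I 0 s.
  split; first by move=> u v _ _; exact: s_lt.
    exact: continuous_subspaceT.
  by rewrite /s addr0 subrr.
have [_ sP] := stieltjesP scf.
have acs : abs_continuous_cc x z s.
  apply: ac_shift; apply: acD; last exact: ac_id.
  move=> eps e0; have [d d0 Hd] := acF _ e0; exists d => // n p q pq tpq dl.
  rewrite (eq_bigr (fun i => `|F (q i) - F (p i)|)); first exact: Hd.
  by move=> i _; have [h1 h2 h3] := pq i; rewrite !clE// ?(le_trans _ h3)//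
    ?h2 ?h1 ?h3// ?(le_trans h1)//.
have [h hint hE] := increasing_density xz acs
  (fun u v uv => sP u v (IT u) (IT v) uv).
(* The 1 removed here is the density of the identity that was added to [F]. *)
exists (fun t => h t - 1).
  rewrite (_ : EFin \o _ = ((EFin \o h) \- (EFin \o cst 1%R))%E); last first.
    by apply/funext => t /=; rewrite EFinB.
  apply: integrableB => //; exact: integrable_cst_oc.
move=> u v xu uv vz.
have ih : leb.-integrable (`]u, v]%classic : set mR) (EFin \o h).
  apply: integrableS hint => // t /=; rewrite !in_itv/= => /andP[h1 h2].
  by rewrite (le_lt_trans xu)//= (le_trans h2).
have i1 : leb.-integrable (`]u, v]%classic : set mR) (EFin \o cst 1).
  exact: integrable_cst_oc.
rewrite RintegralB// -hE// Rintegral_cst_oc// mul1r.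
rewrite /s (clE u) ?xu ?(le_trans uv)// (clE v) ?(le_trans xu)//; ring.
Unshelve. all: by end_near. Qed.

(** Jordan decomposition: with the variation function [F], both [F] and [F - f] are nondecreasing
    and absolutely continuous, and [f] is their difference. *)
Lemma ac_density (x z : R) f : x < z -> abs_continuous_cc x z f ->
  exists2 h : R -> R, leb.-integrable (`]x, z]%classic : set mR) (EFin \o h) &
  forall u v, x <= u -> u <= v -> v <= z ->
    f v - f u = \int[leb]_(t in `]u, v]) h t.
Proof.
move=> xz acf; have [F acF fF] := variation_function acf.
have [h1 ih1 E1] : exists2 h : R -> R, leb.-integrable (`]x, z]%classic : set mR) (EFin \o h) &
    forall u v, x <= u -> u <= v -> v <= z -> F v - F u = \int[leb]_(t in `]u, v]) h t.
  apply: nondecreasing_ac_density => // u v xu uv vz.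
  by rewrite -subr_ge0; apply: le_trans (fF _ _ xu uv vz).
have [h2 ih2 E2] : exists2 h : R -> R, leb.-integrable (`]x, z]%classic : set mR) (EFin \o h) &
    forall u v, x <= u -> u <= v -> v <= z ->
      (F \+ (fun t => - f t)) v - (F \+ (fun t => - f t)) u = \int[leb]_(t in `]u, v]) h t.
  apply: nondecreasing_ac_density => //; first exact/acD/acN.
  move=> u v xu uv vz /=.
  have := le_trans (ler_norm _) (fF _ _ xu uv vz); lra.
exists (fun t => h1 t - h2 t).
  rewrite (_ : EFin \o _ = ((EFin \o h1) \- (EFin \o h2))%E); last first.
    by apply/funext => t /=; rewrite EFinB.
  exact: integrableB.
move=> u v xu uv vz.
have sub : `]u, v]%classic `<=` `]x, z]%classic.
  move=> t /=; rewrite !in_itv/= => /andP[k1 k2].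
  by rewrite (le_lt_trans xu)//= (le_trans k2).
rewrite RintegralB//; [|exact: integrableS ih1|exact: integrableS ih2].
by rewrite -E1// -E2//=; ring.
Qed.

End density_of_ac.

(** * Measures and integrals on an open interval *)

Section local_measures.
Context {R : realType}.
Notation mR := (measurableTypeR R).
Implicit Types (I : set R) (mu nu : {measure set mR -> \bar R}).

Lemma interval_mem I x y z : is_interval I -> I x -> I y -> x <= z <= y -> I z.
Proof. by move=> iI Ix Iy /andP[xz zy]; apply: (iI x y) => //; rewrite xz zy. Qed.

Lemma interval_sub I (x y : R) b1 b2 : is_interval I -> I x -> I y ->
  [set` Interval (BSide b1 x) (BSide b2 y)] `<=` I.
Proof.
move=> iI Ix Iy z /=; rewrite in_itv/= => /andP[xz zy].
apply: (@interval_mem I x y) => //.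
by rewrite (lteifW xz) (lteifW zy).
Qed.

Lemma open_interval_points I x : open I -> I x ->
  exists y z, [/\ I y, I z & y < x < z].
Proof.
move=> oI Ix; have /nbhs_ballP[r /= r0 rI] : nbhs x I by exact: open_nbhs_nbhs.
exists (x - r / 2), (x + r / 2); split; first last.
- by apply/andP; split; lra.
- by apply: rI; rewrite /ball/= opprD addrA subrr add0r normrN gtr0_norm; lra.
- by apply: rI; rewrite /ball/= opprB addrCA subrr addr0 gtr0_norm; lra.
Qed.

(** Reduces statements on I to intervals with endpoints in I, on which the measures and integrals
    concerned are finite. *)
Lemma open_interval_cover I x0 : open I -> is_interval I -> I x0 ->
  exists c : nat -> R * R,
    (forall n, [/\ I (c n).1, I (c n).2 & (c n).1 <= (c n).2]) /\
    (forall t, I t -> exists n, (c n).1 < t < (c n).2).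
Proof.
move=> oI iI I0.
(* Pairs of rational points of I are enumerated; every other code yields the degenerate pair
   [(x0, x0)], which covers nothing. *)
pose c n : R * R := if unpickle n is Some (p, q) then
  if pselect [/\ I (ratr p), I (ratr q) & ratr p <= (ratr q : R)]
  then (ratr p, ratr q) else (x0, x0) else (x0, x0).
exists c; split.
  by move=> n; rewrite /c; case: unpickle => [[p q]|//]; case: pselect.
move=> t It; have [y [z [Iy Iz /andP[yt tz]]]] := open_interval_points oI It.
have [p] := rat_in_itvoo yt; rewrite in_itv/= => /andP[yp pt].
have [q] := rat_in_itvoo tz; rewrite in_itv/= => /andP[tq qz].
exists (pickle (p, q)); rewrite /c pickleK; case: pselect => [_|]/=; first by rewrite pt.
case; split; last by rewrite ltW// (lt_trans pt).
- by apply: (@interval_mem I y z) => //; rewrite (ltW yp) ltW// (lt_trans pt)// (lt_trans tq).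
- by apply: (@interval_mem I y z) => //; rewrite (ltW qz) andbT ltW// (lt_trans yt)// (lt_trans tq).
Qed.

Lemma measure_eq_local I mu nu (A : set mR) : open I -> is_interval I ->
  (forall x y, I x -> I y -> x <= y -> forall B : set mR, measurable B ->
     B `<=` A `&` `]x, y]%classic -> mu B = nu B) ->
  measurable A -> A `<=` I -> mu A = nu A.
Proof.
move=> oI iI H mA AI.
have [->|/set0P[x0 Ax0]] := eqVneq A set0; first by rewrite !measure0.
have [c [c1 c2]] := open_interval_cover oI iI (AI _ Ax0).
pose B n : set mR := A `&` `](c n).1, (c n).2]%classic.
have mB n : measurable (B n) by apply: measurableI.
have mD n : measurable (seqDU B n).
  by apply: measurableD => //; apply: bigsetU_measurable.
have -> : A = \bigcup_n seqDU B n.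
  rewrite -seqDU_bigcup_eq; apply/seteqP; split; last by move=> t [n _ []].
  move=> t At; have [n /andP[h1 h2]] := c2 _ (AI _ At).
  by exists n => //; split => //=; rewrite in_itv/= h1 ltW.
rewrite !measure_bigcup//.
apply: eq_eseriesr => n _; have [k1 k2 k3] := c1 n.
by apply: (H _ _ k1 k2 k3) => // t [].
Qed.

Lemma measure_null_local I mu (A : set mR) : open I -> is_interval I ->
  (forall x y, I x -> I y -> x <= y -> mu (A `&` `]x, y]%classic) = 0%E) ->
  measurable A -> A `<=` I -> mu A = 0%E.
Proof.
move=> oI iI H mA AI; rewrite (@measure_eq_local I mu mzero A)// => x y Ix Iy xy B mB BA.
change (mu B = 0%E); apply/eqP; rewrite eq_le measure_ge0 andbT -(H x y Ix Iy xy).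
by apply: le_measure; rewrite ?inE//; apply: measurableI.
Qed.

Lemma ae_mono mu (P Q : R -> Prop) : (forall t, P t -> Q t) ->
  (\forall t \ae mu, P t) -> \forall t \ae mu, Q t.
Proof.
by move=> PQ; apply: filterS PQ; exact: (ae_filter_ringOfSetsType mu).
Qed.

Lemma ae_local I mu (P : R -> Prop) : open I -> is_interval I ->
  (forall x y, I x -> I y -> x <= y -> \forall t \ae mu, x < t < y -> P t) ->
  \forall t \ae mu, I t -> P t.
Proof.
move=> oI iI H; have [[x0 I0]|I0] := pselect (exists x, I x); last first.
  by apply: (@aeW _ _ _ mu) => t It; exfalso; apply: I0; exists t.
have [c [c1 c2]] := open_interval_cover oI iI I0.
have : \forall t \ae mu, forall n, (c n).1 < t < (c n).2 -> P t.
  by apply: ae_foralln => n; have [k1 k2 k3] := c1 n; exact: H.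
by apply: ae_mono => t Ht /c2[n]; exact: Ht.
Qed.

(** Half-open intervals form a pi-system generating the Borel sets, and the sets on which the
    integrals agree form a Dynkin system. The functions may change sign; integrability is what
    permits complements and countable disjoint unions. *)
Lemma integral_eq_itv mu nu (x y : R) (h k : R -> R) :
  x <= y ->
  mu.-integrable (`]x, y]%classic : set mR) (EFin \o h) ->
  nu.-integrable (`]x, y]%classic : set mR) (EFin \o k) ->
  (forall p q, x <= p -> p <= q -> q <= y ->
    \int[mu]_(t in `]p, q]) h t = \int[nu]_(t in `]p, q]) k t) ->
  forall A : set mR, measurable A -> A `<=` `]x, y]%classic ->
    (\int[mu]_(t in A) (h t)%:E = \int[nu]_(t in A) (k t)%:E)%E.
Proof.
move=> xy ih ik hk A mA AD.
set D : set mR := `]x, y]%classic.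
have mD : measurable D by exact: measurable_itv.
have fin1 (B : set mR) : measurable B -> B `<=` D -> (\int[mu]_(t in B) (h t)%:E)%E \is a fin_num.
  by move=> mB BD; apply: integrable_fin_num => //; exact: integrableS ih.
have fin2 (B : set mR) : measurable B -> B `<=` D -> (\int[nu]_(t in B) (k t)%:E)%E \is a fin_num.
  by move=> mB BD; apply: integrable_fin_num => //; exact: integrableS ik.
have hkE p q : x <= p -> p <= q -> q <= y ->
    (\int[mu]_(t in `]p, q]) (h t)%:E = \int[nu]_(t in `]p, q]) (k t)%:E)%E.
  move=> xp pq qy; have := hk _ _ xp pq qy; rewrite /Rintegral.
  have sub : `]p, q]%classic `<=` D.
    move=> t; rewrite /D/= !in_itv/= => /andP[h1 h2].
    by rewrite (le_lt_trans xp)//= (le_trans h2).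
  by move/(congr1 (@EFin R)); rewrite !fineK ?fin1 ?fin2.
pose P (B : set mR) := (\int[mu]_(t in D `&` B) (h t)%:E = \int[nu]_(t in D `&` B) (k t)%:E)%E.
have PT : P setT by rewrite /P setIT; exact: hkE.
suff : P A by rewrite /P setIidr.
apply: (@dynkin_induction _ mR (@ocitv R) P) => //.
- by move=> B C; exact: ocitvI.
- move=> _ [[p q] _ <-]/=; rewrite /P.
  have -> : D `&` `]p, q]%classic = `]Num.max x p, Num.min y q]%classic.
    apply/seteqP; split => t; rewrite /D/= !in_itv/= gt_max le_min.
      by move=> [/andP[-> ->] /andP[-> ->]].
    by move=> /andP[/andP[-> ->] /andP[-> ->]].
  have [pq|pq] := leP (Num.max x p) (Num.min y q).
    by apply: hkE => //; rewrite ?le_max ?ge_min lexx.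
  rewrite (_ : `]_, _]%classic = set0) ?integral_set0//.
  by apply/seteqP; split => t //=; rewrite in_itv/= => /andP[h1 /(lt_le_trans h1)/(lt_trans pq)]; rewrite ltxx.
- move=> S mS PS; have mDS : measurable (D `&` S) by exact: measurableI.
  have mDCS : measurable (D `&` ~` S) by apply: measurableI => //; exact: measurableC.
  have dj : [disjoint (D `&` S) & (D `&` ~` S)].
    by apply/disj_setPS => t [[_ St] [_]].
  have DE : D = (D `&` S) `|` (D `&` ~` S) by rewrite -setIUr setUv setIT.
  have : (\int[mu]_(t in (D `&` S) `|` (D `&` ~` S)) (h t)%:E =
         \int[nu]_(t in (D `&` S) `|` (D `&` ~` S)) (k t)%:E)%E.
    by rewrite -DE; exact: hkE.
  rewrite integral_setU//; last by rewrite -DE; exact: measurable_int ih.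
  rewrite integral_setU//; last by rewrite -DE; exact: measurable_int ik.
  have [sD1 sD2] : D `&` S `<=` D /\ D `&` ~` S `<=` D by split => t [].
  rewrite PS /P -(fineK (fin2 _ mDS sD1)) -(fineK (fin1 _ mDCS sD2)).
  rewrite -(fineK (fin2 _ mDCS sD2)).
  by move=> /eqP; rewrite -!EFinD eqe => /eqP/addrI ->.
- move=> F mF tF PF; rewrite /P setI_bigcupr !integral_bigcup//.
  + by apply: eq_eseriesr => n _; exact: PF.
  + by apply/trivIset_setIl.
  + by move=> n; exact: measurableI.
  + by rewrite -setI_bigcupr; apply: integrableS ik => //; apply: measurableI => //; exact: bigcup_measurable.
  + by apply/trivIset_setIl.
  + by move=> n; exact: measurableI.
  + by rewrite -setI_bigcupr; apply: integrableS ih => //; apply: measurableI => //; exact: bigcup_measurable.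
Qed.

End local_measures.

(** * Integrals against a density, null sets and tails *)

Section integral_facts.
Import HBNNSimple.
Context {R : realType}.
Notation mR := (measurableTypeR R).
Implicit Types (mu nu : {measure set mR -> \bar R}).

(** Restricted to [D], [nu] is finite and dominated by [mu], and [g] is almost everywhere its
    Radon-Nikodym derivative, so the change of variables formula for that derivative applies. *)
Lemma integral_density nu (mu : {sigma_finite_measure set mR -> \bar R})
    (D : set mR) (g : R -> R) : measurable D ->
  measurable_fun D g -> (forall t, D t -> 0 <= g t) -> (nu D < +oo)%E ->
  (forall A : set mR, measurable A -> A `<=` D ->
     nu A = (\int[mu]_(t in A) (g t)%:E)%E) ->
  forall f : R -> R, measurable_fun D f -> (forall t, D t -> 0 <= f t) ->
  (\int[nu]_(t in D) (f t)%:E = \int[mu]_(t in D) (f t * g t)%:E)%E.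
Proof.
move=> mD mg g0 nuDoo nuE f mf f0.
pose nuD : {finite_measure set mR -> \bar R} := mfrestr mD nuDoo.
have nuDE A : measurable A -> nuD A = (\int[mu]_(t in A) ((g \_ D) t)%:E)%E.
  move=> mA; rewrite (_ : nuD A = nu (A `&` D))// nuE; last by move=> t [].
    by rewrite integral_mkcondr; apply: eq_integral => t _; rewrite restrict_EFin.
  exact: measurableI.
have mgD : measurable_fun setT (g \_ D) by exact/(measurable_restrictT _ mD).
have dom : nuD `<< mu.
  apply/null_content_dominatesP => A mA A0; rewrite nuDE//.
  by rewrite null_set_integral//; apply/measurable_EFinP; exact: measurable_funTS.
have igD : mu.-integrable setT (EFin \o (g \_ D)).
  apply/integrableP; split; first exact/measurable_EFinP.
  rewrite (eq_integral (EFin \o (g \_ D))); last first.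
    move=> t _ /=; rewrite ger0_norm// patchE; case: ifPn => // /set_mem; exact: g0.
  by rewrite -nuDE// (_ : nuD setT = nu (setT `&` D))// setTI.
have aeg : ae_eq mu setT (Radon_Nikodym_SigmaFinite.f nuD mu) (EFin \o (g \_ D)).
  apply: integral_ae_eq => //.
  - exact: Radon_Nikodym_SigmaFinite.f_integrable.
  - exact/measurable_EFinP.
  - move=> E _ mE; rewrite -Radon_Nikodym_SigmaFinite.f_integral//.
    exact: nuDE.
have mfD : measurable_fun setT (f \_ D) by exact/(measurable_restrictT _ mD).
have fD0 t : (0 <= ((f \_ D) t)%:E)%E.
  by rewrite lee_fin patchE; case: ifPn => // /set_mem; exact: f0.
transitivity (\int[nuD]_(t in D) ((f \_ D) t)%:E)%E.
  transitivity (\int[nuD]_(t in D) (f t)%:E)%E.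
    by apply: eq_measure_integral => A mA AD; change (nu A = nu (A `&` D)); rewrite setIidl.
  by apply: eq_integral => t tD; rewrite patchE tD.
rewrite -(@Radon_Nikodym_SigmaFinite.change_of_variables _ _ _ _ _ dom)//; last first.
  by apply: measurable_funTS; exact/measurable_EFinP.
transitivity (\int[mu]_(t in D) (((f \_ D) t)%:E * ((g \_ D) t)%:E))%E; last first.
  by apply: eq_integral => t tD; rewrite !patchE tD EFinM.
apply: ge0_ae_eq_integral => //.
- apply: emeasurable_funM; apply: measurable_funTS; first exact/measurable_EFinP.
  exact: measurable_int (Radon_Nikodym_SigmaFinite.f_integrable dom).
- by apply: emeasurable_funM; apply: measurable_funTS; exact/measurable_EFinP.
- by move=> t Dt; apply: mule_ge0 => //; exact: Radon_Nikodym_SigmaFinite.f_ge0.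
- move=> t Dt; apply: mule_ge0 => //.
  by rewrite lee_fin patchE; case: ifPn => // /set_mem; exact: g0.
- by apply: filterS aeg => t + _ => /(_ I) ->.
Qed.

Lemma integral_density_signed nu (mu : {sigma_finite_measure set mR -> \bar R})
    (D : set mR) (g : R -> R) : measurable D ->
  measurable_fun D g -> (forall t, D t -> 0 <= g t) -> (nu D < +oo)%E ->
  (forall A : set mR, measurable A -> A `<=` D ->
     nu A = (\int[mu]_(t in A) (g t)%:E)%E) ->
  forall f : R -> R, measurable_fun D f ->
  (\int[nu]_(t in D) (f t)%:E = \int[mu]_(t in D) (f t * g t)%:E)%E.
Proof.
move=> mD mg g0 nuDoo nuE f mf.
rewrite integralE [RHS]integralE; congr (_ - _)%E.
  transitivity (\int[nu]_(t in D) (Num.max (f t) 0)%:E)%E.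
    by apply: eq_integral => t _; rewrite funeposE EFin_max.
  rewrite (integral_density mD mg g0 nuDoo nuE)//; last 2 first.
  - by apply: measurable_maxr.
  - by move=> t _; rewrite le_max lexx orbT.
  apply: eq_integral => t /[!inE] Dt; rewrite funeposE -EFin_max.
  by congr EFin; rewrite maxr_pMl ?g0// mul0r.
transitivity (\int[nu]_(t in D) (Num.max (- f t) 0)%:E)%E.
  by apply: eq_integral => t _; rewrite funenegE EFin_max.
rewrite (integral_density mD mg g0 nuDoo nuE)//; last 2 first.
- by apply: measurable_maxr => //; exact: measurableT_comp.
- by move=> t _; rewrite le_max lexx orbT.
apply: eq_integral => t /[!inE] Dt; rewrite funenegE -EFinN -EFin_max.
by congr EFin; rewrite maxr_pMl ?g0// mul0r mulNr.
Qed.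

(* The integral of a non-measurable function is a supremum over the simple
   functions below it, so it does not see null sets either. *)
Lemma integral_ae_eq_nonmeas mu (D Z : set mR) (f k : mR -> \bar R) :
  measurable D -> measurable Z -> mu Z = 0%E ->
  (forall t, D t -> ~ Z t -> f t = k t) ->
  (\int[mu]_(t in D) f t = \int[mu]_(t in D) k t)%E.
Proof.
move=> mD mZ Z0.
suff le (u v : mR -> \bar R) : (forall t, (0 <= u t)%E) -> (forall t, (0 <= v t)%E) ->
    (forall t, ~ Z t -> u t = v t) -> (\int[mu]_t u t <= \int[mu]_t v t)%E.
  have eqn (u v : mR -> \bar R) : (forall t, (0 <= u t)%E) -> (forall t, (0 <= v t)%E) ->
      (forall t, ~ Z t -> u t = v t) -> (\int[mu]_t u t = \int[mu]_t v t)%E.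
    by move=> u0 v0 uv; apply/eqP; rewrite eq_le !le// => t /uv.
  move=> fk; rewrite integralE [RHS]integralE; congr (_ - _)%E;
    rewrite integral_mkcond [RHS]integral_mkcond; apply: eqn => t;
    rewrite ?patchE; (try by case: ifP => // _; rewrite ?funepos_ge0 ?funeneg_ge0).
    by move=> Zt; case: ifPn => // /set_mem Dt; rewrite !funeposE fk.
  by move=> Zt; case: ifPn => // /set_mem Dt; rewrite !funenegE fk.
move=> u0 v0 uv; rewrite ge0_integralTE//.
apply: ge_ereal_sup => _ [h hu <-].
(* Setting the simple function to 0 on [Z] leaves its integral unchanged and brings it below [v]
   everywhere. *)
pose h' := proj_nnsfun h (measurableC mZ).
have h'E t : h' t = h t * \1_(~` Z) t by [].
have -> : sintegral mu h = sintegral mu h'.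
  rewrite -!integralT_nnsfun.
  rewrite (ge0_negligible_integral mZ)//; last 2 first.
  - exact/measurable_EFinP.
  - by move=> t _; rewrite lee_fin.
  rewrite [RHS](ge0_negligible_integral mZ)//; last 2 first.
  - exact/measurable_EFinP.
  - by move=> t _; rewrite lee_fin.
  apply: eq_integral => t /[!inE] -[_ Zt].
  by rewrite h'E indicE mem_set// mulr1.
rewrite [leRHS]ge0_integralTE//; apply: ereal_sup_ubound; exists h' => // t.
rewrite h'E indicE; have [Zt|Zt] := pselect (Z t).
  by rewrite memNset ?mulr0//; apply.
by rewrite mem_set// mulr1 -uv.
Qed.

Lemma measurable_fun_tail (D : set mR) (f p : R -> R) (c : R) : measurable D ->
  measurable_fun D f -> measurable_fun D p ->
  measurable_fun D (fun t => if p t <= c then 0 else `|f t|).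
Proof.
move=> mD mf mp; apply: measurable_fun_if => //; first exact: measurable_fun_ler.
have mnf : measurable_fun D (fun t => `|f t|) by exact: measurableT_comp.
exact: (measurable_funS mD (@subIsetl _ _ _) mnf).
Qed.

(** Dominated convergence with bound |f|: at each point the integrand vanishes once [M] exceeds [p].
    The control [p] is separate from [f] because a weighted square is cut off below according to the
    size of the unweighted function. *)
Lemma integrable_tail mu (D : set mR) (f p : R -> R) eps : measurable D ->
  mu.-integrable D (EFin \o f) -> measurable_fun D p -> 0 < eps ->
  exists M : nat,
    (\int[mu]_(t in D) (if p t <= M%:R then 0 else `|f t|)%:E < eps%:E)%E.
Proof.
move=> mD fi mp e0; apply: contrapT => noM.
have mf : measurable_fun D f by by apply/measurable_EFinP; exact: measurable_int fi.
pose F (n : nat) t := (if p t <= n%:R then 0 else `|f t|)%:E : \bar R.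
have mF n : measurable_fun D (F n).
  apply/measurable_EFinP; exact: measurable_fun_tail.
have cF : (\int[mu]_(t in D) F n t)%E @[n --> \oo] --> (\int[mu]_(t in D) cst 0 t)%E.
  apply: (@dominated_cvg _ _ _ _ _ mD F (cst 0%E) (fun t => `|(f t)%:E|%E)) => //.
  - move=> t Dt; apply: cvg_near_cst; exists (Num.truncn (p t)).+1 => // n /= pn.
    rewrite /F ifT// (le_trans (ltW (truncnS_gt _)))//.
    by rewrite ler_nat.
  - exact: integrable_abse.
  - by move=> n t Dt; rewrite /F; case: ifP => _; rewrite ?abse0 ?abse_ge0//= normr_id.
rewrite integral0 in cF.
have : (eps%:E <= limn (fun n => \int[mu]_(t in D) F n t))%E.
  apply: lime_ge; first by apply/cvg_ex; eexists; exact: cF.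
  apply: nearW => n; rewrite leNgt; apply/negP => h; apply: noM; exists n.
  exact: h.
by rewrite (cvg_lim _ cF)// lee_fin leNgt e0.
Qed.

End integral_facts.

(** Integrability is local because [h] may fail to be integrable up to the ends of I. The half-open
    intervals match those of [is_stieltjes_measure], so that increments add up even for a measure
    with atoms. *)
Definition density {R : realType} (I : set R)
    (mu : {measure set (measurableTypeR R) -> \bar R}) (u h : R -> R) : Prop :=
  [/\ measurable_fun (I : set (measurableTypeR R)) h,
      forall x y, I x -> I y -> x <= y ->
        mu.-integrable (`]x, y]%classic : set (measurableTypeR R)) (EFin \o h) &
      forall x y, I x -> I y -> x <= y ->
        u y - u x = \int[mu]_(t in `]x, y]) h t].

Lemma derive1_near_shift {R : realType} (f F : R -> R) c t :
  (\near t, f t = F t + c) -> derivable F t 1 ->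
  derivable f t 1 /\ derive1 f t = derive1 F t.
Proof.
move=> fF /derivableP dF.
have dc : is_derive t (1 : R) (fun x : R => F x + c) ('D_1 F t).
  by apply: is_derive_eq; rewrite addr0.
have Ff : \near t, F t + c = f t by apply: filterS fF => u ->.
have [? ?] := near_eq_is_derive Ff dc.
by split=> //; rewrite !derive1E.
Qed.

(** * Lebesgue densities and absolute continuity *)

Section lebesgue_density.
Context {R : realType}.
Notation mR := (measurableTypeR R).
Notation leb := (@lebesgue_measure R).
Variable J : set R.
Hypotheses (oJ : open J) (iJ : is_interval J).

Let mJ : measurable (J : set mR). Proof. exact: open_measurable. Qed.

Lemma density_abs_continuous f h : density J leb f h -> abs_continuous_on J f.
Proof.
move=> [mh ih fE] x y xy xyJ eps e0.
have Jx : J x by apply: xyJ; rewrite /= in_itv/= lexx.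
have Jy : J y by apply: xyJ; rewrite /= in_itv/= lexx andbT.
pose D : set mR := `]x, y]%classic.
have mD : measurable D by exact: measurable_itv.
have DJ : D `<=` J by exact: interval_sub.
have iD := ih _ _ Jx Jy xy.
have mhD : measurable_fun D h by exact: measurable_funS mh.
have e20 : 0 < eps / 2 by rewrite divr_gt0.
have mnh : measurable_fun D (fun t => `|h t|) by exact: measurableT_comp.
have [M HM] := integrable_tail mD iD mnh e20.
pose tl (t : R) := if `|h t| <= M%:R then 0 else `|h t|.
have mtl : measurable_fun D tl.
  exact: measurable_fun_tail.
have tl0 t : 0 <= tl t by rewrite /tl; case: ifP.
(* The part of [h] bounded by [M] contributes less than [M.+1] times the total length, and the tail
   at most eps / 2; [M.+1] is nonzero even when [M] is 0. *)
exists (eps / 2 / M.+1%:R); first by rewrite divr_gt0.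
move=> n p q pq tpq dl.
have subD i : `]p i, q i]%classic `<=` D.
  move=> t; have [k1 k2 k3] := pq i; rewrite /D/= !in_itv/= => /andP[h1 h2].
  by rewrite (le_lt_trans k1)//= (le_trans h2).
have subD' i : `]p i, q i[%classic `<=` D.
  by apply: subset_trans (subD i); exact: subset_itv_oo_oc.
have bnd i : (`|f (q i) - f (p i)|%:E <=
    (M.+1%:R * (q i - p i))%:E + \int[leb]_(t in `]p i, q i[) (tl t)%:E)%E.
  have [k1 k2 k3] := pq i.
  have Jp : J (p i) by apply: xyJ; rewrite /= in_itv/= k1 (le_trans k2).
  have Jq : J (q i) by apply: xyJ; rewrite /= in_itv/= k3 (le_trans k1).
  have ipq := ih _ _ Jp Jq k2.
  rewrite fE// /Rintegral -[leLHS]/(abse (fine _)%:E) fineK; last exact: integrable_fin_num.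
  have mpq : measurable (`]p i, q i]%classic : set mR) by exact: measurable_itv.
  apply: (le_trans (le_abse_integral _ mpq (measurable_int _ ipq))).
  apply: (@le_trans _ _ (\int[leb]_(t in `]p i, q i]) (M.+1%:R%:E + (tl t)%:E))%E).
    apply: ge0_le_integral => //.
    - by apply: measurableT_comp => //; exact: measurable_int ipq.
    - apply: emeasurable_funD => //; apply/measurable_EFinP.
      exact: measurable_funS (subD i) mtl.
    - move=> t _; rewrite /= -EFinD lee_fin /tl; case: ifP => hM.
        by rewrite addr0 (le_trans hM)// ler_nat.
      by rewrite lerDr.
  rewrite ge0_integralD//; last 2 first.
  - by move=> t _; rewrite lee_fin.
  - by apply/measurable_EFinP; exact: measurable_funS (subD i) mtl.
  rewrite integral_cst_oc// leeD2l//.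
  (* Only the open intervals of a subdivision are disjoint, so the tail is integrated over them. *)
  rewrite integral_itv_bndo_bndc//; apply/measurable_EFinP.
  exact: measurable_funS (subD' i) mtl.
rewrite -lte_fin -sumEFin.
apply: (@le_lt_trans _ _ (\sum_(i < n) ((M.+1%:R * (q i - p i))%:E + \int[leb]_(t in `]p i, q i[) (tl t)%:E))%E).
  by apply: lee_sum => i _; exact: bnd.
have S : (\sum_(i < n) \int[leb]_(t in `]p i, q i[) (tl t)%:E <= (eps / 2)%:E)%E.
  rewrite -ge0_integral_bigsetU//=.
  - apply: le_trans (ltW HM); apply: ge0_subset_integral => //.
    + by apply: bigsetU_measurable => i _; exact: measurable_itv.
    + by apply/measurable_EFinP.
    + by move=> t _; rewrite lee_fin.
    + by rewrite -bigcup_seq => t [i _]; exact: subD'.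
  - exact: index_enum_uniq.
  - by apply: sub_trivIset tpq.
  - apply/measurable_EFinP; apply: measurable_funS mtl => //.
    by rewrite -bigcup_seq => t [i _]; exact: subD'.
  - by move=> t _; rewrite lee_fin.
rewrite big_split/= (splitr eps) EFinD; apply: lte_leD => //.
  rewrite ge0_fin_numE ?(le_lt_trans S) ?ltry//.
  by apply: sume_ge0 => i _; apply: integral_ge0 => t _; rewrite lee_fin.
by rewrite sumEFin lte_fin -mulr_sumr mulrC -ltr_pdivlMr.
Qed.

(** Inside ]x, y[, [f] differs by the constant [f x] from a primitive of [h] restricted to ]x, y],
    to which the Lebesgue differentiation theorem applies. *)
Lemma density_derive1 f h : density J leb f h ->
  \forall t \ae leb, J t -> derivable f t 1 /\ derive1 f t = h t.
Proof.
move=> [mh ih fE]; apply: ae_local => // x y Jx Jy xy.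
pose D : set mR := `]x, y]%classic.
have mD : measurable D by exact: measurable_itv.
have iD := ih _ _ Jx Jy xy.
have iDT : leb.-integrable setT (EFin \o (h \_ D)).
  by rewrite -restrict_EFin; apply/(integrable_mkcond _ mD).
have iDx y0 : leb.-integrable ([set` Interval (BLeft x) (BRight y0)] : set mR)
    (EFin \o (h \_ D)) by exact: integrableS iDT.
have := FTC1 iDx (integrable_locally mD iD).
apply: ae_mono => t + /andP[xt ty].
rewrite /= lte_fin => /(_ xt).
set F := fun x : R => _.
have FE : \near t, f t = F t + f x.
  near=> u.
  have xu : x < u by near: u; exact: lt_nbhsr.
  have uy : u < y by near: u; exact: lt_nbhsl.
  have Ju : J u by apply: (interval_mem iJ Jx Jy); rewrite !ltW.
  rewrite /= -[LHS](subrK (f x)) fE ?(ltW xu)//; congr (_ + _).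
  rewrite /F -Rintegral_itv_obnd_cbnd; last exact: integrableS iDT.
  apply: eq_Rintegral => v /[!inE]/=; rewrite in_itv/= => /andP[xv vu].
  by rewrite patchE mem_set//= /D/= in_itv/= xv (le_trans vu)// ltW.
have hD : (h \_ D) t = h t by rewrite patchE mem_set// /D/= in_itv/= xt ltW.
rewrite hD => -[dF <-]; exact: derive1_near_shift FE dF.
Unshelve. all: by end_near. Qed.

Lemma abs_continuous_on_continuous f : abs_continuous_on J f ->
  {in J, continuous f}.
Proof.
move=> acf t /[!inE] Jt.
have [y [z [Jy Jz /andP[yt tz]]]] := open_interval_points oJ Jt.
have acyz : abs_continuous_cc y z f.
  by apply: acf; [exact/ltW/(lt_trans yt)|exact: interval_sub].
apply/cvgrPdist_lt => eps e0; have [d d0 Hd] := ac_continuous acyz e0.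
near=> u; apply: Hd.
- by rewrite (ltW yt) (ltW tz).
- by apply/andP; split; apply/ltW; near: u; [exact: lt_nbhsr|exact: lt_nbhsl].
- by near: u; exists d.
Unshelve. all: by end_near. Qed.

End lebesgue_density.

Section abs_continuous_density.
Context {R : realType}.
Notation mR := (measurableTypeR R).
Notation leb := (@lebesgue_measure R).
Variable J : set R.
Hypotheses (oJ : open J) (iJ : is_interval J).

Let mJ : measurable (J : set mR). Proof. exact: open_measurable. Qed.

(** [ac_density] provides a density on each compact subinterval, and these have to be glued. The
    upper limit of the difference quotients with steps 1 / (n + 1) is a single Borel function equal
    to the derivative wherever that exists, hence almost everywhere equal to each local density. *)
Lemma abs_continuous_density f : abs_continuous_on J f ->
  exists h, density J leb f h.
Proof.
move=> acf; have cf := abs_continuous_on_continuous oJ iJ acf.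
have mf : measurable_fun (J : set mR) f by exact: open_continuous_measurable_fun.
pose fJ := f \_ J.
have mfJ : measurable_fun (setT : set mR) fJ by exact/(measurable_restrictT _ mJ).
pose q (n : nat) (t : R) := (n.+1%:R * (fJ (n.+1%:R^-1 + t) - fJ t))%:E : \bar R.
pose h t := fine (limn_esup (q ^~ t)).
have mq n : measurable_fun (setT : set mR) (q n).
  apply/measurable_EFinP; apply: measurable_funM => //.
  apply: measurable_funB => //.
  by apply: (measurableT_comp mfJ); exact: measurable_funD.
have mh : measurable_fun (setT : set mR) h.
  by apply: measurableT_comp => //; exact: measurable_fun_limn_esup.
have hE t : J t -> derivable f t 1 -> h t = derive1 f t.
  move=> Jt df; have : q ^~ t @ \oo --> (derive1 f t)%:E.
    have near_fJ : \near t, f t = fJ t.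
      have : \near t, J t by exact: open_nbhs_nbhs.
      by apply: filterS => u Ju; rewrite /fJ patchE mem_set.
    have dfJ := near_eq_derivable near_fJ df.
    rewrite derive1E (near_eq_derive _ near_fJ).
    apply: cvg_EFin; first by apply: nearW.
    have /cvgr_dnbhsP/(_ (fun n => n.+1%:R^-1)) := dfJ.
    have inv0 : (forall n, (n.+1%:R^-1 : R) != 0) /\ (n.+1%:R^-1 : R) @[n --> \oo] --> (0:R).
      by split; [move=> n; rewrite invr_eq0 pnatr_eq0|exact: cvg_harmonic].
    move=> /(_ inv0); apply: cvg_trans; apply: near_eq_cvg; apply: nearW => n /=.
    by rewrite invrK [_%:A]mulr1.
  by move=> /cvg_limn_einf_sup[_]; rewrite /h => ->.
have loc x y : J x -> J y -> x <= y ->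
    leb.-integrable (`]x, y]%classic : set mR) (EFin \o h) /\
    f y - f x = \int[leb]_(t in `]x, y]) h t.
  move=> Jx Jy xy.
  (* A point [z] beyond [y] places all of ]x, y], its right end included, in the open interval ]x,
     z[. *)
  have [_ [z [_ Jz /andP[_ yz]]]] := open_interval_points oJ Jy.
  have xz := le_lt_trans xy yz.
  have acxz : abs_continuous_cc x z f.
    by apply: acf; [exact/ltW|exact: interval_sub].
  have [k ik kE] := ac_density xz acxz.
  pose J' : set R := `]x, z[%classic.
  have mk : measurable_fun (`]x, z]%classic : set mR) k.
    by apply/measurable_EFinP; exact: measurable_int ik.
  have dk : density J' leb f k.
    split.
    - by apply: measurable_funS mk => //; exact: subset_itv_oo_oc.
    - move=> u v; rewrite /J'/= !in_itv/= => /andP[xu _] /andP[_ vz] uv.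
      apply: integrableS ik => // t /=; rewrite !in_itv/= => /andP[h1 h2].
      by rewrite (lt_trans xu)//= (le_trans h2)// ltW.
    - move=> u v; rewrite /J'/= !in_itv/= => /andP[xu _] /andP[_ vz] uv.
      by rewrite kE// ltW.
  have hk : \forall t \ae leb, (`]x, y]%classic : set mR) t -> h t = k t.
    have oJ' : open J' by exact: interval_open.
    have iJ' : is_interval J' by exact: interval_is_interval.
    apply: ae_mono (density_derive1 oJ' iJ' dk) => t H; rewrite /= in_itv/= => /andP[xt ty].
    have [|dft <-] := H _.
      by rewrite /J'/= in_itv/= xt (le_lt_trans ty).
    apply: hE => //; apply: (interval_mem iJ Jx Jz).
    by rewrite (ltW xt) (le_trans ty)// ltW.
  have sub : `]x, y]%classic `<=` `]x, z]%classic.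
    by move=> t /=; rewrite !in_itv/= => /andP[-> h2]; rewrite (le_trans h2)// ltW.
  have mkD : measurable_fun (`]x, y]%classic : set mR) k by exact: measurable_funS mk.
  have mhD : measurable_fun (`]x, y]%classic : set mR) h by exact: measurable_funTS.
  split; last first.
    rewrite kE ?(ltW yz)// /Rintegral; congr fine.
    apply: ae_eq_integral => //; [exact/measurable_EFinP..|].
    by apply: ae_mono hk => t hk Dt; rewrite hk.
  apply/integrableP; split; first exact/measurable_EFinP.
  have /integrableP[_ koo] : leb.-integrable (`]x, y]%classic : set mR) (EFin \o k).
    exact: integrableS ik.
  apply: le_lt_trans koo; rewrite le_eqVlt; apply/orP; left; apply/eqP.
  apply: ge0_ae_eq_integral => //.
  - by apply: measurableT_comp => //; exact/measurable_EFinP.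
  - by apply: measurableT_comp => //; exact/measurable_EFinP.
  - by apply: ae_mono hk => t hk Dt /=; rewrite hk.
exists h; split; first exact: measurable_funTS.
  by move=> x y Jx Jy xy; have [] := loc _ _ Jx Jy xy.
by move=> x y Jx Jy xy; have [] := loc _ _ Jx Jy xy.
Qed.

End abs_continuous_density.

(** * Upper bounds for integrals of nonnegative functions *)

Section integral_le.
Context {R : realType}.
Notation mR := (measurableTypeR R).
Implicit Types (mu : {measure set mR -> \bar R}) (D : set mR) (F G : R -> R).

(** The bound travels with the measurability and nonnegativity that adding and comparing integrals
    require. Since [a] is real, it also records that the integral is finite. *)
Definition integral_le mu D G (a : R) : Prop :=
  [/\ measurable_fun D G, forall t, D t -> 0 <= G t &
      (\int[mu]_(t in D) (G t)%:E <= a%:E)%E].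

Lemma integral_leD mu D F G a b : measurable D ->
  integral_le mu D F a -> integral_le mu D G b ->
  integral_le mu D (fun t => F t + G t) (a + b).
Proof.
move=> mD [mF F0 Fa] [mG G0 Gb]; split.
- exact: measurable_funD.
- by move=> t Dt; rewrite addr_ge0 ?F0 ?G0.
- under eq_integral do rewrite EFinD.
  rewrite ge0_integralD//; last 2 first.
  + exact/measurable_EFinP.
  + exact/measurable_EFinP.
  by rewrite EFinD leeD.
Qed.

Lemma integral_leZ mu D G a k : measurable D -> 0 <= k ->
  integral_le mu D G a -> integral_le mu D (fun t => k * G t) (k * a).
Proof.
move=> mD k0 [mG G0 Ga]; split.
- exact: measurable_funM.
- by move=> t Dt; rewrite mulr_ge0 ?G0.
- under eq_integral do rewrite EFinM.
  rewrite ge0_integralZl_EFin//; last exact/measurable_EFinP.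
  by rewrite EFinM lee_wpmul2l// lee_fin.
Qed.

Lemma integral_le_mono mu D F G a b : measurable D -> measurable_fun D F ->
  (forall t, D t -> 0 <= F t <= G t) -> integral_le mu D G a -> a <= b ->
  integral_le mu D F b.
Proof.
move=> mD mF FG [mG G0 Ga] ab; split => //.
  by move=> t /FG/andP[].
apply: (@le_trans _ _ a%:E); last by rewrite lee_fin.
apply: le_trans Ga; apply: ge0_le_integral => //.
- by move=> t /FG/andP[F0 _]; rewrite lee_fin.
- exact/measurable_EFinP.
- exact/measurable_EFinP.
- by move=> t /FG/andP[_ h]; rewrite lee_fin.
Qed.

Lemma integral_le_sub mu D E G a : measurable D -> measurable E -> E `<=` D ->
  integral_le mu D G a -> integral_le mu E G a.
Proof.
move=> mD mE ED [mG G0 Ga]; split.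
- exact: measurable_funS mG.
- by move=> t /ED/G0.
- apply: le_trans Ga; apply: ge0_subset_integral => //.
  exact/measurable_EFinP.
Qed.

Lemma integral_le_integrable mu D G a : integral_le mu D (fun t => `|G t|) a ->
  measurable_fun D G -> mu.-integrable D (EFin \o G).
Proof.
move=> [_ _ Ga] mG; apply/integrableP; split; first exact/measurable_EFinP.
exact: le_lt_trans Ga (ltry _).
Qed.

Lemma integral_le_Rintegral mu D G a : measurable D -> measurable_fun D G ->
  integral_le mu D (fun t => `|G t|) a -> `|\int[mu]_(t in D) G t| <= a.
Proof.
move=> mD mG H; have iG := integral_le_integrable H mG.
have [_ _ Ga] := H.
apply: le_trans (le_normr_Rintegral mD iG) _.
rewrite /Rintegral -lee_fin fineK//; exact: integrable_fin_num (integrable_norm iG).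
Qed.

Lemma cvg0_lt (u : (\bar R)^nat) (eps : R) : u @ \oo --> 0%E -> 0 < eps ->
  exists n, (u n < eps%:E)%E.
Proof.
move=> cu e0; apply: contrapT => H.
have : (eps%:E <= limn u)%E.
  apply: lime_ge; first by apply/cvg_ex; eexists; exact: cu.
  apply: nearW => n; rewrite leNgt; apply/negP => h; apply: H; by exists n.
by rewrite (cvg_lim _ cu)// lee_fin leNgt e0.
Qed.

End integral_le.

(** * Change of scale *)

Section scaling.
Context {R : realType}.
Notation mR := (measurableTypeR R).
Notation leb := (@lebesgue_measure R).
Variables (I : set R) (e : R) (s : R -> R).
Hypotheses (oI : open I) (iI : is_interval I).
Hypothesis ss : scaling_function I e s.

Let J := s @` I.
Let mI : measurable (I : set mR). Proof. exact: open_measurable. Qed.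

Lemma scaling_lt x y : I x -> I y -> x < y -> s x < s y.
Proof. by case: ss => h _ _ Ix Iy; apply: h; rewrite inE. Qed.

Lemma scaling_le x y : I x -> I y -> (s x <= s y) = (x <= y).
Proof.
move=> Ix Iy; apply/idP/idP => [|].
  by apply: contraTT; rewrite -!ltNge; exact: scaling_lt.
by rewrite le_eqVlt => /predU1P[->//|/(scaling_lt Ix Iy)/ltW].
Qed.

Lemma scaling_ltE x y : I x -> I y -> (s x < s y) = (x < y).
Proof. by move=> Ix Iy; rewrite !ltNge scaling_le. Qed.

Lemma scaling_inj : {in I &, injective s}.
Proof.
move=> x y /[!inE] Ix Iy sxy; apply/eqP.
by rewrite eq_le -(scaling_le Ix Iy) -(scaling_le Iy Ix) sxy lexx.
Qed.

Lemma scaling_continuous : {in I, continuous s}.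
Proof. by case: ss => _ cs _; move: cs; rewrite continuous_open_subspace. Qed.

Lemma scaling_pinvK x : I x -> pinv I s (s x) = x.
Proof. by move=> Ix; rewrite (pinvKV _ scaling_inj)// inE. Qed.

Lemma scaling_pinvP t : J t -> I (pinv I s t) /\ s (pinv I s t) = t.
Proof. by move=> [x Ix <-]; rewrite scaling_pinvK. Qed.

Lemma scaling_image_interval : is_interval J.
Proof.
move=> _ _ [x Ix <-] [y Iy <-] z /andP[xz zy].
have xy : x <= y by rewrite -scaling_le// (le_trans xz).
have sub : `[x, y]%classic `<=` I by exact: interval_sub.
have cs : {within `[x, y], continuous s}.
  by case: ss => _ cs _; exact: continuous_subspaceW cs.
have [|t txy <-] := IVT xy cs (v := z).
  by rewrite ge_min le_max xz zy orbT.
by exists t => //; apply: sub.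
Qed.

Lemma scaling_image_open : open J.
Proof.
rewrite openE => _ [x Ix <-].
have [y [z [Iy Iz /andP[yx xz]]]] := open_interval_points oI Ix.
have : nbhs (s x) (`]s y, s z[%classic : set R).
  by apply: open_nbhs_nbhs; split; [exact: interval_open|rewrite /= in_itv/= !scaling_lt].
apply: filterS => t /=; rewrite in_itv/= => /andP[h1 h2].
apply: (interval_mem scaling_image_interval (x := s y) (y := s z)); [by exists y|by exists z|].
by rewrite !ltW.
Qed.

Let oJ := scaling_image_open.
Let iJ := scaling_image_interval.
Let mJ : measurable (J : set mR). Proof. exact: open_measurable. Qed.

Lemma scaling_measurable : measurable_fun (I : set mR) s.
Proof. exact: open_continuous_measurable_fun oI scaling_continuous. Qed.

Lemma pinv_measurable : measurable_fun (J : set mR) (pinv I s).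
Proof.
apply: (measurability (@RGenCInfty.G R)) => [|/= _ [_] [r] -> <-].
  exact: RGenCInfty.measurableE.
apply: is_interval_measurable => y1 y2 [Jy1 /=].
rewrite !in_itv/= !andbT => r1 [Jy2 r2] t /andP[yt ty].
have Jt : J t by apply: (iJ Jy1 Jy2); rewrite yt ty.
split => //=; rewrite in_itv/= andbT (le_trans r1)//.
have [[I1 E1] [It Et]] := (scaling_pinvP Jy1, scaling_pinvP Jt).
by rewrite -scaling_le// E1 Et.
Qed.

Variable nu : {measure set mR -> \bar R}.
Hypothesis nuP : is_stieltjes_measure I s nu.

Let nuI0 : nu (~` I) = 0%E. Proof. by case: nuP. Qed.

Lemma scaling_preimage_itv x y : I x -> I y ->
  I `&` s @^-1` `]s x, s y]%classic = `]x, y]%classic.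
Proof.
move=> Ix Iy; apply/seteqP; split => t /=; rewrite !in_itv/=.
  by move=> [It]; rewrite scaling_ltE// scaling_le.
move=> xty; have It : I t.
  by case/andP: xty => h1 h2; apply: (interval_mem iI Ix Iy); rewrite (ltW h1) h2.
by split => //; rewrite scaling_ltE// scaling_le.
Qed.

(** The push-forward asks for a map on the whole line. The complement of I is sent to 0, possibly a
    point of J, which is harmless because [nu] does not charge that complement. *)
Let sI : mR -> mR := s \_ I.
Let msI : measurable_fun (setT : set mR) sI.
Proof. by apply/(measurable_restrictT _ mI); exact: scaling_measurable. Qed.

Let sI_preimage (B : set R) : sI @^-1` B `\` ~` I = I `&` s @^-1` B.
Proof.
apply/seteqP; split => t; rewrite setDE setCK /= /sI.
  by move=> [] + It; rewrite patchE mem_set.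
by move=> [It Bt]; rewrite patchE mem_set.
Qed.

Let msIB (B : set mR) : measurable B -> measurable (sI @^-1` B : set mR).
Proof. by move=> mB; rewrite -[X in measurable X]setTI; exact: msI. Qed.

Lemma measurable_scaling_preimage (B : set mR) : measurable B ->
  measurable (I `&` s @^-1` B : set mR).
Proof. by move=> mB; apply: scaling_measurable. Qed.

Let P : {measure set mR -> \bar R}.
Proof. by refine (pushforward nu sI : {measure set mR -> \bar R}). Defined.

Let PE (B : set mR) : measurable B -> P B = nu (I `&` s @^-1` B).
Proof.
move=> mB; change (nu (sI @^-1` B) = nu (I `&` s @^-1` B)).
have mB' := msIB mB.
have mIC : measurable (~` I : set mR) by exact: measurableC.
rewrite -sI_preimage (measureDI nu mB' mIC).
transitivity (nu (sI @^-1` B `\` ~` I) + 0)%E; last by rewrite adde0.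
congr (_ + _)%E; apply: (subset_measure0 _ _ _ nuI0) => //.
exact: measurableI.
Qed.

(** The map s carries ds to Lebesgue measure: on an interval with endpoints s x and s y both give
    the length s y - s x. All changes of variables below come from this. *)
Lemma scaling_image_measure (B : set mR) : measurable B -> B `<=` J ->
  nu (I `&` s @^-1` B) = leb B.
Proof.
move=> mB BJ; rewrite -PE//.
apply: (@measure_eq_local _ J P leb B) => // x y Jx Jy xy A mA AB.
have AD : A `<=` `]x, y]%classic by move=> t /AB[].
have [[Ix sx] [Iy sy]] := (scaling_pinvP Jx, scaling_pinvP Jy).
have Pitv p q : x <= p -> p <= q -> q <= y -> P `]p, q]%classic = (q - p)%:E.
  move=> xp pq qy; rewrite PE//.
  have Jp : J p by apply: (interval_mem iJ Jx Jy); rewrite xp (le_trans pq).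
  have Jq : J q by apply: (interval_mem iJ Jx Jy); rewrite qy (le_trans xp).
  have [[Ip sp] [Iq sq]] := (scaling_pinvP Jp, scaling_pinvP Jq).
  rewrite -sp -sq scaling_preimage_itv//; case: nuP => _ ->//.
  by rewrite -scaling_le// sp sq.
have mD : measurable (`]x, y]%classic : set mR) by exact: measurable_itv.
(* Integrating the constant 1 turns the uniqueness result for integrals into one for measures. *)
have : (\int[P]_(t in A) (cst 1 t)%:E = \int[leb]_(t in A) (cst 1 t)%:E)%E.
  apply: (integral_eq_itv (x := x) (y := y)) => //.
  - apply: (@measurable_bounded_integrable _ mR _ P (cst 1)) => //.
      by rewrite Pitv// ltry.
    exists 1; split; first exact: num_real.
    by move=> M cM t _ /=; rewrite normr1 ltW.
  - exact: integrable_cst_oc.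
  - move=> p q xp pq qy; rewrite Rintegral_cst// Rintegral_cst_oc// Pitv//.
have icst (m0 : {measure set mR -> \bar R}) : (\int[m0]_(t in A) (cst 1 t)%:E = m0 A)%E.
  by rewrite -[RHS]mul1e -integral_cst.
by rewrite !icst.
Qed.

Lemma scaling_integral_ge0 (B : set mR) (f : mR -> \bar R) : measurable B -> B `<=` J ->
  measurable_fun B f -> (forall t, B t -> (0 <= f t)%E) ->
  (\int[leb]_(t in B) f t = \int[nu]_(t in I `&` s @^-1` B) f (s t))%E.
Proof.
move=> mB BJ mf f0.
transitivity (\int[P]_(t in B) f t)%E.
  apply: eq_measure_integral => A mA AB; rewrite PE//.
  by apply/esym/scaling_image_measure => //; exact: subset_trans BJ.
have f0' : {in B, forall t, (0 <= f t)%E} by move=> t /[!inE] Bt; exact: f0.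
apply: (etrans (ge0_integral_pushforward msI nu mB mf f0')).
rewrite (ge0_negligible_integral (measurableC mI))//.
- rewrite sI_preimage; apply: eq_integral => t /[!inE] -[It Bt].
  by rewrite /= /sI patchE mem_set.
- exact: msIB.
- apply: (measurable_comp mB) => //; last exact: measurable_funTS.
  by move=> _ [t Bt <-].
- by move=> t Bt; exact: f0.
Qed.

Lemma scaling_integral (B : set mR) (f : mR -> \bar R) : measurable B -> B `<=` J ->
  measurable_fun B f ->
  (\int[leb]_(t in B) f t = \int[nu]_(t in I `&` s @^-1` B) f (s t))%E.
Proof.
move=> mB BJ mf; rewrite integralE [RHS]integralE; congr (_ - _)%E.
  rewrite scaling_integral_ge0//; last exact: measurable_funepos.
  by apply: eq_integral => t _; rewrite !funeposE.
rewrite scaling_integral_ge0//; last exact: measurable_funeneg.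
by apply: eq_integral => t _; rewrite !funenegE.
Qed.

Lemma scaling_density_comp u phi h : density J leb phi h ->
  (forall x, I x -> u x = phi (s x)) -> density I nu u (h \o s).
Proof.
move=> [mh ih phiE] uE; split.
- apply: (measurable_comp mJ) => //; last exact: scaling_measurable.
- move=> x y Ix Iy xy.
  have Jx : J (s x) by exists x.
  have Jy : J (s y) by exists y.
  have sxy : s x <= s y by rewrite scaling_le.
  have /integrableP[mhD hoo] := ih _ _ Jx Jy sxy.
  have sub : `]s x, s y]%classic `<=` J by exact: interval_sub.
  have mitv : measurable (`]s x, s y]%classic : set mR) by exact: measurable_itv.
  apply/integrableP; split.
    apply/measurable_EFinP; apply: (measurable_comp mJ) => //.
      by move=> _ [t txy <-]; exists t => //; move: txy; exact: interval_sub.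
    apply: measurable_funS scaling_measurable => //; exact: interval_sub.
  move: hoo; rewrite scaling_integral_ge0 ?scaling_preimage_itv//.
  by apply: measurableT_comp.
- move=> x y Ix Iy xy.
  have Jx : J (s x) by exists x.
  have Jy : J (s y) by exists y.
  have sxy : s x <= s y by rewrite scaling_le.
  rewrite !uE// phiE// /Rintegral scaling_integral ?scaling_preimage_itv//.
  + exact: interval_sub.
  + exact: measurable_int (ih _ _ Jx Jy sxy).
Qed.

(** Together with [scaling_density_comp], this identifies ds-densities on I with Lebesgue densities
    on J, so that the theory on the line applies to any scale. *)
Lemma scaling_density_pinv u h : density I nu u h ->
  density J leb (u \o pinv I s) (h \o pinv I s).
Proof.
move=> [mh ih uE].
have mhp : measurable_fun (J : set mR) (h \o pinv I s).
  apply: (measurable_comp mI) => //; last exact: pinv_measurable.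
have hp t : I t -> (h \o pinv I s) (s t) = h t by move=> It; rewrite /= scaling_pinvK.
split => //.
- move=> _ _ [x Ix <-] [y Iy <-]; rewrite scaling_le// => xy.
  have sub : `]s x, s y]%classic `<=` J by apply: interval_sub => //; [exists x|exists y].
  have mhD : measurable_fun (`]s x, s y]%classic : set mR) (h \o pinv I s).
    exact: measurable_funS mhp.
  have /integrableP[mhDI hoo] := ih _ _ Ix Iy xy.
  apply/integrableP; split; first exact/measurable_EFinP.
  rewrite scaling_integral_ge0 ?scaling_preimage_itv//; last first.
    by apply: measurableT_comp => //; exact/measurable_EFinP.
  have -> // : (\int[nu]_(t in `]x, y]) `|(EFin \o (h \o pinv I s)) (s t)| =
      \int[nu]_(t in `]x, y]) `|(EFin \o h) t|)%E.
  apply: eq_integral => t /[!inE] txy.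
  by rewrite /comp/= scaling_pinvK//; move: txy; exact: interval_sub.
- move=> _ _ [x Ix <-] [y Iy <-]; rewrite scaling_le// => xy.
  have sub : `]s x, s y]%classic `<=` J by apply: interval_sub => //; [exists x|exists y].
  rewrite /= !scaling_pinvK// uE// /Rintegral scaling_integral ?scaling_preimage_itv//.
    congr fine; apply: eq_integral => t /[!inE] txy.
    by rewrite scaling_pinvK//; move: txy; exact: interval_sub.
  by apply/measurable_EFinP; exact: measurable_funS mhp.
Qed.

Lemma density_ac_wrt u h : density I nu u h -> ac_wrt I s u.
Proof.
move=> /scaling_density_pinv/(density_abs_continuous oJ iJ) H.
by exists (u \o pinv I s) => // x Ix; rewrite /= scaling_pinvK.
Qed.

Lemma ac_wrt_density u : ac_wrt I s u -> exists h, density I nu u h.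
Proof.
move=> [phi /(abs_continuous_density oJ iJ)[h dh] uE].
by exists (h \o s); exact: scaling_density_comp dh uE.
Qed.

(** The exceptional set is the preimage under s of the Lebesgue null set where the function of the
    scale variable fails to have [h] as derivative. It is given explicitly so that
    [integral_ae_eq_nonmeas] can be applied to [scale_derive]. *)
Lemma density_scale_derive u h : density I nu u h ->
  exists Z : set mR, [/\ measurable Z, nu Z = 0%E &
    forall t, I t -> ~ Z t -> scale_derive I s u t = h t].
Proof.
move=> /scaling_density_pinv/(density_derive1 oJ iJ)[Z [mZ Z0 subZ]].
exists (I `&` s @^-1` (Z `&` J)); split.
- by apply: measurable_scaling_preimage; exact: measurableI.
- rewrite scaling_image_measure//; last exact: measurableI.
  by apply: (subset_measure0 _ _ _ Z0) => //; exact: measurableI.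
- move=> t It nZ; have [//|_] : J (s t) -> derivable (u \o pinv I s) (s t) 1 /\
      derive1 (u \o pinv I s) (s t) = (h \o pinv I s) (s t).
    apply: contrapT => nd; apply: nZ; split => //; split; last by exists t.
    by apply: subZ.
    by exists t.
  by rewrite /scale_derive => ->; rewrite /= scaling_pinvK.
Qed.

Lemma density_continuous u h : density I nu u h -> {in I, continuous u}.
Proof.
move=> /scaling_density_pinv/(density_abs_continuous oJ iJ).
move=> /(abs_continuous_on_continuous oJ iJ) cu x /[!inE] Ix.
have sx : s x \in J by rewrite inE; exists x.
have := cvg_comp _ _ (scaling_continuous (mem_set Ix)) (cu _ sx).
rewrite /= scaling_pinvK//; apply: cvg_trans; apply: near_eq_cvg.
have : \near x, I x by exact: open_nbhs_nbhs.
by apply: filterS => y Iy; rewrite /= scaling_pinvK.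
Qed.

Lemma density_measurable u h : density I nu u h -> measurable_fun (I : set mR) u.
Proof.
by move=> /density_continuous cu; exact: open_continuous_measurable_fun oI cu.
Qed.

End scaling.

(** * Smooth functions *)

Section smooth.
Context {R : realType}.
Implicit Types (f g : R -> R).

Definition smooth f := forall n (x : R), derivable (derive1n n f) x 1.

(** n + 1 times derivable. The recursion starts from the derivative of [f], whereas [derive1n] adds
    a derivative on the outside; this form lets the rules for products, compositions and inverses be
    proved by induction on [n]. *)
Fixpoint ck n f : Prop :=
  (forall x : R, derivable f x 1) /\ if n is n'.+1 then ck n' (derive1 f) else True.

Lemma ck_derivable n f : ck n f -> forall x : R, derivable f x 1.
Proof. by case: n => [|n] []. Qed.

Lemma ckW n f : ck n.+1 f -> ck n f.
Proof.
by elim: n f => [|n IH] f [df h]; split; [exact: df| |exact: df|exact: IH].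
Qed.

Lemma ck_derive1 n f : ck n.+1 f -> ck n (derive1 f). Proof. by case. Qed.

Lemma derive1n_derive1 n f : derive1n n (derive1 f) = derive1n n.+1 f.
Proof. by elim: n => [//|n IH]; rewrite derive1nS IH. Qed.

Lemma smoothP f : smooth f <-> forall n, ck n f.
Proof.
split=> [sf n|ckf n].
  elim: n f sf => [|n IH] f sf; split => //; do ?[exact: (sf 0%N)].
  by apply: IH => k x; rewrite derive1n_derive1; exact: sf.
elim: n f ckf => [|n IH] f ckf x; first exact: (ck_derivable (ckf 0%N)).
by rewrite -derive1n_derive1; apply: IH => k; exact: (ck_derive1 (ckf k.+1)).
Qed.

Lemma smooth_continuous f : smooth f -> continuous f.
Proof.
move=> sf x; apply/differentiable_continuous/derivable1_diffP; exact: (sf 0%N).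
Qed.

Lemma smooth_derive1 f : smooth f -> smooth (derive1 f).
Proof. by move=> sf n x; rewrite derive1n_derive1; exact: sf. Qed.

Lemma ck_ind n f (f' : R -> R) : (forall x : R, is_derive x (1 : R) f (f' x)) ->
  ck n f' -> ck n.+1 f.
Proof.
move=> df cf'; split; first by move=> x; case: (df x).
suff -> : derive1 f = f' by [].
by apply/funext => x; rewrite derive1E; case: (df x).
Qed.

Lemma ck0 f (f' : R -> R) : (forall x : R, is_derive x (1 : R) f (f' x)) -> ck 0 f.
Proof. by move=> df; split => // x; case: (df x). Qed.

Lemma ck_is_derive n f : ck n f -> forall x : R, is_derive x (1 : R) f (derive1 f x).
Proof.
by move=> /ck_derivable df x; rewrite derive1E; apply/derivableP.
Qed.

Lemma ck_cst n (c : R) : ck n (cst c).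
Proof.
elim: n c => [|n IH] c; first by apply: (@ck0 _ (cst 0)) => x; exact: is_derive_cst.
by apply: (@ck_ind _ _ (cst 0)) => // x; exact: is_derive_cst.
Qed.

Lemma ck_id n : ck n (@idfun R).
Proof.
have d (x : R) : is_derive x (1 : R) (@idfun R) ((cst 1) x) by exact: is_derive_id.
by case: n => [|n]; [exact: ck0 d|exact: ck_ind d (ck_cst _ _)].
Qed.

Lemma ckD n f g : ck n f -> ck n g -> ck n (f \+ g).
Proof.
elim: n f g => [|n IH] f g cf cg.
  apply: (@ck0 _ (derive1 f \+ derive1 g)) => x.
  exact: is_deriveD (ck_is_derive cf x) (ck_is_derive cg x).
apply: (@ck_ind _ _ (derive1 f \+ derive1 g)) => [x|].
  exact: is_deriveD (ck_is_derive cf x) (ck_is_derive cg x).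
by apply: IH; exact: ck_derive1.
Qed.

Lemma is_deriveM1 f g (x df dg : R) : is_derive x (1 : R) f df -> is_derive x (1 : R) g dg ->
  is_derive x (1 : R) (f \* g) (df * g x + f x * dg).
Proof.
move=> hf hg; have := is_deriveM hf hg.
by move=> h; apply: is_derive_eq; rewrite /GRing.scale/= addrC; congr (_ + _); rewrite mulrC.
Qed.

Lemma ckM n f g : ck n f -> ck n g -> ck n (f \* g).
Proof.
elim: n f g => [|n IH] f g cf cg.
  apply: (@ck0 _ ((derive1 f \* g) \+ (f \* derive1 g))) => x.
  exact: is_deriveM1 (ck_is_derive cf x) (ck_is_derive cg x).
apply: (@ck_ind _ _ ((derive1 f \* g) \+ (f \* derive1 g))) => [x|].
  exact: is_deriveM1 (ck_is_derive cf x) (ck_is_derive cg x).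
by apply: ckD; apply: IH => //; (exact: ck_derive1) || exact: ckW.
Qed.

Lemma ck_comp n f g : ck n f -> ck n g -> ck n (f \o g).
Proof.
elim: n f g => [|n IH] f g cf cg.
  apply: (@ck0 _ ((derive1 f \o g) \* derive1 g)) => x.
  exact: is_derive1_comp (ck_is_derive cf (g x)) (ck_is_derive cg x).
apply: (@ck_ind _ _ ((derive1 f \o g) \* derive1 g)) => [x|].
  exact: is_derive1_comp (ck_is_derive cf (g x)) (ck_is_derive cg x).
by apply: ckM; [apply: IH => //; [exact: ck_derive1|exact: ckW]|exact: ck_derive1].
Qed.

Lemma ckV n f : (forall x, f x != 0) -> ck n f -> ck n (fun x => (f x)^-1).
Proof.
move=> f0; pose f' x := - (f x)^-1 * (f x)^-1 * derive1 f x.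
have d k x : ck k f -> is_derive x (1 : R) (fun x => (f x)^-1) (f' x).
  move=> cf; have := is_deriveV (f0 x) (ck_is_derive cf x) => h.
  apply: is_derive_eq; rewrite /f' /GRing.scale/= -mulrN1 -[in RHS]mulrN1.
  by rewrite expr2 invfM; ring.
elim: n => [|n IH] cf; first by apply: (@ck0 _ f') => x; exact: d cf.
apply: (@ck_ind _ _ f') => [x|]; first exact: d cf.
rewrite (_ : f' = (((cst (-1) \* (fun x => (f x)^-1)) \* (fun x => (f x)^-1)) \* derive1 f)).
  apply: ckM; last exact: ck_derive1.
  have cV := IH (ckW cf).
  by apply: ckM => //; apply: ckM => //; exact: ck_cst.
by apply/funext => x /=; rewrite /f' mulN1r.
Qed.

(** The powers of 1/x are included so that the linear span of the family is closed under
    differentiation; k = 0 is the classical flat function. *)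
Definition flat k (x : R) : R := if 0 < x then x^-1 ^+ k * expR (- x^-1) else 0.

(** For positive [k], raise y / k <= exp (y / k) to the power [k]. *)
Lemma exp_pow_bound k (y : R) : 0 <= y -> y ^+ k <= k%:R ^+ k * expR y.
Proof.
case: k => [|k] y0; first by rewrite !expr0 mul1r -expR0 ler_expR.
have k0 : 0 < k.+1%:R :> R by [].
rewrite -ler_pdivrMl ?exprn_gt0// mulrC -expr_div_n.
have -> : expR y = expR (y / k.+1%:R) ^+ k.+1.
  by rewrite -expRM_natl mulrC divfK// gt_eqF.
rewrite lerXn2r ?nnegrE ?divr_ge0 ?expR_ge0//.
by apply: le_trans (expR_ge1Dx _); rewrite lerDr.
Qed.

(** A quadratic bound forces the difference quotient at 0 to tend to 0. The exponent [k.+2] absorbs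
    the factor of order [k] and leaves the square. *)
Lemma flat_bound k (x : R) : `|flat k x| <= k.+2%:R ^+ k.+2 * x ^+ 2.
Proof.
rewrite /flat; case: ltP => x0; last first.
  by rewrite normr0; apply: mulr_ge0; [exact: exprn_ge0|exact: sqr_ge0].
have y0 : 0 < x^-1 by rewrite invr_gt0.
have fl0 : 0 <= x^-1 ^+ k * expR (- x^-1).
  by apply: mulr_ge0; [exact/exprn_ge0/ltW|exact: expR_ge0].
rewrite ger0_norm//.
have := exp_pow_bound k.+2 (ltW y0).
have x20 : 0 < x ^+ 2 by exact: exprn_gt0.
rewrite expRN -ler_pdivrMr ?expR_gt0// => h.
rewrite -ler_pdivrMr//; apply: le_trans h.
by rewrite -exprVn !exprS expr0 mulr1 le_eqVlt; apply/orP; left; apply/eqP; ring.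
Qed.

Lemma flat_derive k (x : R) :
  is_derive x (1 : R) (flat k) (flat k.+2 x - k%:R * flat k.+1 x).
Proof.
have [x0|x0|->] := ltgtP x 0.
- have : \near x, (cst 0) x = flat k x.
    have : \near x, x < 0 by exact: lt_nbhsl.
    by apply: filterS => y y0; rewrite /flat ltNge ltW.
  move=> /near_eq_is_derive; apply.
  by apply: is_derive_eq; rewrite /flat ltNge ltW//= mulr0 subr0.
- have : \near x, ((fun y => y^-1 ^+ k * expR (- y^-1)) x) = flat k x.
    have : \near x, 0 < x by exact: lt_nbhsr.
    by apply: filterS => y y0; rewrite /flat y0.
  move=> /near_eq_is_derive; apply.
  have x0' : x != 0 by rewrite gt_eqF.
  have dV : is_derive x (1 : R) (fun y : R => y^-1) (- x ^- 2).
    by have := is_deriveV x0' (is_derive_id x 1) => h; apply: is_derive_eq; rewrite /GRing.scale/= mulr1.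
  have dN : is_derive x (1 : R) (fun y : R => - y^-1) (x ^- 2).
    by have := is_deriveN dV => h; apply: is_derive_eq; rewrite opprK.
  have dE : is_derive x (1 : R) (fun y : R => expR (- y^-1)) (expR (- x^-1) * x ^- 2).
    by have := @is_derive1_comp _ expR (fun y : R => - y^-1) x _ _ (is_derive_expR _) dN.
  have dX : is_derive x (1 : R) (fun y : R => y^-1 ^+ k) (k%:R * x^-1 ^+ k.-1 * - x ^- 2).
    rewrite (_ : (fun y : R => y^-1 ^+ k) = (fun y : R => y^-1) ^+ k).
      by have := is_deriveX k dV => h; apply: is_derive_eq.
    by apply/funext => y; rewrite exprfctE.
  have := is_deriveM1 dX dE => h; apply: is_derive_eq.
  rewrite /flat x0 -exprVn; case: k {h dX} => [|k]; first by rewrite !expr0; ring.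
  by rewrite /= !exprS expr0; ring.
- have -> : flat k.+2 0 - k%:R * flat k.+1 0 = 0 by rewrite /flat ltxx mulr0 subr0.
  have f00 : flat k 0 = 0 by rewrite /flat ltxx.
  have H : (fun h : R => h^-1 *: (flat k (h *: 1 + 0) - flat k 0)) h @[h --> 0^'] --> 0.
    apply/cvgr0Pnorm_le => eps e0.
    pose C : R := k.+2%:R ^+ k.+2.
    have C0 : 0 < C by rewrite exprn_gt0.
    near=> h.
    have hn0 : h != 0 by near: h; exact: nbhs_dnbhs_neq.
    have he : `|h| < eps / C.
      near: h; apply: dnbhs0_lt; exact: divr_gt0.
    rewrite f00 subr0 addr0 [h *: 1]mulr1 normrZ normfV.
    rewrite ler_pdivrMl ?normr_gt0//; apply: le_trans (flat_bound _ _) _.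
    rewrite -/C -[h ^+ 2]real_normK ?num_real// expr2 mulrCA ler_wpM2l//.
    by rewrite mulrC -ler_pdivlMr// ltW.
  apply: DeriveDef; first by apply/cvg_ex; exists 0.
  by apply/cvg_lim => //.
Unshelve. all: by end_near. Qed.

Lemma ck_flat n k : ck n (flat k).
Proof.
elim: n k => [|n IH] k.
  by apply: (@ck0 _ (fun x => flat k.+2 x - k%:R * flat k.+1 x)) => x; exact: flat_derive.
apply: (@ck_ind _ _ (flat k.+2 \+ (cst (- k%:R) \* flat k.+1))) => [x|].
  by have := flat_derive k x => h; apply: is_derive_eq; rewrite /= mulNr.
by apply: ckD => //; apply: ckM => //; exact: ck_cst.
Qed.

(** The usual smooth transition from 0 on the negative half-line to 1 beyond 1. *)
Definition smooth_step (x : R) : R := flat 0 x / (flat 0 x + flat 0 (1 - x)).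

Lemma flat_ge0 (x : R) : 0 <= flat 0 x.
Proof. by rewrite /flat; case: ifP => // _; rewrite mulr_ge0 ?expR_ge0// exprn_ge0. Qed.

Lemma flat_gt0 (x : R) : 0 < x -> 0 < flat 0 x.
Proof. by move=> x0; rewrite /flat x0 expr0 mul1r expR_gt0. Qed.

Lemma step_denom (x : R) : 0 < flat 0 x + flat 0 (1 - x).
Proof.
have [x0|x0] := ltP 0 x.
  by apply: ltr_pwDl; [exact: flat_gt0|exact: flat_ge0].
by apply: ltr_wpDl; [exact: flat_ge0|apply: flat_gt0; lra].
Qed.

Lemma ck_step n : ck n smooth_step.
Proof.
have c : ck n (flat 0 \+ (flat 0 \o (cst 1 \+ (cst (-1) \* idfun)))).
  apply: ckD; first exact: ck_flat; apply: ck_comp; first exact: ck_flat.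
  by apply: ckD; [exact: ck_cst|apply: ckM; [exact: ck_cst|exact: ck_id]].
rewrite (_ : smooth_step = flat 0 \* (fun x => ((flat 0 \+ (flat 0 \o (cst 1 \+ (cst (-1) \* idfun)))) x)^-1)).
  apply: ckM; first exact: ck_flat.
  by apply: ckV => // x /=; rewrite mulN1r gt_eqF// step_denom.
by apply/funext => x; rewrite /smooth_step/= mulN1r.
Qed.

Lemma step_le0 (x : R) : x <= 0 -> smooth_step x = 0.
Proof. by move=> x0; rewrite /smooth_step /flat ltNge x0 mul0r. Qed.

Lemma step_ge1 (x : R) : 1 <= x -> smooth_step x = 1.
Proof.
move=> x1; have x0 : 0 < flat 0 x by apply: flat_gt0; exact: lt_le_trans x1.
rewrite /smooth_step [X in _ + X](_ : _ = 0) ?addr0 ?divff ?gt_eqF//.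
by rewrite /flat ltNge subr_le0 x1.
Qed.

Lemma step_bound (x : R) : 0 <= smooth_step x <= 1.
Proof.
rewrite /smooth_step; apply/andP; split.
  by apply: divr_ge0; [exact: flat_ge0|exact/ltW/step_denom].
by rewrite ler_pdivrMr ?step_denom// mul1r lerDl flat_ge0.
Qed.

End smooth.

Section smooth_functions.
Context {R : realType}.
Implicit Types (f g : R -> R).

Lemma smooth_cst (c : R) : smooth (fun _ : R => c).
Proof. by apply/smoothP => n; exact: ck_cst. Qed.

Lemma smooth_id : smooth (fun t : R => t).
Proof. by apply/smoothP => n; exact: ck_id. Qed.

Lemma smoothD f g : smooth f -> smooth g -> smooth (fun t => f t + g t).
Proof. by move=> /smoothP cf /smoothP cg; apply/smoothP => n; exact: ckD. Qed.

Lemma smoothM f g : smooth f -> smooth g -> smooth (fun t => f t * g t).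
Proof. by move=> /smoothP cf /smoothP cg; apply/smoothP => n; exact: ckM. Qed.

Lemma smooth_comp f g : smooth f -> smooth g -> smooth (fun t => f (g t)).
Proof. by move=> /smoothP cf /smoothP cg; apply/smoothP => n; exact: ck_comp. Qed.

Lemma smooth_sum n (F : nat -> R -> R) : (forall k, smooth (F k)) ->
  smooth (fun t => \sum_(k < n) F k t).
Proof.
move=> sF; elim: n => [|n IH].
  by under eq_fun do rewrite big_ord0; exact: smooth_cst.
by under eq_fun do rewrite big_ord_recr; exact: smoothD.
Qed.

Lemma smooth_step_affine (x d : R) : smooth (fun t => smooth_step ((t - x) / d)).
Proof.
apply: smooth_comp; first by apply/smoothP => n; exact: ck_step.
apply: smoothM; last exact: smooth_cst.
by apply: smoothD; [exact: smooth_id|exact: smooth_cst].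
Qed.

Lemma smooth_is_derive f (x : R) : smooth f -> is_derive x (1 : R) f (derive1 f x).
Proof. by move=> /smoothP/(_ 0%N)/ck_is_derive. Qed.

Lemma smooth_measurable f (D : set (measurableTypeR R)) : smooth f ->
  measurable_fun D f.
Proof.
move=> sf; apply: measurable_funTS; apply: continuous_measurable_fun.
exact: smooth_continuous.
Qed.

Lemma smooth_bump (a b c d : R) : a < b -> c < d -> exists beta : R -> R,
  [/\ smooth beta, forall t, 0 <= beta t <= 1,
      forall t, b <= t <= c -> beta t = 1 &
      forall t, t <= a \/ d <= t -> beta t = 0].
Proof.
move=> ab cd.
(* The second denominator is negative, so its factor descends from 1 at [c] to 0 at [d]. *)
exists (fun t => smooth_step ((t - a) / (b - a)) * smooth_step ((t - d) / (c - d))).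
have ba0 : 0 < b - a by rewrite subr_gt0.
have cd0 : c - d < 0 by rewrite subr_lt0.
split.
- by apply: smoothM; exact: smooth_step_affine.
- move=> t; have /andP[h1 h2] := step_bound ((t - a) / (b - a)).
  have /andP[h3 h4] := step_bound ((t - d) / (c - d)).
  by rewrite mulr_ge0//= -[leRHS]mulr1 ler_pM.
- move=> t /andP[bt tc]; rewrite !step_ge1 ?mulr1//.
    by rewrite ler_ndivlMr// mul1r lerD2r.
  by rewrite ler_pdivlMr// mul1r lerD2r.
- move=> t [ta|dt].
    by rewrite step_le0 ?mul0r// pmulr_lle0 ?invr_gt0// subr_le0.
  by rewrite (@step_le0 _ ((t - d) / _)) ?mulr0// nmulr_lle0 ?invr_lt0// subr_ge0.
Qed.

End smooth_functions.

(** * Compact supports *)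

Section compact_support.
Context {R : realType}.
Variable I : set R.
Hypotheses (oI : open I) (iI : is_interval I).
Implicit Types f : R -> R.

Lemma tsupp_sub f x y : (forall t, t <= x \/ y <= t -> f t = 0) ->
  tsupp f `<=` `[x, y]%classic.
Proof.
move=> f0; rewrite /tsupp [X in _ `<=` X](closure_id _).1; last exact: interval_closed.
apply: closureS => t /= ft; rewrite in_itv/=; apply/andP; split.
  by rewrite leNgt; apply/negP => tx; move: ft; rewrite f0 ?eqxx//; left; exact: ltW.
by rewrite leNgt; apply/negP => tx; move: ft; rewrite f0 ?eqxx//; right; exact: ltW.
Qed.

Lemma tsupp_compact f x y : (forall t, t <= x \/ y <= t -> f t = 0) ->
  compact (tsupp f).
Proof.
move=> f0; apply: subclosed_compact (@segment_compact _ x y) (tsupp_sub f0).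
exact: closed_closure.
Qed.

Lemma Cc_smooth_of_supp f x y : smooth f -> I x -> I y ->
  (forall t, t <= x \/ y <= t -> f t = 0) -> Cc_smooth I f.
Proof.
move=> sf Ix Iy f0; split => //; first exact: tsupp_compact f0.
by apply: subset_trans (tsupp_sub f0) _; exact: interval_sub.
Qed.

(** Keeping [e] strictly inside makes the interval nondegenerate even when [K] is empty. *)
Lemma compact_in_segment e (K : set R) : I e -> compact K -> K `<=` I ->
  exists x y, [/\ I x, I y, x < e < y & forall t, K t -> x < t < y].
Proof.
move=> Ie cK KI; have [x1 [y1 [Ix1 Iy1 /andP[x1e ey1]]]] := open_interval_points oI Ie.
have [->|/set0P K0] := eqVneq K set0.
  by exists x1, y1; split => //; rewrite x1e.
have idc : {within K, continuous (fun t : R => t)}.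
  by apply: continuous_subspaceT => t; exact: cvg_id.
have [m /[!inE] Km mmin] := compact_EVT_min K0 cK idc.
have [M /[!inE] KM Mmax] := compact_EVT_max K0 cK idc.
have [x2 [_ [Ix2 _ /andP[x2m _]]]] := open_interval_points oI (KI _ Km).
have [_ [y2 [_ Iy2 /andP[_ My2]]]] := open_interval_points oI (KI _ KM).
exists (Num.min x1 x2), (Num.max y1 y2); split.
- by rewrite /Num.min; case: ifP.
- by rewrite /Num.max; case: ifP.
- by rewrite gt_min x1e lt_max ey1.
- move=> t Kt; rewrite gt_min lt_max.
  rewrite (lt_le_trans x2m) ?orbT/=; last by apply: mmin; rewrite inE.
  by rewrite (le_lt_trans _ My2) ?orbT//; apply: Mmax; rewrite inE.
Qed.

Lemma tsupp_segment e f : I e -> compact (tsupp f) -> tsupp f `<=` I ->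
  exists x y, [/\ I x, I y, x < e < y & forall t, t <= x \/ y <= t -> f t = 0].
Proof.
move=> Ie cf fI; have [x [y [Ix Iy xey H]]] := compact_in_segment Ie cf fI.
exists x, y; split => // t txy; apply: contrapT => /eqP ft.
have /H/andP[h1 h2] : tsupp f t by apply: subset_closure.
by case: txy; rewrite leNgt ?h1 ?h2.
Qed.

End compact_support.

(** * Antiderivatives of smooth functions with bounded support *)

Section antiderivative.
Context {R : realType}.
Notation mR := (measurableTypeR R).
Notation leb := (@lebesgue_measure R).
Variables (chi : R -> R) (c d : R).
Hypotheses (sc : smooth chi) (chi0 : forall t, t <= c \/ d <= t -> chi t = 0).

Lemma smooth_supp_integrable : leb.-integrable (setT : set mR) (EFin \o chi).
Proof.
have : leb.-integrable (`[c, d]%classic : set mR) (EFin \o chi).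
  apply: continuous_compact_integrable; first exact: segment_compact.
  by apply: continuous_subspaceT; exact: smooth_continuous.
have mcd : measurable (`[c, d]%classic : set mR) by exact: measurable_itv.
move=> /(integrable_mkcond _ mcd).
rewrite restrict_EFin (_ : chi \_ _ = chi)//.
apply/funext => t; rewrite patchE; case: ifPn => // /negP tcd.
apply/esym/chi0; have [tc|ct] := leP t c; first by left.
have [dt|td] := leP d t; first by right.
by exfalso; apply: tcd; rewrite inE/= in_itv/= !ltW.
Qed.

(** Integration starts at -oo, so [G] vanishes to the left of the support. It also vanishes to the
    right exactly when [chi] has integral 0. *)
Lemma smooth_antiderivative : exists2 G : R -> R, smooth G &
  derive1 G = chi /\ (forall t, t <= c -> G t = 0) /\
  (forall p q, p <= q -> G q - G p = \int[leb]_(t in `]p, q]) chi t).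
Proof.
have ichi (B : set mR) : measurable B -> leb.-integrable B (EFin \o chi).
  by move=> mB; exact: integrableS smooth_supp_integrable.
have cchi := smooth_continuous sc.
pose G (x : R) := \int[leb]_(t in `]-oo, x]) chi t.
have dG (x : R) : derivable G x 1 /\ derive1 G x = chi x.
  apply: (@continuous_FTC1 R chi (BInfty _ true) x (x + 1)) => //.
  - by rewrite ltrDl.
  - exact: ichi.
  - exact: ltNyr.
  - exact: cchi.
have G' : derive1 G = chi by apply/funext => x; case: (dG x).
exists G.
  move=> [|n] x; first by case: (dG x).
  by rewrite -derive1n_derive1 G'.
split => //; split.
- move=> t tc; rewrite /G /Rintegral integral0_eq// => u /=; rewrite in_itv/= => ut.
  by rewrite chi0//; left; exact: le_trans tc.
- move=> p q pq; rewrite /G.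
  by rewrite Rintegral_itvB//; exact: ichi.
Qed.

End antiderivative.

(** * Uniform approximation by smooth functions *)

Section uniform_approximation.
Context {R : realType}.

Lemma segment_uniform_continuity (f : R -> R) (x y eps : R) : continuous f -> 0 < eps ->
  exists2 delta, 0 < delta & forall u v, x <= u <= y -> `|u - v| < delta ->
    `|f u - f v| < eps.
Proof.
move=> cf e0; have /compact_near_coveringP cov := @segment_compact R x y.
have [d /= d0 H] : \forall d \near (0 : R)^'+, `[x, y]%classic `<=`
    (fun u => forall v, `|u - v| < d -> `|f u - f v| < eps).
  apply: cov => u uxy.
  have e20 : 0 < eps / 2 by rewrite divr_gt0.
  have /cvgrPdist_lt/(_ _ e20)/nbhs_ballP[r /= r0 rf] := cf u.
  have r20 : 0 < r / 2 by rewrite divr_gt0.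
  exists (ball u (r / 2), [set d | d < r / 2]).
    by split; [exact: nbhsx_ballx|exact: nbhs_right_lt].
  move=> [u' d] [/= uu' dr] v uv.
  have h1 := rf u' (le_ball (_ : r / 2 <= r) uu').
  have h2 := rf v.
  rewrite (splitr eps) -(subrKA (f u)) (le_lt_trans (ler_normD _ _))// ltrD//.
    by rewrite distrC; apply: h1; lra.
  apply: h2; rewrite /ball/= -(subrKA u').
  rewrite (le_lt_trans (ler_normD _ _))// (splitr r) ltrD//.
  exact: lt_trans dr.
exists (d / 2); first by rewrite divr_gt0.
move=> u v uxy uv; apply: (H (d / 2)) => //=.
- by rewrite sub0r normrN gtr0_norm; lra.
- by rewrite divr_gt0.
Qed.

(** Interpolation by smooth steps on a fine grid: between two grid points the approximant is a
    convex combination of the two values of [f] there, both within [eps] of [f t]. As [f] vanishes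
    at the first and last grid points, so does the approximant outside. *)
Lemma smooth_uniform_approx (f : R -> R) (x y eps : R) : x < y -> continuous f ->
  (forall t, t <= x \/ y <= t -> f t = 0) -> 0 < eps ->
  exists h : R -> R, [/\ smooth h, forall t, t <= x \/ y <= t -> h t = 0 &
    forall t, `|f t - h t| < eps].
Proof.
move=> xy cf f0 e0.
have [d d0 Hd] := segment_uniform_continuity x y cf e0.
have [N [N0 zN]] : exists N : nat, N%:R != 0 :> R /\ (y - x) / d < N%:R.
  by exists (Num.truncn ((y - x) / d)).+1; split; [rewrite pnatr_eq0|exact: truncnS_gt].
have N1 : 0 < N%:R :> R by rewrite lt0r N0 ler0n.
pose w : R := (y - x) / N%:R.
have yx0 : 0 < y - x by rewrite subr_gt0.
have w0 : 0 < w by rewrite divr_gt0.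
have wd : w < d.
  by rewrite /w ltr_pdivrMr// mulrC -ltr_pdivrMr.
pose c k : R := x + k%:R * w.
have c0 : c 0%N = x by rewrite /c mul0r addr0.
have cN : c N = y by rewrite /c /w mulrC divfK// addrCA subrr addr0.
have cS k : c k.+1 = c k + w by rewrite /c -natr1; ring.
have c_le k l : (k <= l)%N -> c k <= c l.
  by move=> kl; rewrite lerD2l ler_pM2r// ler_nat.
pose S n t := \sum_(k < n) (f (c k.+1) - f (c k)) * smooth_step ((t - c k) / w).
have SS n t : S n.+1 t = S n t + (f (c n.+1) - f (c n)) * smooth_step ((t - c n) / w).
  by rewrite /S big_ord_recr.
have S_ge n t : c n <= t -> S n t = f (c n).
  elim: n => [|n IH]; first by rewrite /S big_ord0 c0 f0//; left.
  rewrite cS => ct; rewrite SS IH ?step_ge1 ?mulr1; first by rewrite -cS; ring.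
    by rewrite ler_pdivlMr// mul1r; lra.
  by lra.
have S_le n m t : t <= c n -> (n <= m)%N -> S m t = S n t.
  move=> tc /subnKC <-; elim: (m - n)%N => [|j IH]; first by rewrite addn0.
  rewrite addnS SS IH step_le0 ?mulr0 ?addr0//.
  rewrite pmulr_lle0 ?invr_gt0// subr_le0 (le_trans tc)// c_le//.
  exact: leq_addr.
exists (S N); split.
- apply: (@smooth_sum _ N (fun k t => (f (c k.+1) - f (c k)) * smooth_step ((t - c k) / w))) => k.
  by apply: smoothM; [exact: smooth_cst|exact: smooth_step_affine].
- move=> t [tx|yt].
    by rewrite (S_le 0%N) ?c0// /S big_ord0.
  by rewrite S_ge ?cN// f0//; right.
- move=> t; have [tx|xt] := leP t x.
    by rewrite f0; [rewrite (S_le 0%N) ?c0// /S big_ord0 subrr normr0|left].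
  have [yt|ty] := leP y t.
    by rewrite S_ge ?cN// !f0 ?subrr ?normr0//; right.
  have ex : exists k, t <= c k by exists N; rewrite cN ltW.
  case: (ex_minnP ex) => -[|k]; first by rewrite c0 leNgt xt.
  move=> tk kmin.
  have kN : (k < N)%N by apply: kmin; rewrite cN ltW.
  have ck : c k <= t by rewrite ltW// ltNge; apply/negP => /kmin; rewrite ltnn.
  rewrite (S_le k.+1)// SS S_ge//.
  have /andP[s1 s2] := step_bound ((t - c k) / w).
  set s := smooth_step _ in s1 s2 *.
  have txy : x <= t <= y by rewrite !ltW.
  have h1 : `|f t - f (c k)| < eps.
    by apply: Hd => //; rewrite ger0_norm ?subr_ge0//; move: tk; rewrite cS; lra.
  have h2 : `|f t - f (c k.+1)| < eps.
    by apply: Hd => //; rewrite ler0_norm ?subr_le0//; move: tk; rewrite cS; lra.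
  have -> : f t - (f (c k) + (f (c k.+1) - f (c k)) * s) =
    (1 - s) * (f t - f (c k)) + s * (f t - f (c k.+1)) by ring.
  move: h1 h2; rewrite !ltr_norml => /andP[a1 a2] /andP[b1 b2].
  have convex_lt (a b r : R) : a < r -> b < r -> (1 - s) * a + s * b < r.
    move=> ar br; have [->|s0] := eqVneq s 0; first by rewrite subr0 mul1r mul0r addr0.
    have : 0 < s * (r - b) by rewrite mulr_gt0 ?subr_gt0// lt0r s0.
    have : 0 <= (1 - s) * (r - a) by rewrite mulr_ge0 ?subr_ge0// ltW.
    by lra.
  apply/andP; split; last exact: convex_lt.
  have := convex_lt (- (f t - f (c k))) (- (f t - f (c k.+1))) eps.
  by rewrite !mulrN -opprD => H; rewrite ltrNl; apply: H; rewrite ltrNl.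
Qed.

End uniform_approximation.

(** * Weighted approximation of densities by derivatives *)

Lemma clamp_le {R : realType} (M a b : R) : `|a| <= M ->
  `|a - Num.max (- M) (Num.min M b)| <= `|a - b|.
Proof.
rewrite ler_norml => /andP[h1 h2].
have [c1 c2] : a - b <= `|a - b| /\ b - a <= `|a - b|.
  by rewrite ler_norm -opprB ler_normr lexx orbT.
move: `|a - b| c1 c2 => n c1 c2; have M0 : - M <= M by exact: le_trans h2.
have [Mb|/ltW bM] := leP M b.
  by rewrite (max_idPr M0) ler_norml; apply/andP; split; lra.
have [Mb|/ltW bM'] := leP (- M) b; by rewrite ler_norml; apply/andP; split; lra.
Qed.

Section smooth_density.
Context {R : realType}.
Notation mR := (measurableTypeR R).
Notation leb := (@lebesgue_measure R).
Variables (c d : R).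
Hypothesis cd : c < d.
Let D : set mR := `]c, d]%classic.
Let mD : measurable D. Proof. exact: measurable_itv. Qed.

(** A continuous L^1 approximant is clamped to [-M, M], multiplied by a bump that vanishes at the
    ends, and smoothed uniformly. Each of the three errors is at most sigma / 4. *)
Let bounded_approx (h : R -> R) (M sigma : R) : 0 < M -> 0 < sigma ->
  measurable_fun D h -> (forall t, D t -> `|h t| <= M) ->
  exists chi : R -> R, [/\ smooth chi, forall t, t <= c \/ d <= t -> chi t = 0,
    forall t, `|chi t| <= M + 1 & integral_le leb D (fun t => `|h t - chi t|) sigma].
Proof.
move=> M0 s0 mh hM.
have ih : leb.-integrable D (EFin \o h).
  apply: (integral_le_integrable (a := M * (d - c))) => //.
  apply: (integral_le_mono (G := cst M) (a := M * (d - c))) => //.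
  - exact: measurableT_comp.
  - by move=> t /hM ->; rewrite normr_ge0.
  - split => //; first by move=> *; exact: ltW.
    by rewrite integral_cst_oc// ltW.
have Doo : (leb D < +oo)%E.
  by apply: le_lt_trans (ltry (d - c)); rewrite le_eqVlt; apply/orP; left; apply/eqP; exact: lebesgue_itv_oc (ltW cd).
have [g_ [cg ig gh]] := approximation_continuous_integrable mD Doo ih.
have s40 : 0 < sigma / 4 by rewrite divr_gt0.
have [n Hn] := cvg0_lt gh s40.
pose g t := Num.max (- M) (Num.min M (g_ n t)).
have gM t : `|g t| <= M.
  by rewrite ler_norml /g le_max lexx /= ge_max ge_min lexx /= andbT; lra.
have gh' t : D t -> `|h t - g t| <= `|h t - g_ n t|.
  by move=> /hM; exact: clamp_le.
have cgg : continuous g.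
  move=> t; apply: (@continuous_comp _ _ _ (fun u => Num.min M (g_ n u)) (fun u => Num.max (- M) u)).
    apply: (@continuous_comp _ _ _ (g_ n) (fun u => Num.min M u)); first exact: cg.
    by apply: continuous_min; [exact: cst_continuous|exact: cvg_id].
  by apply: continuous_max; [exact: cst_continuous|exact: cvg_id].
(* The two boundary layers of length [k], which may overlap, cost at most 2 k M = sigma / 4. *)
pose k := sigma / (8 * M).
have k0 : 0 < k by rewrite divr_gt0// mulr_gt0.
have [beta [sb b01 b1 b0]] := @smooth_bump R c (c + k) (d - k) d (ltac:(lra)) (ltac:(lra)).
(* The 1 keeps [chi] below M + 1; the other term makes the uniform error cost at most sigma / 4 in
   L^1. *)
pose eta := Num.min 1 (sigma / (4 * (d - c))).
have dc0 : 0 < d - c by rewrite subr_gt0.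
have eta0 : 0 < eta by rewrite lt_min ltr01 divr_gt0// mulr_gt0.
have cbg : continuous (fun t => beta t * g t).
  by move=> t; apply: continuousM; [exact: smooth_continuous|exact: cgg].
have bg0 t : t <= c \/ d <= t -> beta t * g t = 0 by move=> /b0 ->; rewrite mul0r.
have [chi [schi chi0 chiE]] := smooth_uniform_approx cd cbg bg0 eta0.
have mchi : measurable_fun (setT : set mR) chi by exact: smooth_measurable.
exists chi; split => //.
  move=> t; have h1 := chiE t; have h2 := gM t; have /andP[h3 h4] := b01 t.
  have h5 : eta <= 1 by rewrite ge_min lexx.
  have h6 : `|beta t * g t| <= M.
    rewrite normrM ger0_norm// -[leRHS]mul1r ler_pM//.
  have := ler_distD (beta t * g t) (chi t) 0.
  by rewrite !subr0 distrC; lra.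
pose A : set mR := `]c, c + k]%classic; pose B : set mR := `]d - k, d]%classic.
have mA : measurable A by exact: measurable_itv.
have mB : measurable B by exact: measurable_itv.
have iA : integral_le leb D (\1_A) k.
  split; [by apply: measurable_indic; exact: measurable_itv|by move=> t _; rewrite indicE|].
  rewrite integral_indic//.
  have -> : k%:E = leb A by rewrite lebesgue_itv_oc ?lerDl ?ltW// addrAC subrr add0r.
  by apply: le_measure; rewrite ?inE//; exact: measurableI.
have iB : integral_le leb D (\1_B) k.
  split; [by apply: measurable_indic; exact: measurable_itv|by move=> t _; rewrite indicE|].
  rewrite integral_indic//.
  have -> : k%:E = leb B by rewrite lebesgue_itv_oc ?gerBl ?ltW// opprB addrCA subrr addr0.
  by apply: le_measure; rewrite ?inE//; exact: measurableI.
have iAB := integral_leZ mD (ltW M0) (integral_leD mD iA iB).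
have ieta : integral_le leb D (cst eta) (eta * (d - c)).
  split => //; first by move=> *; exact: ltW.
  by rewrite integral_cst_oc// ltW.
have ig' : integral_le leb D (fun t => `|h t - g_ n t|) (sigma / 4).
  split => //; last exact: ltW.
  apply: measurableT_comp => //; apply: measurable_funB => //.
  by apply: measurable_funTS; exact: continuous_measurable_fun.
apply: integral_le_mono (integral_leD mD ig' (integral_leD mD iAB ieta)) _ => //.
- apply: measurableT_comp => //; apply: measurable_funB => //.
  exact: measurable_funTS.
- move=> t Dt; rewrite normr_ge0/=.
  have -> : h t - chi t = (h t - g t) + ((1 - beta t) * g t + (beta t * g t - chi t)) by ring.
  apply: le_trans (ler_normD _ _) _; apply: lerD; first exact: gh'.
  apply: le_trans (ler_normD _ _) _; apply: lerD; last exact/ltW/chiE.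
  have /andP[h3 h4] := b01 t.
  rewrite normrM ger0_norm ?subr_ge0// mulrC.
  have [tA|tA] := pselect (A t).
    rewrite !indicE mem_set//; apply: ler_pM => //; first by rewrite subr_ge0.
    by rewrite (@le_trans _ _ 1)// ?gerBl// lerDl.
  have [tB|tB] := pselect (B t).
    rewrite !indicE (mem_set tB); apply: ler_pM => //; first by rewrite subr_ge0.
    by rewrite (@le_trans _ _ 1)// ?gerBl// lerDr.
  have -> : beta t = 1; last first.
    by rewrite subrr mulr0 mulr_ge0 ?addr_ge0 ?(ltW M0)// indicE.
  apply: b1.
  move: Dt; rewrite /D/= in_itv/= => /andP[ct td]; apply/andP; split.
    rewrite leNgt; apply/negP => tk; apply: tA.
    by rewrite /A/= in_itv/= ct ltW.
  by rewrite leNgt; apply/negP => tk; apply: tB; rewrite /B/= in_itv/= tk td.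
- have h1 : M * (k + k) = sigma / 4 by rewrite /k; field; rewrite gt_eqF.
  have h2 : eta * (d - c) <= sigma / 4.
    apply: (@le_trans _ _ (sigma / (4 * (d - c)) * (d - c))).
      by rewrite ler_pM2r// ge_min lexx orbT.
    by rewrite le_eqVlt; apply/orP; left; apply/eqP; field; rewrite gt_eqF.
  by rewrite h1; lra.
Qed.

(* h is truncated at height M, approximated in L^1 by a smooth chi0 bounded by
   M + 1, and corrected by a multiple of a bump b2 to have integral 0.  In the
   weighted norm the L^1 error is used where w <= L, and the tail of w elsewhere. *)
Lemma smooth_density (h w : R -> R) (eps : R) : measurable_fun D h ->
  measurable_fun D w -> (forall t, D t -> 0 <= w t) ->
  leb.-integrable D (EFin \o h) -> leb.-integrable D (EFin \o w) ->
  leb.-integrable D (fun t => (h t ^+ 2 * w t)%:E) ->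
  \int[leb]_(t in D) h t = 0 -> 0 < eps ->
  exists f : R -> R, [/\ smooth f, forall t, t <= c \/ d <= t -> f t = 0,
    integral_le leb D (fun t => (h t - derive1 f t) ^+ 2 * w t) eps &
    forall t, D t -> `|\int[leb]_(u in `]c, t]) h u - f t| <= eps].
Proof.
move=> mh mw w0 ih iw ihw h0 e0.
have dc0 : 0 < d - c by rewrite subr_gt0.
have [b2 [b2s b20 [Bd b2B b2i]]] : exists b2 : R -> R, [/\ smooth b2,
    forall t, t <= c \/ d <= t -> b2 t = 0 & exists2 Bd : R, (forall t, `|b2 t| <= Bd)
    & \int[leb]_(t in D) b2 t = 1].
  (* A bump equal to 1 on the middle third has integral at least (d - c) / 3, hence can be
     normalized to integral 1. *)
  pose p := c + (d - c) / 3; pose q := d - (d - c) / 3.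
  have cp : c < p by rewrite /p; lra.
  have qd : q < d by rewrite /q; lra.
  have pq : q - p = (d - c) / 3 by rewrite /p /q; lra.
  have pq0 : p <= q by rewrite -subr_ge0 pq divr_ge0// ltW.
  have [beta [sb b01 b1 b0]] := smooth_bump cp qd.
  have [G sG [G' [G0 GE]]] := smooth_antiderivative sb b0.
  have ib (B : set mR) : measurable B -> leb.-integrable B (EFin \o beta).
    by move=> mB; exact: integrableS (smooth_supp_integrable sb b0).
  have Gd : 0 < \int[leb]_(t in D) beta t.
    apply: (@lt_le_trans _ _ ((d - c) / 3)); first by rewrite divr_gt0.
    rewrite /Rintegral -lee_fin fineK; last by apply: integrable_fin_num => //; exact: ib.
    apply: (@le_trans _ _ (\int[leb]_(t in `]p, q]) (beta t)%:E)%E).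
      rewrite (eq_integral (cst (1%R)%:E)); last first.
        move=> t /[!inE]/=; rewrite in_itv/= => /andP[k1 k2].
        by rewrite b1// ltW.
      by rewrite integral_cst_oc// mul1r pq.
    apply: ge0_subset_integral => //.
    - by apply/measurable_EFinP; exact: smooth_measurable.
    - by move=> t _; rewrite lee_fin; case/andP: (b01 t).
    - move=> t; rewrite /D/= !in_itv/= => /andP[k1 k2].
      by rewrite (lt_trans cp)//= (le_trans k2)// ltW.
  set V := Rintegral _ _ _ in Gd.
  exists (fun t => V^-1 * beta t); split.
  - exact: (smoothM (@smooth_cst _ _) sb).
  - by move=> t /b0 ->; rewrite mulr0.
  - exists (V^-1).
      move=> t; have /andP[k1 k2] := b01 t.
      have V0 : 0 <= V^-1 by rewrite invr_ge0 ltW.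
      by rewrite normrM (ger0_norm V0) (ger0_norm k1) ler_piMr.
    by rewrite RintegralZl ?mulVf ?gt_eqF//; exact: ib.
have Bd0 : 0 <= Bd by apply: le_trans (b2B 0).
pose W := fine (\int[leb]_(t in D) (w t)%:E)%E.
have iW : integral_le leb D w W.
  split => //; rewrite /W fineK//; exact: integrable_fin_num.
have W0 : 0 <= W by apply: fine_ge0; apply: integral_ge0 => t Dt; rewrite lee_fin w0.
(* [C] collects what [tau] multiplies: the L^1 error, the primitive of the correcting bump, and the
   weighted square of that bump. *)
pose C := 1 + Bd * (d - c) + Bd ^+ 2 * W.
have Bdc0 : 0 <= Bd * (d - c) by rewrite mulr_ge0// ltW.
have BW0 : 0 <= Bd ^+ 2 * W by rewrite mulr_ge0// sqr_ge0.
have C1 : 1 <= C by rewrite /C; lra.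
have C0 : 0 < C by apply: lt_le_trans C1.
(* The cap 1 gives r^2 <= |r| <= [tau] for the integral [r] to be corrected. *)
pose tau := Num.min 1 (eps / (12 * C)).
have tau0 : 0 < tau by rewrite lt_min ltr01 divr_gt0// mulr_gt0.
have tau1 : tau <= 1 by rewrite ge_min lexx.
have tauC : tau * C <= eps / 12.
  apply: (@le_trans _ _ (eps / (12 * C) * C)); first by rewrite ler_pM2r// ge_min lexx orbT.
  by rewrite le_eqVlt; apply/orP; left; apply/eqP; field; rewrite gt_eqF.
have mnh : measurable_fun D (fun t => `|h t|) by exact: measurableT_comp.
have mh2w : measurable_fun D (fun t => h t ^+ 2 * w t).
  by apply: measurable_funM => //; exact: measurable_funX.
have t20 : 0 < tau / 2 by rewrite divr_gt0.
have e90 : 0 < eps / 9 by rewrite divr_gt0.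
have [M1 HM1] := integrable_tail mD ih mnh t20.
have [M2 HM2] := integrable_tail mD ihw mnh e90.
pose M : R := (M1 + M2 + 1)%N%:R.
have M0 : 0 < M by rewrite ltr0n addn1.
have M1M : M1%:R <= M by rewrite ler_nat -addnA leq_addr.
have M2M : M2%:R <= M by rewrite ler_nat addnAC leq_addl.
pose hM t := if `|h t| <= M then h t else 0.
have mhM : measurable_fun D hM.
  apply: measurable_fun_if => //; first exact: measurable_fun_ler.
  exact: (measurable_funS mD (@subIsetl _ _ _) mh).
have hMM t : D t -> `|hM t| <= M.
  by move=> _; rewrite /hM; case: ifP => // _; rewrite normr0; exact/ltW/M0.
have iT1 : integral_le leb D (fun t => `|h t - hM t|) (tau / 2).
  apply: (integral_le_mono (G := fun t => if `|h t| <= M1%:R then 0 else `|h t|) (a := tau / 2)) => //.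
  - by apply: measurableT_comp => //; exact: measurable_funB.
  - move=> t Dt; rewrite normr_ge0/= /hM; case: ifP => k1; case: ifP => k2.
    + by rewrite subrr normr0.
    + by rewrite subrr normr0.
    + by rewrite (le_trans k2 M1M) in k1.
    + by rewrite subr0.
  - split; [exact: measurable_fun_tail|by move=> t _; case: ifP|exact: ltW].
have iT2 : integral_le leb D (fun t => (h t - hM t) ^+ 2 * w t) (eps / 9).
  apply: (integral_le_mono (G := fun t => if `|h t| <= M2%:R then 0 else `|h t ^+ 2 * w t|) (a := eps / 9)) => //.
  - by apply: measurable_funM => //; apply: measurable_funX; exact: measurable_funB.
  - move=> t Dt; rewrite mulr_ge0 ?sqr_ge0 ?w0//= /hM; case: ifP => k1; case: ifP => k2.
    + by rewrite subrr expr0n mul0r.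
    + by rewrite subrr expr0n mul0r.
    + by rewrite (le_trans k2 M2M) in k1.
    + by rewrite subr0 ger0_norm// mulr_ge0 ?sqr_ge0 ?w0.
  - split; [exact: measurable_fun_tail|by move=> t _; case: ifP|exact: ltW].
(* [K] bounds |hM - chi0|, because |hM| <= M and |chi0| <= M + 1. *)
pose K := 2 * M + 1.
have K0 : 0 < K by rewrite /K; lra.
have eK0 : 0 < eps / (18 * K ^+ 2) by rewrite divr_gt0// mulr_gt0// exprn_gt0.
have [L HL] := integrable_tail mD iw mw eK0.
have iL : integral_le leb D (fun t => if w t <= L%:R then 0 else `|w t|) (eps / (18 * K ^+ 2)).
  by split; [exact: measurable_fun_tail|by move=> t _; case: ifP|exact: ltW].
pose sigma := Num.min (tau / 2) (eps / (18 * K * L.+1%:R)).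
have sigma0 : 0 < sigma.
  by rewrite lt_min t20 divr_gt0// mulr_gt0// mulr_gt0.
have [chi0 [schi0 chi00 chi0M ichi0]] := bounded_approx M0 sigma0 mhM hMM.
have mchi0 : measurable_fun D chi0 by exact: smooth_measurable.
pose r := \int[leb]_(t in D) chi0 t.
have ichi (B : set mR) : measurable B -> leb.-integrable B (EFin \o chi0).
  by move=> mB; exact: integrableS (smooth_supp_integrable schi0 chi00).
have iD1 : integral_le leb D (fun t => `|h t - chi0 t|) tau.
  apply: (integral_le_mono _ _ _ (integral_leD mD iT1 ichi0)) => //.
  - by apply: measurableT_comp => //; exact: measurable_funB.
  - by move=> t Dt; rewrite normr_ge0/= ler_distD.
  - by rewrite [leRHS](splitr tau) lerD2l ge_min lexx.
have rtau : `|r| <= tau.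
  have := integral_le_Rintegral mD (measurable_funB mh mchi0) iD1.
  by rewrite RintegralB//; [rewrite h0 sub0r normrN|exact: ichi].
pose chi t := chi0 t + - r * b2 t.
have schi : smooth chi.
  exact: (smoothD schi0 (smoothM (@smooth_cst _ _) b2s)).
have chi_0 t : t <= c \/ d <= t -> chi t = 0.
  by move=> tcd; rewrite /chi chi00// b20// mulr0 addr0.
have ib2 (B : set mR) : measurable B -> leb.-integrable B (EFin \o b2).
  by move=> mB; exact: integrableS (smooth_supp_integrable b2s b20).
have mchi : measurable_fun D chi by exact: smooth_measurable.
have chiD : \int[leb]_(t in D) chi t = 0.
  rewrite /chi RintegralD//; [|exact: ichi|].
    by rewrite RintegralZl ?b2i ?mulr1 -/r ?subrr//; exact: ib2.
  rewrite (_ : EFin \o _ = (fun t => (- r)%:E * (b2 t)%:E)%E)//.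
  by apply: integrableZl => //; exact: ib2.
have [f sf [f' [fc fE]]] := smooth_antiderivative schi chi_0.
exists f; split => //.
- move=> t [|dt]; first exact: fc.
  have cdt : c <= t by rewrite (le_trans _ dt)// ltW.
  have := fE _ _ dt; have := fE _ _ (ltW cd); rewrite chiD (fc c)// subr0 => ->.
  rewrite subr0 => ->; rewrite /Rintegral integral0_eq// => u /=.
  by rewrite in_itv/= => /andP[du _]; rewrite chi_0//; right; exact: ltW.
- rewrite f'.
  have iB2 := integral_leZ mD (_ : 0 <= 3 * (tau * Bd ^+ 2)) iW.
  have iKL := integral_leD mD
    (integral_leZ mD (_ : 0 <= 3 * (K * L.+1%:R)) ichi0)
    (integral_leZ mD (_ : 0 <= 3 * K ^+ 2) iL).
  have p1 : 0 <= 3 * (tau * Bd ^+ 2) by rewrite !mulr_ge0 ?sqr_ge0// ltW.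
  have p2 : 0 <= 3 * (K * L.+1%:R) by rewrite !mulr_ge0// ltW.
  have p3 : 0 <= 3 * K ^+ 2 by rewrite mulr_ge0// sqr_ge0.
  apply: (integral_le_mono _ _ _ (integral_leD mD (integral_leZ mD (ler0n R 3) iT2)
    (integral_leD mD (iKL p2 p3) (iB2 p1)))) => //.
  + by apply: measurable_funM => //; apply: measurable_funX; exact: measurable_funB.
  + move=> t Dt; have wt := w0 _ Dt.
    rewrite mulr_ge0 ?sqr_ge0//=.
    set X := h t - hM t; set Y := hM t - chi0 t; set Z := r * b2 t.
    have -> : h t - chi t = X + Y + Z by rewrite /chi /X /Y /Z; ring.
    have YK : `|Y| <= K.
      apply: (le_trans (ler_normB _ _)); rewrite /K.
      have := lerD (hMM _ Dt) (chi0M t).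
      by rewrite (_ : M + (M + 1) = 2 * M + 1) //; ring.
    (* With the factor 3, truncation costs eps / 3, the L^1 approximation eps / 3 (two halves, one
       for each range of [w]), and the correcting bump eps / 4. *)
    have hX : (X + Y + Z) ^+ 2 <= 3 * X ^+ 2 + 3 * Y ^+ 2 + 3 * Z ^+ 2.
      rewrite -subr_ge0 (_ : _ - _ = (X - Y) ^+ 2 + (Y - Z) ^+ 2 + (Z - X) ^+ 2); last by ring.
      by rewrite !addr_ge0// sqr_ge0.
    have hZ : Z ^+ 2 <= tau * Bd ^+ 2.
      rewrite /Z exprMn ler_pM ?sqr_ge0//.
        rewrite -[r ^+ 2]real_normK ?num_real// expr2.
        apply: (@le_trans _ _ (`|r| * 1)); last by rewrite mulr1.
        by rewrite ler_wpM2l// (le_trans rtau).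
      by rewrite -[b2 t ^+ 2]real_normK ?num_real// lerXn2r ?nnegrE.
    have hY : Y ^+ 2 * w t <= K * L.+1%:R * `|Y| + K ^+ 2 * (if w t <= L%:R then 0 else `|w t|).
      rewrite -[Y ^+ 2]real_normK ?num_real//; case: ifP => wL.
        rewrite mulr0 addr0 expr2 -!mulrA ler_pM ?mulr_ge0//.
        rewrite mulrC ler_wpM2r// (le_trans wL)// ler_nat; exact: leqnSn.
      rewrite (ger0_norm wt) -[leLHS]add0r lerD//.
        by rewrite !mulr_ge0// ltW.
      by rewrite ler_wpM2r// lerXn2r ?nnegrE// ltW.
    have hZw : Z ^+ 2 * w t <= tau * Bd ^+ 2 * w t by rewrite ler_wpM2r.
    apply: (le_trans (ler_wpM2r wt hX)).
    have alg (x y z v p q n : R) : y * v <= p + q -> z * v <= n * v ->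
        (3 * x + 3 * y + 3 * z) * v <= 3 * (x * v) + (3 * p + 3 * q + 3 * n * v).
      by move=> ? ?; lra.
    rewrite -(mulrA 3 (K * _)) -(mulrA 3 (K ^+ 2)); exact: alg hY hZw.
  + have q1 : K * L.+1%:R * sigma <= eps / 18.
      apply: (@le_trans _ _ (K * L.+1%:R * (eps / (18 * K * L.+1%:R)))).
        by rewrite ler_wpM2l ?ge_min ?lexx ?orbT// mulr_ge0// ltW.
      have q0 (l : R) : 0 < l -> K * l * (eps / (18 * K * l)) = eps / 18.
        by move=> l0; field; rewrite !gt_eqF.
      by rewrite q0.
    have q2 : K ^+ 2 * (eps / (18 * K ^+ 2)) = eps / 18 by field; rewrite gt_eqF.
    have q3 : tau * Bd ^+ 2 * W <= eps / 12.
      apply: le_trans tauC; rewrite -mulrA ler_pM2l// /C; lra.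
    by rewrite -!(mulrA 3) q2; lra.
- move=> t; rewrite /D/= in_itv/= => /andP[ct td].
  have sub : `]c, t]%classic `<=` D.
    by move=> u; rewrite /D/= !in_itv/= => /andP[-> ut]/=; rewrite (le_trans ut).
  have mct : measurable (`]c, t]%classic : set mR) by exact: measurable_itv.
  rewrite -[f t]subr0 -(fc c)// (fE _ _ (ltW ct)).
  rewrite -RintegralB//; [|exact: integrableS ih|]; last first.
    by exact: integrableS (smooth_supp_integrable schi chi_0).
  have iB1 : integral_le leb D (cst (tau * Bd)) (tau * Bd * (d - c)).
    split => //; first by move=> *; rewrite mulr_ge0// ltW.
    by rewrite integral_cst_oc// ltW.
  apply: integral_le_Rintegral => //.
    by apply: measurable_funS (measurable_funB mh mchi).
  apply: (integral_le_sub mD mct sub).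
  apply: (integral_le_mono _ _ _ (integral_leD mD iD1 iB1)) => //.
  + by apply: measurableT_comp => //; exact: measurable_funB.
  + move=> u Du; rewrite normr_ge0/= /chi opprD addrA mulNr opprK.
    apply: (le_trans (ler_normD _ _)); rewrite lerD2l normrM ler_pM//.
  + have : tau * (1 + Bd * (d - c)) <= tau * C by rewrite ler_pM2l// /C; lra.
    by rewrite mulrDr mulr1 mulrA; lra.
Qed.

End smooth_density.

(** * The energy norm *)

Section energy_norm.
Context {R : realType}.
Notation mR := (measurableTypeR R).
Notation leb := (@lebesgue_measure R).
Implicit Types (m mu : {measure set mR -> \bar R}) (u v h k : R -> R).

Lemma densityB (I : set R) mu u v h k : density I mu u h -> density I mu v k ->
  measurable (I : set mR) ->
  density I mu (u \- v) (fun t => h t - k t).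
Proof.
move=> [mh ih uE] [mk ik vE] mI; split.
- exact: measurable_funB.
- move=> x y Ix Iy xy.
  rewrite (_ : EFin \o _ = ((EFin \o h) \- (EFin \o k))%E); last first.
    by apply/funext => t /=; rewrite EFinB.
  by apply: integrableB => //; [exact: ih|exact: ik].
- move=> x y Ix Iy xy; rewrite RintegralB//; [|exact: ih|exact: ik].
  by rewrite -uE// -vE//=; ring.
Qed.

Variables (I : set R) (e : R) (s : R -> R) (m : {measure set mR -> \bar R}).
Hypotheses (oI : open I) (iI : is_interval I).
Hypothesis ss : scaling_function I e s.
Hypothesis nuP : is_stieltjes_measure I s (stieltjes I s).
Let nu := stieltjes I s.
Let mI : measurable (I : set mR). Proof. exact: open_measurable. Qed.

Definition finite_energy mu u h := density I mu u h /\
  exists A : R, integral_le mu I (fun t => h t ^+ 2) A /\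
                integral_le m I (fun t => u t ^+ 2) A.

Let scale_derive_integral u h v k : density I nu u h -> density I nu v k ->
  (\int[nu]_(x in I) (scale_derive I s u x * scale_derive I s v x)%:E =
   \int[nu]_(x in I) (h x * k x)%:E)%E.
Proof.
move=> dh dk.
have [Z1 [mZ1 Z10 Z1E]] := density_scale_derive oI iI ss nuP dh.
have [Z2 [mZ2 Z20 Z2E]] := density_scale_derive oI iI ss nuP dk.
apply: (@integral_ae_eq_nonmeas _ _ _ (Z1 `|` Z2)) => //.
- exact: measurableU.
- by rewrite measureU0.
- by move=> t It /not_orP[n1 n2]; rewrite Z1E// Z2E.
Qed.

Let finite_integral_le mu (F : R -> R) : measurable_fun (I : set mR) F ->
  (forall t, I t -> 0 <= F t) -> (\int[mu]_(t in I) (F t)%:E < +oo)%E ->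
  integral_le mu I F (\int[mu]_(t in I) F t).
Proof.
move=> mF F0 Foo; split => //; rewrite /Rintegral fineK// ge0_fin_numE//.
by apply: integral_ge0 => t It; rewrite lee_fin F0.
Qed.

Let integral_le_bound mu (F : R -> R) (a : R) : integral_le mu I F a -> \int[mu]_(t in I) F t <= a.
Proof.
move=> [mF F0 Fa]; rewrite /Rintegral -lee_fin fineK//.
rewrite ge0_fin_numE ?(le_lt_trans Fa) ?ltry//.
by apply: integral_ge0 => t It; rewrite lee_fin F0.
Qed.

(** [scale_derive] agrees with any density off a [nu]-null set, so its default values do not affect
    the domain; membership is handled through densities from here on. *)
Lemma finite_E1P u : finite_E1 I s m u <-> exists h, finite_energy nu u h.
Proof.
split=> [[/(ac_wrt_density oI iI ss nuP)[h dh] uoo moo]|[h [dh [A [hA uA]]]]].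
  exists h; split => //.
  have [mh _ _] := dh; have mu := density_measurable oI iI ss nuP dh.
  have hoo : (\int[nu]_(x in I) (h x ^+ 2)%:E < +oo)%E.
    under eq_integral do rewrite expr2.
    rewrite -(scale_derive_integral dh dh).
    by under eq_integral do rewrite -expr2.
  have h1 := finite_integral_le (measurable_funX 2 mh) (fun t _ => sqr_ge0 _) hoo.
  have h2 := finite_integral_le (measurable_funX 2 mu) (fun t _ => sqr_ge0 _) moo.
  exists (Num.max (\int[nu]_(t in I) h t ^+ 2) (\int[m]_(t in I) u t ^+ 2)).
  split; [have [k1 k2 k3] := h1|have [k1 k2 k3] := h2]; split => //;
    by apply: le_trans k3 _; rewrite lee_fin le_max lexx ?orbT.
split.
- exact: (density_ac_wrt oI iI ss nuP dh).
- under eq_integral do rewrite expr2.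
  rewrite (scale_derive_integral dh dh); under eq_integral do rewrite -expr2.
  by have [_ _ h1] := hA; apply: le_lt_trans h1 (ltry _).
- by have [_ _ h1] := uA; apply: le_lt_trans h1 (ltry _).
Qed.

Lemma energyE u v h k : density I nu u h -> density I nu v k ->
  energy I s u v = 2^-1 * \int[nu]_(x in I) (h x * k x).
Proof.
by move=> dh dk; rewrite /energy /Rintegral (scale_derive_integral dh dk).
Qed.

Lemma E1_norm_le u h (A : R) : density I nu u h ->
  integral_le nu I (fun t => h t ^+ 2) A -> integral_le m I (fun t => u t ^+ 2) A ->
  E1_norm I s m u <= Num.sqrt (2 * A).
Proof.
move=> dh /integral_le_bound hA /integral_le_bound uA.
have X0 : 0 <= \int[nu]_(t in I) h t ^+ 2 by apply: Rintegral_ge0 => t It; exact: sqr_ge0.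
rewrite /E1_norm (energyE dh dh) ler_wsqrtr//.
under eq_Rintegral do rewrite -expr2.
by move: hA uA X0; set X := Rintegral _ _ _; set Y := Rintegral _ _ _ => hA uA X0; lra.
Qed.

(** The factor 2 undoes the 1/2 of the energy. Finiteness is essential: a real-valued integral is 0
    by default when the extended one is infinite, and a small norm would then mean nothing. *)
Lemma E1_norm_lt u h (eps : R) : finite_energy nu u h -> E1_norm I s m u < eps ->
  integral_le nu I (fun t => h t ^+ 2) (2 * eps ^+ 2) /\
  integral_le m I (fun t => u t ^+ 2) (2 * eps ^+ 2).
Proof.
move=> [dh [A [hA uA]]] Neps.
have [mh h0 hI] := hA; have [mu u0 uI] := uA.
have i1 := finite_integral_le mh h0 (le_lt_trans hI (ltry _)).
have i2 := finite_integral_le mu u0 (le_lt_trans uI (ltry _)).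
have X0 : 0 <= \int[nu]_(t in I) h t ^+ 2 by apply: Rintegral_ge0 => t It; exact: sqr_ge0.
have Y0 : 0 <= \int[m]_(t in I) u t ^+ 2 by apply: Rintegral_ge0 => t It; exact: sqr_ge0.
have e0 : 0 < eps by apply: le_lt_trans Neps; exact: sqrtr_ge0.
have : 2^-1 * \int[nu]_(t in I) h t ^+ 2 + \int[m]_(t in I) u t ^+ 2 < eps ^+ 2.
  move: Neps; rewrite /E1_norm (energyE dh dh) -ltr_sqr ?nnegrE ?sqrtr_ge0 ?ltW//.
  under eq_Rintegral do rewrite -expr2.
  by rewrite sqr_sqrtr// addr_ge0// mulr_ge0// invr_ge0.
move: i1 i2 X0 Y0; set X := Rintegral _ _ _; set Y := Rintegral _ _ _ => i1 i2 X0 Y0 XY.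
have [p1 p2 p3] := i1; have [q1 q2 q3] := i2.
by split; split => //; [apply: le_trans p3 _|apply: le_trans q3 _]; rewrite lee_fin; lra.
Qed.

Let sqr_dist_le mu (F G : R -> R) (A B : R) : measurable_fun (I : set mR) F ->
  measurable_fun (I : set mR) G ->
  integral_le mu I (fun t => F t ^+ 2) A -> integral_le mu I (fun t => G t ^+ 2) B ->
  forall H : R -> R, measurable_fun (I : set mR) H -> (forall t, I t -> H t = F t + G t) ->
  integral_le mu I (fun t => H t ^+ 2) (2 * A + 2 * B).
Proof.
move=> mF mG FA GB H mH HE.
apply: integral_le_mono (integral_leD mI (integral_leZ mI (ler0n R 2) FA)
  (integral_leZ mI (ler0n R 2) GB)) (lexx _) => //.
  exact: measurable_funX.
move=> t It; rewrite sqr_ge0 HE//= -subr_ge0.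
by rewrite (_ : _ - _ = (F t - G t) ^+ 2) ?sqr_ge0//; ring.
Qed.

Lemma finite_energyB u v h k : finite_energy nu u h -> finite_energy nu v k ->
  finite_energy nu (u \- v) (fun t => h t - k t).
Proof.
move=> [dh [A [hA uA]]] [dk [B [kB vB]]].
have [[mh _ _] [mk _ _]] := (dh, dk).
have mu := density_measurable oI iI ss nuP dh.
have mv := density_measurable oI iI ss nuP dk.
split; first exact: densityB.
exists (2 * A + 2 * B); split.
- apply: (sqr_dist_le (F := h) (G := fun t => - k t)) => //.
  + exact: measurableT_comp.
  + by move: kB; under [X in integral_le _ _ X _]eq_fun do rewrite -sqrrN.
  + exact: measurable_funB.
- apply: (sqr_dist_le (F := u) (G := fun t => - v t)) => //.
  + exact: measurableT_comp.
  + by move: vB; under [X in integral_le _ _ X _]eq_fun do rewrite -sqrrN.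
  + exact: measurable_funB.
Qed.

Lemma finite_E1B u v : finite_E1 I s m u -> finite_E1 I s m v ->
  finite_E1 I s m (u \- v).
Proof.
move=> /finite_E1P[h uh] /finite_E1P[k vk]; apply/finite_E1P.
by exists (fun t => h t - k t); exact: finite_energyB.
Qed.

(** A crude triangle inequality from (a + b)^2 <= 2 a^2 + 2 b^2 applied pointwise: the squares are
    bounded by 8 eps^2, and the square root of 2 times this is 4 eps. *)
Lemma E1_norm_triangle u v w (eps : R) : finite_E1 I s m u -> finite_E1 I s m v ->
  finite_E1 I s m w -> E1_norm I s m (u \- v) < eps -> E1_norm I s m (v \- w) < eps ->
  E1_norm I s m (u \- w) <= 4 * eps.
Proof.
move=> /finite_E1P[h uh] /finite_E1P[k vk] /finite_E1P[l wl] uv vw.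
have e0 : 0 <= eps by apply/ltW; apply: le_lt_trans uv; exact: sqrtr_ge0.
have [uv1 uv2] := E1_norm_lt (finite_energyB uh vk) uv.
have [vw1 vw2] := E1_norm_lt (finite_energyB vk wl) vw.
have [duw _] := finite_energyB uh wl.
have [[duv _] [dvw _]] := (finite_energyB uh vk, finite_energyB vk wl).
have -> : 4 * eps = Num.sqrt (2 * (2 * (2 * eps ^+ 2) + 2 * (2 * eps ^+ 2))).
  rewrite (_ : 2 * _ = (4 * eps) ^+ 2); last by ring.
  by rewrite sqrtr_sqr ger0_norm// mulr_ge0.
have [[m1 _ _] [m2 _ _] [m3 _ _]] := And3 duw duv dvw.
have n1 := density_measurable oI iI ss nuP duv.
have n2 := density_measurable oI iI ss nuP dvw.
have n3 := density_measurable oI iI ss nuP duw.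
apply: (E1_norm_le duw).
  by apply: (sqr_dist_le m2 m3 uv1 vw1) => // t _; rewrite subrKA.
by apply: (sqr_dist_le n1 n2 uv2 vw2) => // t _; rewrite /= subrKA.
Qed.

Lemma E1_norm0 u : E1_norm I s m (u \- u) = 0.
Proof.
have -> : u \- u = (fun _ => 0) by apply/funext => t /=; rewrite subrr.
have sd t : scale_derive I s (fun _ => 0) t = 0.
  rewrite /scale_derive (_ : _ \o _ = cst 0) ?derive1_cst//.
rewrite /E1_norm /energy.
under eq_Rintegral do rewrite sd mulr0.
under [X in _ + X]eq_Rintegral do rewrite expr0n/=.
by rewrite /Rintegral !integral0/= mulr0 addr0 sqrtr0.
Qed.

End energy_norm.

(** * Restriction of supports and of densities *)

Section supports.
Context {R : realType}.
Notation mR := (measurableTypeR R).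
Notation leb := (@lebesgue_measure R).
Implicit Types (mu : {measure set mR -> \bar R}) (D E : set mR) (f F G : R -> R).

Lemma Cc_smooth_derive1 (U : set R) f : Cc_smooth U f -> Cc_smooth U (derive1 f).
Proof.
move=> [sf cf fU].
have sub : tsupp (derive1 f) `<=` tsupp f.
  rewrite [X in _ `<=` X](closure_id _).1; last exact: closed_closure.
  apply: closureS => t /= ft; apply: contrapT => nt; move/eqP: ft; apply.
  have H : \forall r \near t, f r = cst 0 r.
    have : \forall r \near t, (~` tsupp f) r.
      by apply: open_nbhs_nbhs; split => //; apply: closed_openC; exact: closed_closure.
    by apply: filterS => r nr; apply: contrapT => /eqP fr; apply: nr; exact: subset_closure.
  by rewrite derive1E (near_eq_derive _ H) derive_cst.
split.
- exact: smooth_derive1.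
- by apply: subclosed_compact cf sub; exact: closed_closure.
- exact: subset_trans fU.
Qed.

Lemma smooth_bounded f (x y : R) : smooth f -> (forall t, t <= x \/ y <= t -> f t = 0) ->
  exists2 B, 0 <= B & forall t, `|f t| <= B.
Proof.
move=> sf f0; have [xy|yx] := leP x y; last first.
  exists 0 => // t; rewrite f0 ?normr0//.
  by have [tx|xt] := leP t x; [left|right; rewrite ltW// (lt_trans yx)].
have cf : {within `[x, y], continuous (fun t => `|f t|)}.
  apply: continuous_subspaceT => t.
  by apply: cvg_norm; exact: smooth_continuous.
have [c _ fc] := EVT_max xy cf.
exists `|f c| => // t; have [txy|txy] := boolP (t \in `[x, y]%R); first exact: fc.
rewrite f0 ?normr0//; move: txy; rewrite in_itv/= negb_and -!ltNge.
by move=> /orP[/ltW|/ltW]; [left|right].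
Qed.

Lemma Cc_smooth_density (J : set R) (j : R) f : open J -> is_interval J -> J j ->
  Cc_smooth J f -> density J leb f (derive1 f).
Proof.
move=> oJ iJ Jj Cf; have [sf _ _] := Cf.
have [sf' cf' f'J] := Cc_smooth_derive1 Cf.
have [x [y [Jx Jy _ f'0]]] := tsupp_segment oJ Jj cf' f'J.
have [G sG [G' [_ GE]]] := smooth_antiderivative sf' f'0.
have fG p q : f q - f p = G q - G p.
  (* [G] satisfies the integral formula by construction, and [f] differs from it by a constant. *)
  have d (t : R) : is_derive t (1 : R) (f \- G) 0.
    apply: is_derive_eq (is_deriveB (smooth_is_derive t sf) (smooth_is_derive t sG)) _.
    by rewrite G' subrr.
  by have /= := is_derive_0_is_cst p q d; move: (f p) (f q) (G p) (G q) => *; lra.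
split.
- exact: smooth_measurable.
- by move=> p q _ _ _; exact: integrableS (smooth_supp_integrable sf' f'0).
- by move=> p q _ _ pq; rewrite fG GE.
Qed.

Lemma integral_le_weaken mu D G a b : a <= b -> integral_le mu D G a ->
  integral_le mu D G b.
Proof. by move=> ab [mG G0 Ga]; split => //; apply: le_trans Ga _; rewrite lee_fin. Qed.

Lemma integral_le_extend mu D E G a : measurable D -> measurable E -> E `<=` D ->
  measurable_fun D G -> (forall t, D t -> ~ E t -> G t = 0) ->
  integral_le mu E G a -> integral_le mu D G a.
Proof.
move=> mD mE ED mG G0 [_ Gp Ga]; split => //.
  by move=> t Dt; have [/Gp//|/(G0 _ Dt)->] := pselect (E t).
have -> // : (\int[mu]_(t in D) (G t)%:E = \int[mu]_(t in E) (G t)%:E)%E.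
rewrite -[in RHS](setIidr ED) integral_mkcondr; apply: eq_integral => t /[!inE] Dt.
by rewrite patchE; case: ifPn => // /negP; rewrite inE => /(G0 _ Dt) ->.
Qed.

Lemma bounded_supp_integral_le mu D E F (B : R) : measurable D -> measurable E ->
  E `<=` D -> measurable_fun D F -> (forall t, D t -> ~ E t -> F t = 0) ->
  (forall t, E t -> `|F t| <= B) -> (mu E < +oo)%E ->
  integral_le mu D (fun t => F t ^+ 2) (B ^+ 2 * fine (mu E)).
Proof.
move=> mD mE ED mF F0 FB Eoo.
have mF2 : measurable_fun D (fun t => F t ^+ 2) by exact: measurable_funX.
apply: (integral_le_extend mD mE ED mF2).
  by move=> t Dt nE; rewrite F0// expr0n.
apply: (integral_le_mono (G := cst (B ^+ 2)) (a := B ^+ 2 * fine (mu E))) => //.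
- exact: measurable_funS mF2.
- move=> t Et; rewrite sqr_ge0/= -[F t ^+ 2]real_normK ?num_real//.
  by rewrite lerXn2r ?nnegrE ?FB// (le_trans _ (FB _ Et)).
- split => //; first by move=> t _; exact: sqr_ge0.
  rewrite (eq_integral (cst (B ^+ 2)%:E))// integral_cst//.
  have Efin : mu E \is a fin_num by rewrite ge0_fin_numE.
  by rewrite -{1}(fineK Efin) -EFinM.
Qed.

(** Projecting the endpoints onto [x, y] does not change the values of [f], and the part of ]p, q]
    inside ]x, y] is the interval between the projected endpoints. The new density vanishes at every
    point off ]x, y], as [small_E1_norm] demands. *)
Lemma density_truncate (I : set R) mu f h (x y : R) : is_interval I ->
  measurable (I : set mR) -> I x -> I y -> x <= y ->
  (forall t, I t -> t <= x \/ y <= t -> f t = 0) -> density I mu f h ->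
  density I mu f (h \_ (`]x, y]%classic : set mR)).
Proof.
move=> iI mI Ix Iy xy f0 [mh ih fE].
pose D : set mR := `]x, y]%classic.
have mD : measurable D by exact: measurable_itv.
have mhD : measurable_fun (I : set mR) (h \_ D).
  by apply/measurable_restrict => //; apply: measurable_funS mh => // t [].
pose cl t := Num.min y (Num.max x t).
have Icl t : I (cl t).
  apply: (interval_mem iI Ix Iy).
  by rewrite /cl le_min xy le_max lexx ge_min lexx.
have fcl t : I t -> f (cl t) = f t.
  move=> It; rewrite /cl; have [tx|xt] := leP t x.
    by rewrite (min_idPr xy) !f0//; left.
  have [yt|ty] := leP y t; last by [].
  by rewrite !f0//; right.
have clD p q : `]p, q]%classic `&` D = `]cl p, cl q]%classic.
  apply/seteqP; suff E t : (p < t <= q) && (x < t <= y) = (cl p < t <= cl q).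
    by split => t; rewrite /D/= !in_itv/= -E => /andP.
  rewrite /cl gt_min gt_max le_min le_max (leNgt t y) (leNgt t x).
  by case: (y < t); case: (x < t); case: (p < t); case: (t <= q).
split => // p q Ip Iq pq.
- have mpq : measurable (`]p, q]%classic : set mR) by exact: measurable_itv.
  apply: (le_integrable mpq _ _ (ih _ _ Ip Iq pq)).
    apply/measurable_EFinP; apply: measurable_funS mhD => //.
    exact: interval_sub.
  move=> t _; rewrite /= lee_fin patchE; case: ifP => // _.
  by rewrite normr0.
- rewrite -Rintegral_mkcondr clD -fE//; first by rewrite !fcl.
  by rewrite le_min !ge_min lexx/= ge_max !le_max lexx pq !orbT.
Qed.

Lemma density_null (I : set R) mu f h (Z : set mR) : measurable (I : set mR) ->
  measurable Z -> mu Z = 0%E -> density I mu f h -> density I mu f (h \_ (~` Z)).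
Proof.
move=> mI mZ Z0 [mh ih fE].
have mr : measurable_fun (I : set mR) (h \_ (~` Z)).
  apply/measurable_restrict => //; first exact: measurableC.
  by apply: measurable_funS mh => // t [].
have hr t : ~ Z t -> h t = (h \_ (~` Z)) t by move=> nZ; rewrite patchT// inE.
split => // x y Ix Iy xy;
  have mxy : measurable (`]x, y]%classic : set mR) by exact: measurable_itv.
- have /integrableP[mhe hoo] := ih _ _ Ix Iy xy.
  have /measurable_EFinP mhD := mhe; apply/integrableP; split.
    apply/measurable_EFinP; apply/measurable_restrict => //; first exact: measurableC.
    by apply: measurable_funS mhD => // t [].
  move: hoo; rewrite (_ : (\int[mu]_(t in `]x, y]) `|(EFin \o h) t| =
    \int[mu]_(t in `]x, y]) `|(EFin \o h \_ (~` Z)) t|)%E)//.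
  by apply: (integral_ae_eq_nonmeas mxy mZ Z0) => t _ nZ; rewrite /= hr.
- rewrite fE//; congr fine.
  by apply: (integral_ae_eq_nonmeas mxy mZ Z0) => t _ nZ; rewrite hr.
Qed.

Lemma restrict_sqr_le mu D E h a : measurable D -> measurable E ->
  integral_le mu D (fun t => h t ^+ 2) a ->
  integral_le mu D (fun t => (h \_ E) t ^+ 2) a.
Proof.
move=> mD mE ha; apply: (integral_le_mono mD _ _ ha (lexx a)).
- have [mh _ _] := ha.
  have : measurable_fun D ((fun t => h t ^+ 2) \_ E).
    by apply/measurable_restrict => //; apply: measurable_funS mh => // t [].
  apply: eq_measurable_fun => t _; rewrite !patchE; case: ifP => // _.
  by rewrite expr0n.
- move=> t _; rewrite sqr_ge0/= patchE; case: ifP => // _.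
  by rewrite expr0n sqr_ge0.
Qed.

End supports.

(** * Approximation by smooth functions of the scale *)

Section scale_approximation.
Context {R : realType}.
Notation mR := (measurableTypeR R).
Notation leb := (@lebesgue_measure R).
Variables (I : set R) (e : R) (s : R -> R) (m : {measure set mR -> \bar R}).
Hypotheses (oI : open I) (iI : is_interval I) (Ie : I e) (mr : radon_on I m).
Hypothesis ss : scaling_function I e s.
Hypothesis nuP : is_stieltjes_measure I s (stieltjes I s).
Let nu := stieltjes I s.
Let J := s @` I.
Let mI : measurable (I : set mR). Proof. exact: open_measurable. Qed.
Let oJ : open J. Proof. exact: scaling_image_open ss. Qed.
Let iJ : is_interval J. Proof. exact: scaling_image_interval ss. Qed.
Let Je : J (s e). Proof. by exists e. Qed.

Lemma radon_itv x y : I x -> I y -> (m `]x, y]%classic < +oo)%E.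
Proof.
move=> Ix Iy; have sub : `[x, y]%classic `<=` I by exact: interval_sub.
apply: le_lt_trans (mr (@segment_compact _ x y) sub).
apply: le_measure; rewrite ?inE//.
by move=> t /=; rewrite !in_itv/= => /andP[/ltW-> ->].
Qed.

Lemma stieltjes_itv_fin x y : I x -> I y -> x <= y -> (nu `]x, y]%classic < +oo)%E.
Proof. by move=> Ix Iy xy; have [_ ->//] := nuP; exact: ltry. Qed.

(** The two bounds under which an approximation succeeds: small energy, and a small supremum for the
    L^2(I, m) part, since m is finite on ]x, y]. *)
Lemma small_E1_norm x y (eps : R) : I x -> I y -> x <= y -> 0 < eps ->
  exists2 delta, 0 < delta & forall u d, density I nu u d ->
    (forall t, I t -> ~ `]x, y]%classic t -> u t = 0 /\ d t = 0) ->
    integral_le nu `]x, y]%classic (fun t => d t ^+ 2) delta ->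
    (forall t, `]x, y]%classic t -> `|u t| <= delta) -> E1_norm I s m u < eps.
Proof.
move=> Ix Iy xy e0; pose D : set mR := `]x, y]%classic.
have mD : measurable D by exact: measurable_itv.
have DI : D `<=` I by exact: interval_sub.
pose M := fine (m D); have M0 : 0 <= M by exact: fine_ge0.
have M1 : 0 < M + 1 by rewrite ltr_wpDl.
(* Both [delta] and delta^2 M are at most delta (M + 1) <= eps^2 / 4, so the norm is at most the
   square root of eps^2 / 2; M + 1 is positive even if M is 0. *)
pose delta := Num.min 1 (eps ^+ 2 / (4 * (M + 1))).
have d0 : 0 < delta by rewrite lt_min ltr01 divr_gt0 ?exprn_gt0// mulr_gt0.
have d1 : delta <= 1 by rewrite ge_min lexx.
have dM : delta * (M + 1) <= eps ^+ 2 / 4.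
  apply: (@le_trans _ _ (eps ^+ 2 / (4 * (M + 1)) * (M + 1))).
    by rewrite ler_pM2r// ge_min lexx orbT.
  by rewrite le_eqVlt; apply/orP; left; apply/eqP; field; rewrite gt_eqF.
exists delta => // u d dud ud0 dl ul; have [md _ _] := dud.
have mu := density_measurable oI iI ss nuP dud.
have B1 : integral_le nu I (fun t => d t ^+ 2) (eps ^+ 2 / 4).
  apply: (integral_le_weaken (a := delta)).
    by apply: le_trans dM; rewrite ler_peMr ?(ltW d0)// lerDr.
  apply: (integral_le_extend (E := D)) => //; first exact: measurable_funX.
  by move=> t It /(ud0 _ It)[_ ->]; rewrite expr0n.
have B2 : integral_le m I (fun t => u t ^+ 2) (eps ^+ 2 / 4).
  apply: (integral_le_weaken (a := delta ^+ 2 * M)).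
    apply: le_trans dM; rewrite expr2 -mulrA ler_pM2l//.
    apply: (@le_trans _ _ (1 * M)); first by rewrite ler_wpM2r.
    by rewrite mul1r lerDl.
  apply: (bounded_supp_integral_le mI mD DI mu _ ul); last exact: radon_itv.
  by move=> t It /(ud0 _ It)[].
apply: le_lt_trans (E1_norm_le oI iI ss nuP dud B1 B2) _.
rewrite -[ltRHS]ger0_norm ?ltW// -sqrtr_sqr ltr_sqrt ?exprn_gt0//.
by have := exprn_gt0 2 e0; move: (eps ^+ 2) => E E0; lra.
Qed.

Lemma smooth_scale_density phi : Cc_smooth J phi ->
  density I nu (phi \o s) (derive1 phi \o s).
Proof.
by move=> Cphi; apply: (scaling_density_comp oI iI ss nuP (Cc_smooth_density oJ iJ Je Cphi)).
Qed.

Let smooth_scale_le (mu : {measure set mR -> \bar R}) psi : Cc_smooth J psi ->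
  (forall x y, I x -> I y -> x <= y -> (mu `]x, y]%classic < +oo)%E) ->
  exists A, integral_le mu I (fun t => psi (s t) ^+ 2) A.
Proof.
move=> [sp cp pJ] mufin.
have [_ [_ [[x Ix <-] [y Iy <-] xy p0]]] := tsupp_segment oJ Je cp pJ.
have {}xy : x <= y.
  by rewrite -(scaling_le ss Ix Iy) ltW//; case/andP: xy => h1 h2; exact: lt_trans h2.
have [B _ pB] := smooth_bounded sp p0.
pose D : set mR := `]x, y]%classic.
exists (B ^+ 2 * fine (mu D)).
apply: (bounded_supp_integral_le (E := D)) => //.
- exact: measurable_itv.
- exact: interval_sub.
- apply: measurableT_comp; first exact: smooth_measurable.
  exact: scaling_measurable ss.
- move=> t It; rewrite /D/= in_itv/= => /negP; rewrite negb_and -leNgt -ltNge => h.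
  apply: p0; rewrite !(scaling_le ss)//.
  by case/orP: h => [|/ltW]; [left|right].
- exact: mufin.
Qed.

Lemma smooth_scale_finite phi : Cc_smooth J phi -> finite_E1 I s m (phi \o s).
Proof.
move=> Cphi; apply/(finite_E1P m oI iI ss nuP); exists (derive1 phi \o s).
split; first exact: smooth_scale_density.
have [A1 h1] := smooth_scale_le (Cc_smooth_derive1 Cphi) stieltjes_itv_fin.
have [A2 h2] := smooth_scale_le Cphi (fun x y Ix Iy _ => radon_itv Ix Iy).
exists (Num.max A1 A2); split; [apply: integral_le_weaken h1|apply: integral_le_weaken h2];
  by rewrite le_max lexx ?orbT.
Qed.

(** [smooth_density] is applied in the scale coordinate, with weight 1 and [h] the Lebesgue density
    of [f] as a function of the scale. The integral of [h] is 0 because [f] vanishes at [x] and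
    [y]. *)
Lemma smooth_scale_approx f x y (eps : R) : I x -> I y -> x < y ->
  (forall t, I t -> t <= x \/ y <= t -> f t = 0) -> finite_E1 I s m f -> 0 < eps ->
  exists2 psi, Cc_smooth J psi & E1_norm I s m (f \- (psi \o s)) < eps.
Proof.
move=> Ix Iy xy f0 /(finite_E1P m oI iI ss nuP)[k [dk [A [kA _]]]] e0.
have [delta d0 small] := small_E1_norm Ix Iy (ltW xy) e0.
pose D : set mR := `]x, y]%classic.
have mD : measurable D by exact: measurable_itv.
have DI : D `<=` I by exact: interval_sub.
have cd : s x < s y by exact: (scaling_lt ss Ix Iy xy).
pose D' : set mR := `]s x, s y]%classic.
have mD' : measurable D' by exact: measurable_itv.
have [Jx Jy] : J (s x) /\ J (s y) by split; [exists x|exists y].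
have D'J : D' `<=` J by exact: interval_sub.
have DD' : I `&` s @^-1` D' = D by exact: (scaling_preimage_itv iI ss Ix Iy).
have pK := scaling_pinvK ss.
have [mh ih hE] := scaling_density_pinv oI iI ss nuP dk.
set h := k \o pinv I s in mh ih hE.
have hs t : I t -> h (s t) = k t by move=> It; rewrite /h/= pK.
have mhD : measurable_fun D' h by exact: (measurable_funS (open_measurable oJ) D'J mh).
have h0 : \int[leb]_(t in D') h t = 0.
  rewrite /D' -(hE _ _ Jx Jy (ltW cd)) /= (pK _ Ix) (pK _ Iy).
  by rewrite (f0 y Iy (or_intror (lexx y))) (f0 x Ix (or_introl (lexx x))) subrr.
have sD t : D t -> D' (s t) by rewrite -DD' => -[].
have push (F : R -> R) : measurable_fun D' F -> (forall t, D' t -> 0 <= F t) ->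
    (\int[leb]_(t in D') (F t)%:E = \int[nu]_(t in D) (F (s t))%:E)%E.
  move=> mF F0; rewrite -DD'.
  apply: (scaling_integral_ge0 oI iI ss nuP mD' D'J (f := EFin \o F)) => //.
  exact/measurable_EFinP.
have h2le : integral_le leb D' (fun t => `|h t ^+ 2 * cst 1 t|) A.
  have mF : measurable_fun D' (fun t => `|h t ^+ 2 * cst 1 t|).
    apply: measurableT_comp => //; apply: measurable_funM => //.
    exact: measurable_funX.
  split => //; rewrite push//.
  have [_ _] := integral_le_sub mI mD DI kA; apply: le_trans.
  rewrite le_eqVlt; apply/orP; left; apply/eqP; apply: eq_integral => t /[!inE] Dt.
  by rewrite /= mulr1 hs ?ger0_norm ?sqr_ge0//; exact: DI.
have i1 : leb.-integrable D' (EFin \o cst (1 : R)).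
  exact: integrable_cst_oc (ltW cd).
have ihD : leb.-integrable D' (EFin \o h) by apply: ih => //; exact: ltW.
have ih2 : leb.-integrable D' (fun t => (h t ^+ 2 * cst 1 t)%:E).
  apply: (integral_le_integrable h2le).
  by apply: measurable_funM => //; exact: measurable_funX.
have [psi [spsi psi0 psid psiu]] := smooth_density cd mhD
  (@measurable_cst _ _ mR mR D' 1) (fun t _ => ler01) ihD i1 ih2 h0 d0.
have Cpsi : Cc_smooth J psi by exact: (Cc_smooth_of_supp iJ spsi Jx Jy psi0).
exists psi => //.
have u0 t : I t -> t <= x \/ y <= t -> (f \- (psi \o s)) t = 0.
  move=> It txy; rewrite /= f0// psi0 ?subrr//.
  by rewrite !(scaling_le ss).
have := density_truncate iI mI Ix Iy (ltW xy) u0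
  (densityB dk (smooth_scale_density Cpsi) mI).
move=> /small; apply.
- move=> t It nD; split; last by rewrite patchN// notin_setE.
  apply: u0 => //; move/negP: nD; rewrite /= in_itv/= negb_and -leNgt -ltNge.
  by case/orP => [|/ltW]; [left|right].
- have [mk _ _] := dk.
  have mF : measurable_fun D' (fun t => (h t - derive1 psi t) ^+ 2 * cst 1 t).
    by case: psid.
  have E t : D t -> ((fun t => k t - derive1 psi (s t)) \_ D) t ^+ 2 =
      (h (s t) - derive1 psi (s t)) ^+ 2 * cst 1 (s t).
    by move=> Dt; rewrite patchT ?inE//= mulr1 hs//; exact: DI.
  split.
  + apply: (@eq_measurable_fun _ _ _ _ _
      (fun t => (h (s t) - derive1 psi (s t)) ^+ 2 * cst 1 (s t))).
      by move=> t /[!inE] Dt; rewrite -E.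
    have := measurable_comp mD' _ mF (measurable_funS mI DI (scaling_measurable oI ss)).
    by apply => _ [t Dt <-]; exact: sD.
  + by move=> t _; exact: sqr_ge0.
  + have [_ F0 le] := psid; apply: le_trans le; rewrite push//.
    rewrite le_eqVlt; apply/orP; left; apply/eqP; apply: eq_integral => t /[!inE] Dt.
    by rewrite E.
- move=> t Dt; have It := DI _ Dt; have := psiu _ (sD _ Dt).
  have st : s x <= s t by have := sD _ Dt; rewrite /D'/= in_itv/= => /andP[/ltW].
  rewrite -(hE _ _ Jx (ex_intro2 _ _ t It erefl) st) /= (pK _ It) (pK _ Ix).
  by rewrite (f0 x Ix (or_introl (lexx x))) subr0.
Qed.

End scale_approximation.

(** * The absolutely continuous part of the scale *)

Section absolutely_continuous_part.
Context {R : realType}.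
Notation mR := (measurableTypeR R).
Notation leb := (@lebesgue_measure R).
Variables (I : set R) (e : R) (s g : R -> R).
Variables (m kappa : {measure set mR -> \bar R}) (N : set mR).
Hypotheses (oI : open I) (iI : is_interval I) (Ie : I e) (mr : radon_on I m).
Hypothesis ss : scaling_function I e s.
Hypothesis stP : forall sigma, scaling_function I e sigma ->
  is_stieltjes_measure I sigma (stieltjes I sigma).
Hypotheses (mg : measurable_fun (I : set mR) g) (g0 : forall x, I x -> 0 <= g x).
Let mu := stieltjes I s.
Hypothesis muE : forall A : set mR, measurable A -> A `<=` I ->
  mu A = (\int[leb]_(x in A) (g x)%:E + kappa A)%E.
Hypotheses (mN : measurable N) (NI : N `<=` I) (N0 : leb N = 0%E).
Hypothesis kN : kappa (I `\` N) = 0%E.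
Hypothesis sF : Cc_smooth I `<=` minimal_domain I s m.

Let sbar := oriented_integral g e.
Let mub := stieltjes I sbar.
Let muP := stP ss.
Let mI : measurable (I : set mR). Proof. exact: open_measurable. Qed.
Let itvI x y : I x -> I y -> `]x, y]%classic `<=` I. Proof. by move=> ? ?; exact: interval_sub. Qed.
Let mitv (x y : R) : measurable (`]x, y]%classic : set mR). Proof. exact: measurable_itv. Qed.

Let mu_off (A : set mR) : measurable A -> A `<=` I `\` N ->
  mu A = (\int[leb]_(x in A) (g x)%:E)%E.
Proof.
move=> mA AIN; have AI : A `<=` I by move=> t /AIN[].
rewrite muE// [X in (_ + X)%E](_ : _ = 0%E) ?adde0//.
by apply: (subset_measure0 mA _ AIN kN); exact: measurableD.
Qed.

Let mu_itv_fin x y : I x -> I y -> x <= y -> (mu `]x, y]%classic < +oo)%E.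
Proof. exact: (stieltjes_itv_fin muP). Qed.

Let g_integrable x y : I x -> I y -> x <= y ->
  leb.-integrable (`]x, y]%classic : set mR) (EFin \o g).
Proof.
move=> Ix Iy xy; have DI := itvI Ix Iy.
apply/integrableP; split.
  by apply/measurable_EFinP; apply: measurable_funS mg.
apply: le_lt_trans (mu_itv_fin Ix Iy xy); rewrite muE//.
have -> : (\int[leb]_(t in `]x, y]) `|(EFin \o g) t| = \int[leb]_(t in `]x, y]) (g t)%:E)%E.
  by apply: eq_integral => t /[!inE] /DI It; rewrite /= ger0_norm// g0.
by rewrite leeDl.
Qed.

Let sbarE x : I x -> sbar x = if e <= x then \int[leb]_(t in `]e, x]) g t
  else - \int[leb]_(t in `]x, e]) g t.
Proof.
move=> Ix; rewrite /sbar /oriented_integral; case: leP => [ex|/ltW xe].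
  by rewrite -Rintegral_itv_obnd_cbnd//; exact: g_integrable.
by rewrite -Rintegral_itv_obnd_cbnd//; exact: g_integrable.
Qed.

Let sbar_density : density I leb sbar g.
Proof.
split => // x y Ix Iy xy; rewrite !sbarE//.
have [ex|xe] := leP e x.
  rewrite (le_trans ex xy) (Rintegral_itvB (g_integrable Ie Iy (le_trans ex xy)))//;
    by rewrite bnd_simp.
have [ey|ye] := leP e y.
  have := @Rintegral_itvB _ g (BRight x) (BRight y) e (g_integrable Ix Iy xy).
  by rewrite !bnd_simp => /(_ (ltW xe) ey) <-; ring.
have := @Rintegral_itvB _ g (BRight x) (BRight e) y (g_integrable Ix Ie (ltW xe)).
by rewrite !bnd_simp => /(_ xy (ltW ye)) <-; ring.
Qed.

Let inv_measurable (D : set mR) : measurable D -> D `<=` I ->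
  measurable_fun D (fun t => (g t)^-1).
Proof.
move=> mD DI; have mgD := measurable_funS mI DI mg.
(* On nonnegative reals the power -1 is the inverse, including the default value 0 at 0. *)
have mp : measurable_fun D ((@powR R)^~ (-1) \o g).
  by apply: measurableT_comp; [exact: measurable_powR|exact: mgD].
by apply: eq_measurable_fun mp => t /[!inE] /DI It; rewrite /= powR_inv1// g0.
Qed.

(* The density k of a test function equal to t on ]x, y] satisfies k g = 1 off a
   null set, hence 1/g = k^2 g. *)
Let g_pos_itv x y : I x -> I y -> x <= y -> exists A, exists Z : set mR,
  [/\ measurable Z, leb Z = 0%E, forall t, `]x, y]%classic t -> ~ Z t -> 0 < g t &
      integral_le leb `]x, y]%classic (fun t => (g t)^-1) A].
Proof.
move=> Ix Iy xy.
have [p [_ [Ip _ /andP[px _]]]] := open_interval_points oI Ix.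
have [_ [q [_ Iq /andP[_ yq]]]] := open_interval_points oI Iy.
have [beta [sb b01 b1 b0]] := smooth_bump px yq.
pose f t := t * beta t.
have Cf : Cc_smooth I f.
  apply: (Cc_smooth_of_supp iI (smoothM (@smooth_id _) sb) Ip Iq).
  by move=> t /b0 ->; rewrite mulr0.
have fE t : x <= t <= y -> f t = t by move=> xty; rewrite /f b1// mulr1.
have [/(finite_E1P m oI iI ss muP)[k [dk [A [kA _]]]] _] := sF Cf.
have [mk ik kE] := dk.
pose D : set mR := `]x, y]%classic; have mD : measurable D by exact: mitv.
have DI : D `<=` I by exact: itvI.
pose D0 := D `\` N; have mD0 : measurable D0 by exact: measurableD.
have D0D : D0 `<=` D by move=> t [].
have D0I : D0 `<=` I by exact: subset_trans DI.
have D0N : D0 `<=` I `\` N by move=> t [/DI].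
have D0fin : (mu D0 < +oo)%E.
  by apply: le_lt_trans (mu_itv_fin Ix Iy xy); apply: le_measure; rewrite ?inE.
have mgD0 := measurable_funS mI D0I mg.
have g0D0 t : D0 t -> 0 <= g t by move=> /D0I/g0.
have i1 : leb.-integrable D (EFin \o cst (1 : R)) by exact: integrable_cst_oc.
(* Both sides have the same integral over each Borel subset E of [D0]: the integral of [k] over E
   against ds is the Lebesgue measure of E, as [f] is the identity there, and ds is g dx off N. *)
have [Z0 [mZ0 Z00 sub]] : ae_eq leb D0 (EFin \o cst (1 : R)) (fun t => (k t * g t)%:E).
  apply: (integral_ae_eq mD0).
  - exact: integrableS i1.
  - apply/measurable_EFinP; apply: measurable_funM => //.
    exact: measurable_funS mk.
  - move=> E ED0 mE; have ED := subset_trans ED0 D0D.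
    have EI := subset_trans ED0 D0I.
    rewrite -(integral_eq_itv xy (ik _ _ Ix Iy xy) i1 _ mE ED).
      apply: integral_density_signed => //.
      + exact: measurable_funS mgD0.
      + by move=> t /EI/g0.
      + by apply: le_lt_trans D0fin; apply: le_measure; rewrite ?inE.
      + by move=> A' mA' A'E; apply: mu_off => //; apply: subset_trans A'E (subset_trans ED0 D0N).
      + exact: measurable_funS mk.
    move=> p' q' xp pq qy; rewrite Rintegral_cst_oc// mul1r.
    rewrite -kE ?fE//; first by rewrite xp (le_trans pq).
    + by rewrite qy (le_trans xp).
    + by apply: (interval_mem iI Ix Iy); rewrite xp (le_trans pq).
    + by apply: (interval_mem iI Ix Iy); rewrite qy (le_trans xp).
pose Z := Z0 `|` N.
have mZ : measurable Z by exact: measurableU.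
have ZZ : leb Z = 0%E by rewrite measureU0.
have kg t : D t -> ~ Z t -> k t * g t = 1.
  move=> Dt nZ; apply: contrapT => kg1; apply: nZ.
  have [Nt|nN] := pselect (N t); first by right.
  by left; apply: sub => /= H; apply: kg1; have [] := H (conj Dt nN).
exists A, Z; split => //.
- move=> t Dt nZ; rewrite lt0r g0; last exact: DI.
  rewrite andbT; apply/eqP => g00; have := kg _ Dt nZ.
  by rewrite g00 mulr0 => /esym/eqP; rewrite oner_eq0.
- split.
  + exact: inv_measurable.
  + by move=> t /DI/g0 gt; rewrite invr_ge0.
  + have [_ _ kD0] := integral_le_sub mI mD0 D0I kA; apply: le_trans kD0.
    have -> : (\int[mu]_(t in D0) (k t ^+ 2)%:E =
        \int[leb]_(t in D0) (k t ^+ 2 * g t)%:E)%E.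
      apply: integral_density => //.
      * by move=> A' mA' A'D; apply: mu_off => //; exact: subset_trans D0N.
      * by apply: measurable_funX; exact: measurable_funS mk.
      * by move=> t _; exact: sqr_ge0.
    rewrite le_eqVlt; apply/orP; left; apply/eqP.
    rewrite -[X in (_ = \int[_]_(_ in X) _)%E](setIidr D0D) integral_mkcondr.
    apply: (integral_ae_eq_nonmeas mD mZ ZZ) => t Dt nZ.
    have nN : ~ N t by move=> Nt; apply: nZ; right.
    have tD0 : t \in D0 by rewrite inE; split.
    rewrite patchT//.
    have kgt := kg _ Dt nZ; congr (_%:E).
    have gn0 : g t != 0 by apply/eqP => g00; move/eqP: kgt; rewrite g00 mulr0 eq_sym oner_eq0.
    apply: (mulIf gn0); rewrite mulVf// -[LHS](expr1n _ 2) -{}kgt; ring.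
Qed.

Let g_pos : exists Z : set mR, [/\ measurable Z, leb Z = 0%E &
  forall t, I t -> ~ Z t -> 0 < g t].
Proof.
have [Z [mZ Z0 sub]] : \forall t \ae leb, I t -> 0 < g t.
  apply: ae_local => // x y Ix Iy xy.
  have [_ [Z [mZ Z0 gZ _]]] := g_pos_itv Ix Iy xy.
  exists Z; split => // t /= /not_implyP[/andP[xt ty] gt0]; apply: contrapT => nZ.
  by apply: gt0; apply: gZ nZ; rewrite /= in_itv/= xt ltW.
exists Z; split => // t It nZ; apply: contrapT => gt0; apply: nZ; apply: sub => /= H.
by apply: gt0; exact: H.
Qed.

(** Strict monotonicity is the point: an increment 0 would make g vanish almost everywhere on an
    interval, against g > 0 a.e. *)
Lemma ac_part_scaling : scaling_function I e sbar.
Proof.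
split.
- move=> x y; rewrite !inE => Ix Iy xy; rewrite -subr_gt0.
  have [_ _ sE] := sbar_density; rewrite sE ?ltW//.
  pose D : set mR := `]x, y]%classic; have mD : measurable D by exact: mitv.
  have DI : D `<=` I by exact: itvI.
  have iD := g_integrable Ix Iy (ltW xy).
  rewrite lt0r; apply/andP; split; last first.
    by apply: Rintegral_ge0 => t /DI/g0.
  apply/eqP => int0; have [Z [mZ Z0 gZ]] := g_pos.
  have : (\int[leb]_(t in D) `|(g t)%:E| = 0)%E.
    have -> : (\int[leb]_(t in D) `|(g t)%:E| = \int[leb]_(t in D) (g t)%:E)%E.
      by apply: eq_integral => t /[!inE] /DI It; rewrite /= ger0_norm// g0.
    by rewrite -[LHS]fineK ?(integrable_fin_num mD iD)//; congr EFin.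
  move=> /(ae_eq_integral_abs leb mD)[].
    by apply/measurable_EFinP; exact: measurable_funS mg.
  move=> Z1 [mZ1 Z10 sub].
  have DZ : D `<=` Z `|` Z1.
    move=> t Dt; have [Zt|nZ] := pselect (Z t); [by left|right; apply: sub => /=].
    move=> /(_ Dt)[gt0]; have := gZ _ (DI _ Dt) nZ.
    by rewrite gt0 ltxx.
  have D0 : leb D = 0%E.
    have ZZ : leb (Z `|` Z1) = 0%E by rewrite measureU0.
    exact: (subset_measure0 mD (measurableU _ _ mZ mZ1) DZ ZZ).
  have := lebesgue_itv_oc (ltW xy); rewrite -/D D0 => -[] /esym/eqP.
  by rewrite subr_eq0 gt_eqF.
- rewrite continuous_open_subspace//.
  exact: (abs_continuous_on_continuous oI iI (density_abs_continuous oI iI sbar_density)).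
- by rewrite /sbar /oriented_integral lexx set_itv1 Rintegral_set1.
Qed.

Let sb := ac_part_scaling.
Let mubP := stP sb.

Let mub_itv_fin x y : I x -> I y -> x <= y -> (mub `]x, y]%classic < +oo)%E.
Proof. exact: (stieltjes_itv_fin mubP). Qed.

Let integrable_cst_fin (nu : {measure set mR -> \bar R}) (D : set mR) :
  measurable D -> (nu D < +oo)%E -> nu.-integrable D (EFin \o cst (1 : R)).
Proof.
move=> mD Doo; apply: (@measurable_bounded_integrable _ mR) => //.
by exists 1; split; [exact: num_real|move=> M M1 t _; rewrite /= normr1 ltW].
Qed.

Let mub_itv x y (A : set mR) : I x -> I y -> x <= y -> measurable A ->
  A `<=` `]x, y]%classic -> mub A = (\int[leb]_(t in A) (g t)%:E)%E.
Proof.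
move=> Ix Iy xy mA AD.
have i1 := integrable_cst_fin (mitv x y) (mub_itv_fin Ix Iy xy).
rewrite -(integral_eq_itv xy i1 (g_integrable Ix Iy xy) _ mA AD).
  have -> : (\int[mub]_(t in A) (cst 1 t)%:E = \int[mub]_(t in A) cst 1%:E t)%E by [].
  by rewrite integral_cst// mul1e.
move=> p q xp pq qy.
have Ip : I p by apply: (interval_mem iI Ix Iy); rewrite xp (le_trans pq).
have Iq : I q by apply: (interval_mem iI Ix Iy); rewrite qy (le_trans xp).
rewrite Rintegral_cst// mul1r; have [_ ->//] := mubP.
by have [_ _ <-] := sbar_density.
Qed.

Let mub_off (A : set mR) : measurable A -> A `<=` I `\` N -> mu A = mub A.
Proof.
move=> mA AIN; apply: (@measure_eq_local _ I) => //; last by move=> t /AIN[].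
move=> x y Ix Iy xy B mB BA.
rewrite (mub_itv Ix Iy xy mB); last by move=> t /BA[].
by rewrite mu_off// => t /BA[/AIN].
Qed.

Let mub_N : mub N = 0%E.
Proof.
apply: (@measure_null_local _ I) => // x y Ix Iy xy.
have mNxy : measurable (N `&` `]x, y]%classic : set mR) by exact: measurableI.
rewrite (mub_itv Ix Iy xy mNxy); last by move=> t [].
have NxyI : N `&` `]x, y]%classic `<=` I by move=> t [/NI].
apply: null_set_integral => //.
  by apply/measurable_EFinP; exact: measurable_funS mg.
by apply: (subset_measure0 mNxy mN _ N0) => t [].
Qed.

Let integral_switch (D : set mR) (F : mR -> \bar R) : measurable D -> D `<=` I ->
  (forall t, N t -> F t = 0%E) -> (\int[mu]_(t in D) F t = \int[mub]_(t in D) F t)%E.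
Proof.
move=> mD DI F0.
have off (nu : {measure set mR -> \bar R}) :
    (\int[nu]_(t in D) F t = \int[nu]_(t in D `\` N) F t)%E.
  rewrite setDE integral_mkcondr; apply: eq_integral => t _.
  rewrite patchE; case: ifPn => // /negP; rewrite inE /= => /contrapT; exact: F0.
rewrite (off mu) (off mub); apply: eq_measure_integral => A mA AD.
by apply: mub_off => // t /AD[/DI].
Qed.

Let integral_le_switch (F : R -> R) a : (forall t, N t -> F t = 0) ->
  integral_le mu I F a <-> integral_le mub I F a.
Proof.
move=> F0.
have E : (\int[mu]_(t in I) (F t)%:E = \int[mub]_(t in I) (F t)%:E)%E.
  by apply: integral_switch => // t /F0 ->.
by split => -[mF Fp Fa]; split => //; [rewrite -E|rewrite E].
Qed.

Let density_switch u k : (forall t, N t -> k t = 0) ->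
  density I mu u k <-> density I mub u k.
Proof.
move=> k0.
have E1 x y : I x -> I y -> (\int[mu]_(t in `]x, y]) `|(k t)%:E| =
    \int[mub]_(t in `]x, y]) `|(k t)%:E|)%E.
  by move=> Ix Iy; apply: integral_switch; [exact: mitv|exact: itvI|
    move=> t /k0 ->; rewrite abse0].
have E2 x y : I x -> I y -> \int[mu]_(t in `]x, y]) k t = \int[mub]_(t in `]x, y]) k t.
  move=> Ix Iy; congr fine; apply: integral_switch; [exact: mitv|exact: itvI|].
  by move=> t /k0 ->.
split => -[mk ik uE]; split => // x y Ix Iy xy; rewrite ?uE ?E2//;
  have /integrableP[mkk koo] := ik _ _ Ix Iy xy; apply/integrableP; split => //.
- by move: koo; rewrite E1.
- by move: koo; rewrite -E1.
Qed.

Let finite_energy_switch u k : (forall t, N t -> k t = 0) ->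
  finite_energy I m mu u k <-> finite_energy I m mub u k.
Proof.
move=> k0; have E A := @integral_le_switch (fun t => k t ^+ 2) A.
split => -[/(density_switch _ k0) dk [A [kA uA]]]; split => //; exists A; split => //;
  by apply/E => // t /k0 ->; rewrite expr0n.
Qed.

Let finite_E1_switch u : finite_E1 I sbar m u -> exists h,
  [/\ forall t, N t -> h t = 0, finite_energy I m mu u h & finite_energy I m mub u h].
Proof.
move=> /(finite_E1P m oI iI sb mubP)[k [dk [A [kA uA]]]].
have h0 t : N t -> (k \_ (~` N)) t = 0.
  by move=> Nt; rewrite patchE; case: ifPn => //; rewrite inE => /(_ Nt).
have fh : finite_energy I m mub u (k \_ (~` N)).
  split; first exact: (density_null mI mN mub_N dk).
  by exists A; split => //; exact: (restrict_sqr_le mI (measurableC mN) kA).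
by exists (k \_ (~` N)); split => //; apply/finite_energy_switch.
Qed.

Lemma ac_part_energy u v : finite_E1 I sbar m u -> finite_E1 I sbar m v ->
  energy I s u v = energy I sbar u v.
Proof.
move=> /finite_E1_switch[h [h0 [d1 _] [d2 _]]] /finite_E1_switch[k [_ [d3 _] [d4 _]]].
rewrite (energyE oI iI ss muP d1 d3) (energyE oI iI sb mubP d2 d4); congr (_ * _).
by congr fine; apply: integral_switch => // t /h0 ->; rewrite mul0r.
Qed.

Let finite_E1_ac_part u : finite_E1 I sbar m u -> finite_E1 I s m u.
Proof.
by move=> /finite_E1_switch[h [_ uh _]]; apply/(finite_E1P m oI iI ss muP); exists h.
Qed.

Let E1_norm_ac_part u : finite_E1 I sbar m u -> E1_norm I s m u = E1_norm I sbar m u.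
Proof. by move=> fu; rewrite /E1_norm ac_part_energy. Qed.

Let mub_integral x y (F : R -> R) : I x -> I y -> x <= y ->
  measurable_fun (`]x, y]%classic : set mR) F ->
  (forall t, `]x, y]%classic t -> 0 <= F t) ->
  (\int[mub]_(t in `]x, y]) (F t)%:E = \int[leb]_(t in `]x, y]) (F t * g t)%:E)%E.
Proof.
move=> Ix Iy xy mF F0; apply: integral_density => //.
- exact: (measurable_funS mI (itvI Ix Iy) mg).
- by move=> t /(itvI Ix Iy)/g0.
- exact: mub_itv_fin.
- by move=> A mA AD; exact: (mub_itv Ix Iy xy).
Qed.

Let mub_integral_signed x y (F : R -> R) : I x -> I y -> x <= y ->
  measurable_fun (`]x, y]%classic : set mR) F ->
  (\int[mub]_(t in `]x, y]) (F t)%:E = \int[leb]_(t in `]x, y]) (F t * g t)%:E)%E.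
Proof.
move=> Ix Iy xy mF; apply: integral_density_signed => //.
- exact: (measurable_funS mI (itvI Ix Iy) mg).
- by move=> t /(itvI Ix Iy)/g0.
- exact: mub_itv_fin.
- by move=> A mA AD; exact: (mub_itv Ix Iy xy).
Qed.

Let density_mub_leb u l : density I mub u l -> density I leb u (fun t => l t * g t).
Proof.
move=> [ml il uE]; split; first exact: measurable_funM.
- move=> x y Ix Iy xy; have DI := itvI Ix Iy.
  have mlD : measurable_fun (`]x, y]%classic : set mR) l by exact: measurable_funS ml.
  have mgD : measurable_fun (`]x, y]%classic : set mR) g by exact: measurable_funS mg.
  apply/integrableP; split; first by apply/measurable_EFinP; exact: measurable_funM.
  have /integrableP[_] := il _ _ Ix Iy xy.
  rewrite (_ : (\int[mub]_(t in `]x, y]) `|(EFin \o l) t| =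
    \int[leb]_(t in `]x, y]) (`|l t| * g t)%:E)%E).
    apply: le_lt_trans; rewrite le_eqVlt; apply/orP; left; apply/eqP.
    by apply: eq_integral => t /[!inE] /DI/g0 gt; rewrite /= normrM (ger0_norm gt).
  by rewrite -mub_integral//; exact: measurableT_comp.
- move=> x y Ix Iy xy; rewrite uE//; congr fine; apply: mub_integral_signed => //.
  by apply: measurable_funS ml => //; exact: itvI.
Qed.

(* Division by zero is harmless: g vanishes on a null set only. *)
Let density_leb_mub u h : density I leb u h -> density I mub u (fun t => h t / g t).
Proof.
move=> [mh ih uE]; have [Z [mZ Z0 gZ]] := g_pos.
have mq : measurable_fun (I : set mR) (fun t => h t / g t).
  by apply: measurable_funM => //; exact: inv_measurable.
have hgg t : I t -> ~ Z t -> h t / g t * g t = h t.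
  by move=> It nZ; rewrite divfK// gt_eqF// gZ.
split => //.
- move=> x y Ix Iy xy; have DI := itvI Ix Iy.
  have mqD : measurable_fun (`]x, y]%classic : set mR) (fun t => h t / g t).
    exact: measurable_funS mq.
  apply/integrableP; split; first by apply/measurable_EFinP.
  have /integrableP[_] := ih _ _ Ix Iy xy.
  rewrite [X in (_ -> X < _)%E](_ : _ =
      \int[leb]_(t in `]x, y]) (`|h t / g t| * g t)%:E)%E; last first.
    by rewrite -mub_integral//; exact: measurableT_comp.
  rewrite (_ : (\int[leb]_(t in `]x, y]) (`|h t / g t| * g t)%:E =
    \int[leb]_(t in `]x, y]) `|(EFin \o h) t|)%E)//.
  apply: (integral_ae_eq_nonmeas (mitv x y) mZ Z0) => t Dt nZ.
  have It := DI _ Dt; rewrite /= -{2}(hgg _ It nZ) [in RHS]normrM.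
  by rewrite (ger0_norm (g0 It)).
- move=> x y Ix Iy xy; have DI := itvI Ix Iy; rewrite uE//; congr fine.
  rewrite mub_integral_signed//; last exact: measurable_funS mq.
  apply: (integral_ae_eq_nonmeas (mitv x y) mZ Z0) => t Dt nZ.
  by rewrite hgg//; exact: DI.
Qed.

(** Twice the energy of [f] in the scale [sbar] is the integral of f'^2 / g, finite because f' is
    bounded and 1/g is integrable on an interval containing its support. *)
Let smooth_ac_part f : Cc_smooth I f -> finite_E1 I sbar m f.
Proof.
move=> Cf; apply/(finite_E1P m oI iI sb mubP).
have df := density_leb_mub (Cc_smooth_density oI iI Ie Cf).
have [sf cf fI] := Cf; have [sf' cf' f'I] := Cc_smooth_derive1 Cf.
have [x1 [y1 [Ix1 Iy1 _ f0]]] := tsupp_segment oI Ie cf fI.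
have [x [y [Ix Iy xey f'0]]] := tsupp_segment oI Ie cf' f'I.
have xy : x <= y by case/andP: xey => h1 h2; exact/ltW/(lt_trans h1 h2).
have [B B0 fB] := smooth_bounded sf f0; have [B' B'0 f'B] := smooth_bounded sf' f'0.
exists (fun t => derive1 f t / g t); split => //.
have off (p q : R) t : ~ `]p, q]%classic t -> t <= p \/ q <= t.
  move/negP; rewrite /= in_itv/= negb_and -leNgt -ltNge.
  by case/orP => [|/ltW]; [left|right].
have h2 : integral_le m I (fun t => f t ^+ 2) (B ^+ 2 * fine (m `]x1, y1]%classic)).
  apply: (bounded_supp_integral_le mI (mitv x1 y1) (itvI Ix1 Iy1)) => //.
  - exact: smooth_measurable.
  - by move=> t It /off/f0.
  - exact: (radon_itv iI mr).
have [A [_ [_ _ _ gA]]] := g_pos_itv Ix Iy xy.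
have [mq _ _] := df.
have mq2 : measurable_fun (I : set mR) (fun t => (derive1 f t / g t) ^+ 2).
  exact: measurable_funX.
have h1 : integral_le mub I (fun t => (derive1 f t / g t) ^+ 2) (B' ^+ 2 * A).
  apply: (integral_le_extend mI (mitv x y) (itvI Ix Iy) mq2).
    by move=> t It /off/f'0 ->; rewrite mul0r expr0n.
  have mq2D : measurable_fun (`]x, y]%classic : set mR) (fun t => (derive1 f t / g t) ^+ 2).
    by apply: measurable_funS mq2 => //; exact: itvI.
  split => //; first by move=> t _; exact: sqr_ge0.
  rewrite mub_integral//; last by move=> t _; exact: sqr_ge0.
  have mgD : measurable_fun (`]x, y]%classic : set mR) g.
    by apply: measurable_funS mg => //; exact: itvI.
  have le t : `]x, y]%classic t ->
      0 <= (derive1 f t / g t) ^+ 2 * g t <= B' ^+ 2 * (g t)^-1.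
    move=> /(itvI Ix Iy)/g0 gt; rewrite mulr_ge0 ?sqr_ge0//=.
    have -> : (derive1 f t / g t) ^+ 2 * g t = derive1 f t ^+ 2 * (g t)^-1.
      have [->|gn0] := eqVneq (g t) 0; first by rewrite mulr0 invr0 mulr0.
      by field.
    rewrite ler_wpM2r ?invr_ge0// -[derive1 f t ^+ 2]real_normK ?num_real//.
    by rewrite lerXn2r ?nnegrE ?f'B.
  by have [_ _] := integral_le_mono (mitv x y) (measurable_funM mq2D mgD) le
    (integral_leZ (mitv x y) (sqr_ge0 B') gA) (lexx _).
set A1 := B' ^+ 2 * A in h1; set A2 := B ^+ 2 * _ in h2.
exists (Num.max A1 A2); split; [apply: integral_le_weaken h1|apply: integral_le_weaken h2];
  by rewrite le_max lexx ?orbT.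
Qed.

(* For the density l of v, the energy of v - f is the integral of
   (l - f'/g)^2 g = (l g - f')^2 / g, which explains the weight 1/g. *)
Let Cc_smooth_approx v x y (eps : R) : I x -> I y -> x < y ->
  (forall t, I t -> t <= x \/ y <= t -> v t = 0) -> finite_E1 I sbar m v -> 0 < eps ->
  exists2 f, Cc_smooth I f & E1_norm I sbar m (v \- f) < eps.
Proof.
move=> Ix Iy xy v0 /(finite_E1P m oI iI sb mubP)[l [dl [A [lA _]]]] e0.
have [delta d0 small] := small_E1_norm oI iI mr sb mubP Ix Iy (ltW xy) e0.
pose D : set mR := `]x, y]%classic.
have mD : measurable D by exact: mitv.
have DI : D `<=` I by exact: itvI.
have [ml _ _] := dl; have [mh ih hE] := density_mub_leb dl.
set h := (fun t => l t * g t) in mh ih hE.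
have mlD := measurable_funS mI DI ml; have mhD := measurable_funS mI DI mh.
have mgD := measurable_funS mI DI mg.
have mw : measurable_fun D (fun t => (g t)^-1) by exact: inv_measurable.
have w0 t : D t -> 0 <= (g t)^-1 by move=> /DI/g0; rewrite invr_ge0.
have h0 : \int[leb]_(t in D) h t = 0.
  rewrite /D -(hE _ _ Ix Iy (ltW xy)).
  by rewrite (v0 y Iy (or_intror (lexx y))) (v0 x Ix (or_introl (lexx x))) subrr.
have hhw t : h t ^+ 2 * (g t)^-1 = l t ^+ 2 * g t.
  rewrite /h; have [->|gn0] := eqVneq (g t) 0; first by rewrite invr0 !mulr0.
  by field.
have h2le : integral_le leb D (fun t => `|h t ^+ 2 * (g t)^-1|) A.
  split.
  - apply: measurableT_comp => //; apply: measurable_funM => //.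
    exact: measurable_funX.
  - by move=> t _; exact: normr_ge0.
  - have [_ _] := integral_le_sub mI mD DI lA; apply: le_trans.
    rewrite (mub_integral Ix Iy (ltW xy))//; last 2 first.
    + exact: measurable_funX.
    + by move=> t _; exact: sqr_ge0.
    rewrite le_eqVlt; apply/orP; left; apply/eqP; apply: eq_integral => t /[!inE] /DI/g0 gt.
    by rewrite hhw ger0_norm// mulr_ge0// sqr_ge0.
have ih2 : leb.-integrable D (fun t => (h t ^+ 2 * (g t)^-1)%:E).
  apply: (integral_le_integrable h2le).
  by apply: measurable_funM => //; exact: measurable_funX.
have [A' [_ [_ _ _ gA]]] := g_pos_itv Ix Iy (ltW xy).
have iw : leb.-integrable D (EFin \o (fun t => (g t)^-1)).
  apply: (integral_le_integrable (a := A')) => //; have [m1 p1 le1] := gA; split.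
  - exact: measurableT_comp.
  - by move=> t _; exact: normr_ge0.
  - apply: le_trans le1; rewrite le_eqVlt; apply/orP; left; apply/eqP.
    by apply: eq_integral => t /[!inE] Dt; rewrite ger0_norm// w0.
have ihD : leb.-integrable D (EFin \o h) by apply: ih => //; exact: ltW.
have [f [sf f0 fd fu]] := smooth_density xy mhD mw w0 ihD iw ih2 h0 d0.
have Cf : Cc_smooth I f by exact: (Cc_smooth_of_supp iI sf Ix Iy f0).
exists f => //.
have u0 t : I t -> t <= x \/ y <= t -> (v \- f) t = 0.
  by move=> It txy; rewrite /= v0// f0// subrr.
have df := density_leb_mub (Cc_smooth_density oI iI Ie Cf).
have [mq _ _] := df; have mqD := measurable_funS mI DI mq.
have := density_truncate iI mI Ix Iy (ltW xy) u0 (densityB dl df mI).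
move=> /small; apply.
- move=> t It nD; split; last by rewrite patchN// notin_setE.
  apply: u0 => //; move/negP: nD; rewrite /= in_itv/= negb_and -leNgt -ltNge.
  by case/orP => [|/ltW]; [left|right].
- have E t : D t -> ((fun t => l t - derive1 f t / g t) \_ D) t ^+ 2 =
      (l t - derive1 f t / g t) ^+ 2.
    by move=> Dt; rewrite patchT ?inE.
  have mF : measurable_fun D (fun t => (l t - derive1 f t / g t) ^+ 2).
    by apply: measurable_funX; exact: measurable_funB.
  split.
  + by apply: eq_measurable_fun mF => t /[!inE] Dt; rewrite E.
  + by move=> t _; exact: sqr_ge0.
  + have -> : (\int[mub]_(t in D) (((fun t => l t - derive1 f t / g t) \_ D) t ^+ 2)%:E =
        \int[leb]_(t in D) ((l t - derive1 f t / g t) ^+ 2 * g t)%:E)%E.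
      rewrite -mub_integral ?ltW//; last by move=> t _; exact: sqr_ge0.
      by apply: eq_integral => t /[!inE] Dt; rewrite E.
    have [Z [mZ Z0 gZ]] := g_pos; have [_ _] := fd; apply: le_trans.
    rewrite le_eqVlt; apply/orP; left; apply/eqP.
    apply: (integral_ae_eq_nonmeas mD mZ Z0) => t Dt nZ.
    by have := gZ _ (DI _ Dt) nZ; move=> gt; congr EFin; rewrite /h; field; rewrite gt_eqF.
- move=> t Dt; have := fu _ Dt.
  have xt : x <= t by move: Dt; rewrite /D/= in_itv/= => /andP[/ltW].
  by rewrite -(hE _ _ Ix (DI _ Dt) xt) (v0 x Ix (or_introl (lexx x))) subr0.
Qed.

Let Fbar := norm_closure (E1_norm I s m) (minimal_domain I s m) (Cc_smooth I).

Let closure_sub : Fbar `<=` minimal_domain I sbar m.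
Proof.
move=> u [[fu _] ap].
have [h [dh [A [hA uA]]]] := (finite_E1P m oI iI ss muP u).1 fu.
have uh : finite_energy I m mu u h by split => //; exists A.
have [mh _ _] := dh; have mhN := measurable_funS mI NI mh.
(* A test function has a density [k] vanishing on N, so on N the square of [h] is that of [h - k],
   whose integral is arbitrarily small. *)
have hN0 : (\int[mu]_(t in N) `|(h t ^+ 2)%:E| = 0)%E.
  apply/eqP; rewrite eq_le integral_ge0 ?andbT//.
  apply/lee_addgt0Pr => r r0; rewrite add0e.
  (* [E1_norm_lt] turns a norm below this value into the bound 2 (r / 2) = r. *)
  have e0 : 0 < Num.sqrt (r / 2) by rewrite sqrtr_gt0 divr_gt0.
  have [f Cf uf] := ap _ e0.
  have [k [k0 fk _]] := finite_E1_switch (smooth_ac_part Cf).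
  have [h2 _] := E1_norm_lt oI iI ss muP (finite_energyB oI iI ss muP uh fk) uf.
  have rE : 2 * Num.sqrt (r / 2) ^+ 2 = r.
    by rewrite sqr_sqrtr ?divr_ge0 ?(ltW r0)// mulrC divfK.
  have [_ _] := integral_le_sub mI mN NI h2; rewrite rE; apply: le_trans.
  rewrite le_eqVlt; apply/orP; left; apply/eqP; apply: eq_integral => t /[!inE] Nt.
  by rewrite k0// subr0 /= ger0_norm// sqr_ge0.
have [|Z0 [mZ0 Z00 sub]] := (ae_eq_integral_abs mu mN _).1 hN0.
  by apply/measurable_EFinP; exact: measurable_funX.
(* As [mu] may charge N, the density cannot simply be reset to 0 there. It is reset on the [mu]-null
   part [Z], outside which [h] already vanishes on N. *)
pose Z := Z0 `&` N; have mZ : measurable Z by exact: measurableI.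
have ZZ : mu Z = 0%E by apply: (subset_measure0 mZ mZ0 _ Z00) => t [].
have hE : h \_ (~` Z) = h \_ (~` N).
  apply/funext => t; rewrite !patchE; have [Nt|nN] := pselect (N t); last first.
    by rewrite !mem_set// => -[].
  rewrite [t \in ~` N]memNset; last by move=> /(_ Nt).
  case: ifPn => // /[!inE] nZ; apply/eqP; rewrite -sqrf_eq0; apply/eqP.
  apply: contrapT => hn0; apply: nZ; split => //; apply: sub => /= H; apply: hn0.
  by have [] := H Nt.
have h0 t : N t -> (h \_ (~` N)) t = 0.
  by move=> Nt; rewrite patchE memNset// => /(_ Nt).
have dh0 : density I mu u (h \_ (~` N)) by rewrite -hE; exact: (density_null mI mZ ZZ dh).
have /(finite_energy_switch _ h0) uh0 : finite_energy I m mu u (h \_ (~` N)).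
  by split => //; exists A; split => //; exact: (restrict_sqr_le mI (measurableC mN) hA).
have fub : finite_E1 I sbar m u by apply/(finite_E1P m oI iI sb mubP); exists (h \_ (~` N)).
split => // eps eps0.
(* [E1_norm_triangle] loses a factor 4, and 4 (eps / 5) is strictly below [eps]. *)
have e50 : 0 < eps / 5 by rewrite divr_gt0.
have [f Cf uf] := ap _ e50; have ff := smooth_ac_part Cf.
have [sf cf fI] := Cf; have [x [y [Ix Iy xey f0]]] := tsupp_segment oI Ie cf fI.
have xy : x < y by case/andP: xey => h1 h2; exact: (lt_trans h1 h2).
have [psi Cpsi fpsi] := smooth_scale_approx oI iI Ie mr sb mubP Ix Iy xy
  (fun t _ => f0 t) ff e50.
exists (psi \o sbar); first by exists psi.
have := E1_norm_triangle oI iI sb mubP fub ff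
  (smooth_scale_finite oI iI Ie mr sb mubP Cpsi) _ fpsi.
rewrite -E1_norm_ac_part; last exact: (finite_E1B oI iI sb mubP fub ff).
by move=> /(_ uf) H; apply: le_lt_trans H _; lra.
Qed.

Let approx_ac_part u x y v (eps : R) : I x -> I y -> x < y ->
  (forall t, I t -> t <= x \/ y <= t -> v t = 0) ->
  finite_E1 I sbar m u -> finite_E1 I sbar m v -> 0 < eps ->
  E1_norm I s m (u \- v) < eps / 5 ->
  exists2 f, Cc_smooth I f & E1_norm I s m (u \- f) < eps.
Proof.
move=> Ix Iy xy v0 fu fv e0 uv; have e50 : 0 < eps / 5 by rewrite divr_gt0.
have [f Cf vf] := Cc_smooth_approx Ix Iy xy v0 fv e50.
have ff := smooth_ac_part Cf; exists f => //.
have fuf := finite_E1B oI iI sb mubP fu ff.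
rewrite (E1_norm_ac_part fuf).
move: uv; rewrite (E1_norm_ac_part (finite_E1B oI iI sb mubP fu fv)) => uv.
by apply: le_lt_trans (E1_norm_triangle oI iI sb mubP fu fv ff uv vf) _; lra.
Qed.

Let scale_supp sigma phi : scaling_function I e sigma -> Cc_smooth (sigma @` I) phi ->
  exists x y, [/\ I x, I y, x < y &
    forall t, I t -> t <= x \/ y <= t -> (phi \o sigma) t = 0].
Proof.
move=> sig [_ cp pJ].
have oJ : open (sigma @` I) by exact: scaling_image_open sig.
have Je : (sigma @` I) (sigma e) by exists e.
have [_ [_ [[x Ix <-] [y Iy <-] xey p0]]] := tsupp_segment oJ Je cp pJ.
exists x, y; split => //.
  by rewrite -(scaling_ltE sig Ix Iy); case/andP: xey => h1 h2; exact: (lt_trans h1 h2).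
by move=> t It txy; apply: p0; rewrite !(scaling_le sig).
Qed.

Let sub_closure : minimal_domain I sbar m `<=` Fbar.
Proof.
move=> u [fu ap]; have fus := finite_E1_ac_part fu.
have apf eps : 0 < eps -> exists2 f, Cc_smooth I f & E1_norm I s m (u \- f) < eps.
  move=> e0; have e50 : 0 < eps / 5 by rewrite divr_gt0.
  have [_ [psi Cpsi <-] upsi] := ap _ e50.
  have [x [y [Ix Iy xy v0]]] := scale_supp sb Cpsi.
  have fv := smooth_scale_finite oI iI Ie mr sb mubP Cpsi.
  apply: (approx_ac_part Ix Iy xy v0 fu fv e0).
  by rewrite (E1_norm_ac_part (finite_E1B oI iI sb mubP fu fv)).
(* Membership in the domain of s also requires approximation of [u] by smooth functions of s. A test
   function close to [u] mediates, since by hypothesis it lies in that domain. *)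
split => //; split => // eps e0; have e50 : 0 < eps / 5 by rewrite divr_gt0.
have [f Cf uf] := apf _ e50; have [ffs apphi] := sF Cf.
have [_ [phi Cphi <-] fphi] := apphi _ e50.
exists (phi \o s); first by exists phi.
have fphis := smooth_scale_finite oI iI Ie mr ss muP Cphi.
by apply: le_lt_trans (E1_norm_triangle oI iI ss muP fus ffs fphis uf fphi) _; lra.
Qed.

Lemma ac_part_closure : Fbar = minimal_domain I sbar m.
Proof. by apply/seteqP; split; [exact: closure_sub|exact: sub_closure]. Qed.

Lemma ac_of_dense : minimal_domain I s m `<=` Fbar -> abs_continuous_on I s.
Proof.
move=> dense x y xy xyI.
have Ix : I x by apply: xyI; rewrite /= in_itv/= lexx.
have Iy : I y by apply: xyI; rewrite /= in_itv/= lexx andbT.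
have [p [_ [Ip _ /andP[px _]]]] := open_interval_points oI Ix.
have [_ [q [_ Iq /andP[_ yq]]]] := open_interval_points oI Iy.
have [beta [sbt b01 b1 b0]] := smooth_bump (scaling_lt ss Ip Ix px) (scaling_lt ss Iy Iq yq).
pose phi t := t * beta t.
have iJ : is_interval (s @` I) by exact: scaling_image_interval ss.
have Cphi : Cc_smooth (s @` I) phi.
  apply: (Cc_smooth_of_supp iJ (smoothM (@smooth_id _) sbt)
    (ex_intro2 _ _ p Ip erefl) (ex_intro2 _ _ q Iq erefl)).
  by move=> t /b0 ->; rewrite mulr0.
have phiE t : x <= t <= y -> phi (s t) = s t.
  move=> /[dup] xty /(interval_mem iI Ix Iy) It; case/andP: xty => xt ty.
  by rewrite /phi b1 ?mulr1// !(scaling_le ss)// xt.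
have Fphi : minimal_domain I s m (phi \o s).
  split; first exact: (smooth_scale_finite oI iI Ie mr ss muP Cphi).
  by move=> eps e0; exists (phi \o s); [exists phi|rewrite E1_norm0].
(* The function equal to s on [x, y] thus has a density [h] in the scale [sbar], hence the Lebesgue
   density h g. *)
have [/(finite_E1P m oI iI sb mubP)[h [dh _]] _] := closure_sub (dense _ Fphi).
have ac := density_abs_continuous oI iI (density_mub_leb dh) xy xyI.
move=> eps e0; have [d d0 H] := ac _ e0; exists d => // n a b ab tab dl.
rewrite (eq_bigr (fun i => `|(phi \o s) (b i) - (phi \o s) (a i)|)); first exact: H.
by move=> i _; have [h1 h2 h3] := ab i; rewrite /= !phiE// ?h1 ?h3 ?(le_trans h1 h2) ?(le_trans h2 h3).
Qed.

Lemma dense_of_ac : abs_continuous_on I s -> minimal_domain I s m `<=` Fbar.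
Proof.
move=> /(abs_continuous_density oI iI)[k [mk ik sE]].
(* On intervals with endpoints in I, ds and k dx have the same primitive, so ds does not charge the
   Lebesgue null set N. *)
have muN : mu N = 0%E.
  apply: (@measure_null_local _ I) => // x y Ix Iy xy.
  have mNxy : measurable (N `&` `]x, y]%classic : set mR) by exact: measurableI.
  have NxyI : N `&` `]x, y]%classic `<=` I by move=> t [/NI].
  have i1 := integrable_cst_fin (mitv x y) (mu_itv_fin Ix Iy xy).
  have -> : mu (N `&` `]x, y]%classic) =
      (\int[mu]_(t in N `&` `]x, y]) (cst (1 : R) t)%:E)%E.
    transitivity (\int[mu]_(t in N `&` `]x, y]) cst 1%:E t)%E => //.
    by rewrite integral_cst// mul1e.
  rewrite (integral_eq_itv xy i1 (ik _ _ Ix Iy xy) _ mNxy); last by move=> t [].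
    apply: null_set_integral => //.
      by apply/measurable_EFinP; exact: measurable_funS mk.
    by apply: (subset_measure0 mNxy mN _ N0) => t [].
  move=> p q xp pq qy.
  have Ip : I p by apply: (interval_mem iI Ix Iy); rewrite xp (le_trans pq).
  have Iq : I q by apply: (interval_mem iI Ix Iy); rewrite qy (le_trans xp).
  rewrite Rintegral_cst// mul1r; have [_ ->//] := muP.
  by rewrite -sE.
have fin u : finite_E1 I s m u -> finite_E1 I sbar m u.
  move=> /(finite_E1P m oI iI ss muP)[h [dh [A [hA uA]]]].
  have h0 t : N t -> (h \_ (~` N)) t = 0.
    by move=> Nt; rewrite patchE memNset// => /(_ Nt).
  apply/(finite_E1P m oI iI sb mubP); exists (h \_ (~` N)).
  apply/(finite_energy_switch _ h0); split; first exact: (density_null mI mN muN dh).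
  by exists A; split => //; exact: (restrict_sqr_le mI (measurableC mN) hA).
move=> u Fu; split => // eps e0; have [fu ap] := Fu.
have e50 : 0 < eps / 5 by rewrite divr_gt0.
have [_ [phi Cphi <-] uphi] := ap _ e50.
have [x [y [Ix Iy xy v0]]] := scale_supp ss Cphi.
have fv := smooth_scale_finite oI iI Ie mr ss muP Cphi.
exact: (approx_ac_part Ix Iy xy v0 (fin _ fu) (fin _ fv) e0 uphi).
Qed.

End absolutely_continuous_part.

(** * Special standard cores *)

Section special_core.
Context {R : realType}.
Notation mR := (measurableTypeR R).
Notation leb := (@lebesgue_measure R).

(** [phi] is the primitive, vanishing at 0, of a bump with values in [0, 1] that is 1 on [0, 1] and
    0 off [-eps, 1 + eps]. *)
Lemma smooth_contraction (eps : R) : 0 < eps -> exists phi : R -> R,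
  [/\ smooth phi, forall t, 0 <= t <= 1 -> phi t = t,
      forall t, - eps <= phi t <= 1 + eps &
      forall t t', t < t' -> 0 <= phi t' - phi t <= t' - t].
Proof.
move=> e0; have [h1 h2] : - eps < 0 /\ 1 < 1 + eps by lra.
have [beta [sb b01 b1 b0]] := smooth_bump h1 h2.
have [G sG [G' [G0 GE]]] := smooth_antiderivative sb b0.
have ib (p q : R) : leb.-integrable (`]p, q]%classic : set mR) (EFin \o beta).
  by apply: integrableS (smooth_supp_integrable sb b0) => //; exact: measurable_itv.
have lip t t' : t <= t' -> 0 <= G t' - G t <= t' - t.
  move=> tt; rewrite GE//; apply/andP; split.
    by apply: Rintegral_ge0 => u _; case/andP: (b01 u).
  rewrite -[leRHS]mul1r -(Rintegral_cst_oc 1 tt); apply: le_Rintegral => //.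
    exact: integrable_cst_oc.
  by move=> u _; case/andP: (b01 u).
have id01 t : 0 <= t <= 1 -> G t - G 0 = t.
  move=> /andP[t0 t1]; rewrite GE// -[RHS]subr0 -[RHS]mul1r -(Rintegral_cst_oc 1 t0).
  apply: eq_Rintegral => u /[!inE]/=; rewrite in_itv/= => /andP[u0 ut].
  by rewrite b1// (ltW u0) (le_trans ut).
have Gr t : 1 + eps <= t -> G t - G (1 + eps) = 0.
  move=> et; rewrite GE// /Rintegral integral0_eq// => u /=; rewrite in_itv/= => /andP[eu _].
  by rewrite b0//; right; exact: ltW.
exists (fun t => G t - G 0); split.
- exact: (smoothD sG (@smooth_cst _ _)).
- exact: id01.
- move=> t; have [/andP[l1 l2] /andP[l3 l4]] :=
    (lip (- eps) 0 (ltW h1), lip 0 (1 + eps) (ltac:(lra))).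
  have Gl u : u <= - eps -> G u = 0 by exact: G0.
  have Gle := Gl _ (lexx _).
  have [te|et] := leP t (- eps).
    have Gt := Gl _ te.
    by move: Gle Gt l1 l2; move: (G t) (G 0) (G (- eps)) => *; apply/andP; split; lra.
  have [t0|t0] := leP t 0.
    have /andP[k1 k2] := lip _ _ t0.
    by move: k1 k2; move: (G t) (G 0) => *; apply/andP; split; lra.
  have [te|te] := leP t (1 + eps).
    have /andP[k1 k2] := lip _ _ (ltW t0).
    by move: k1 k2; move: (G t) (G 0) => *; apply/andP; split; lra.
  have Gt := Gr _ (ltW te).
  by move: Gt l3 l4; move: (G t) (G 0) (G (1 + eps)) => *; apply/andP; split; lra.
- by move=> t t' tt; rewrite opprB addrA subrK; exact: lip (ltW tt).
Qed.

Variables (I : set R) (e : R).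
Hypotheses (oI : open I) (iI : is_interval I) (Ie : I e).

(** A Urysohn function is smoothed uniformly and then composed with a smooth step, which restores
    the exact values 0 and 1 that smoothing destroys. *)
Lemma smooth_cutoff (K G : set R) : compact K -> open G -> K `<=` G ->
  compact (closure G) -> closure G `<=` I ->
  exists f, [/\ Cc_smooth I f, forall x, 0 <= f x,
    forall x, K x -> f x = 1 & forall x, ~ G x -> f x = 0].
Proof.
move=> cK oG KG cG GI.
have cAB : (~` G) `&` K = set0.
  by apply/seteqP; split => // t [nG /KG].
have := @normal_uniform_separator _ (@pseudometric_normal R R) _ _ (open_closedC oG)
  (compact_closed (@Rhausdorff R) cK) cAB.
move=> /(@uniform_separatorP _ R)[F [cF _ F0 F1]].
have [x [y [Ix Iy /andP[xe ey] Gxy]]] := compact_in_segment oI Ie cG GI.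
have off t : t <= x \/ y <= t -> ~ G t.
  move=> txy /(@subset_closure _ G)/Gxy/andP[h1 h2].
  by case: txy; rewrite leNgt ?h1 ?h2.
(* With values 0 and 2 and an error below 1/2, the approximant minus 1/2 is negative off [G] and
   above 1 on [K], where the step is constant. *)
pose F2 t := 2 * F t.
have cF2 : continuous F2 by move=> t; apply: cvgM; [exact: cvg_cst|exact: cF].
have F20 t : ~ G t -> F2 t = 0.
  by move=> nG; rewrite /F2 (F0 (F t)) ?mulr0//; exists t.
have F22 t : K t -> F2 t = 2.
  by move=> Kt; rewrite /F2 (F1 (F t)) ?mulr1//; exists t.
have e0 : 0 < 2^-1 :> R by rewrite invr_gt0.
have [h [sh h0 hE]] := smooth_uniform_approx (lt_trans xe ey) cF2
  (fun t txy => F20 t (off t txy)) e0.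
pose f t := smooth_step ((h t - 2^-1) / 1).
have f0 t : ~ G t -> f t = 0.
  move=> /F20 Ft; apply: step_le0; rewrite divr1.
  by have := hE t; rewrite Ft sub0r normrN ltr_norml => /andP[_]; lra.
exists f; split; last exact: f0.
- apply: (Cc_smooth_of_supp iI _ Ix Iy); last by move=> t /off/f0.
  exact: (smooth_comp (@smooth_step_affine _ 2^-1 1) sh).
- by move=> t; case/andP: (step_bound ((h t - 2^-1) / 1)).
- move=> t /F22 Ft; apply: step_ge1; rewrite divr1.
  by have := hE t; rewrite Ft ltr_norml => /andP[_]; lra.
Qed.

(** Since [F 0 0 = 0], the support stays in an interval containing both supports. This covers linear
    combinations, products and composition with a contraction. *)
Lemma Cc_smooth_comb (F : R -> R -> R) f h : smooth (fun t => F (f t) (h t)) ->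
  F 0 0 = 0 -> Cc_smooth I f -> Cc_smooth I h -> Cc_smooth I (fun t => F (f t) (h t)).
Proof.
move=> sF F0 [_ cf fI] [_ ch hI].
have [x1 [y1 [Ix1 Iy1 _ f0]]] := tsupp_segment oI Ie cf fI.
have [x2 [y2 [Ix2 Iy2 _ h0]]] := tsupp_segment oI Ie ch hI.
have Ix : I (Num.min x1 x2) by case: leP.
have Iy : I (Num.max y1 y2) by case: leP.
apply: (Cc_smooth_of_supp iI sF Ix Iy) => t.
rewrite le_min ge_max => txy; rewrite f0 ?h0//.
- by case: txy => /andP[h1 h2]; [left|right].
- by case: txy => /andP[h1 h2]; [left|right].
Qed.

Lemma Cc_smooth_special_core (N : (R -> R) -> R) (F : set (R -> R)) :
  Cc_smooth I `<=` F -> F `<=` norm_closure N F (Cc_smooth I) ->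
  special_standard_core I N F (Cc_smooth I).
Proof.
move=> CF dense; split.
- split.
  + split => //.
    * by move=> f [sf cf fI]; split => //; exact: smooth_continuous.
    * move=> f [cf tf fI] eps e0.
      have [x [y [Ix Iy /andP[xe ey] f0]]] := tsupp_segment oI Ie tf fI.
      have [h [sh h0 hE]] := smooth_uniform_approx (lt_trans xe ey) cf f0 e0.
      by exists h => //; exact: (Cc_smooth_of_supp iI sh Ix Iy).
  + move=> k f h Cf Ch; have [[sf _ _] [sh _ _]] := (Cf, Ch).
    have k0 : k * 0 + 0 = 0 by rewrite mulr0 addr0.
    exact: (@Cc_smooth_comb (fun u v => k * u + v) f h
      (smoothD (smoothM (@smooth_cst _ k) sf) sh) k0 Cf Ch).
  + move=> eps e0; have [phi [sphi p1 p2 p3]] := smooth_contraction e0.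
    have phi0 : phi 0 = 0 by rewrite p1// lexx ler01.
    exists phi; split; [exact: p1|exact: p2|exact: p3|move=> f Cf; have [sf _ _] := Cf].
    exact: (@Cc_smooth_comb (fun u _ => phi u) f f (smooth_comp sphi sf) phi0 Cf Cf).
- move=> f h Cf Ch; have [[sf _ _] [sh _ _]] := (Cf, Ch).
  exact: (@Cc_smooth_comb (fun u v => u * v) f h (smoothM sf sh) (mulr0 0) Cf Ch).
- exact: smooth_cutoff.
Qed.

End special_core.

Theorem theorem2p2 (R : realType) (a b : \bar R) (e : R) (s : R -> R)
    (m : {measure set (measurableTypeR R) -> \bar R}) (g : R -> R)
    (kappa : {measure set (measurableTypeR R) -> \bar R}) :
  let I := open_itv a b in
  let F := minimal_domain I s m in
  let Fbar := norm_closure (E1_norm I s m) F (Cc_smooth I) in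
  let sbar := oriented_integral g e in
  I e ->
  radon_on I m ->
  fully_supported I m ->
  scaling_function I e s ->
  lebesgue_decomposition I (stieltjes I s) g kappa ->
  Cc_smooth I `<=` F ->
  [/\ scaling_function I e sbar,
      Fbar = minimal_domain I sbar m,
      forall u v, Fbar u -> Fbar v -> energy I s u v = energy I sbar u v &
      special_standard_core I (E1_norm I s m) F (Cc_smooth I) <->
        abs_continuous_on I s].
Proof.
move=> I F Fbar sbar Ie mr _ ss [mg g0 muE [N [mN NI N0 kN]]] sF.
have iI : is_interval I.
  move=> x y /andP[ax _] /andP[_ yb] z /andP[xz zy]; apply/andP; split.
    by rewrite (lt_le_trans ax)// lee_fin.
  by rewrite (le_lt_trans _ yb)// lee_fin.
have oI : open I.
  rewrite /I (_ : open_itv a b = [set x : R | (a < x%:E)%E] `&` [set x : R | (x%:E < b)%E]).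
    by apply: openI; [exact: open_ereal_gt|exact: open_ereal_lt].
  by apply/seteqP; split => x /=; [move=> /andP[]|move=> [h1 h2]; apply/andP].
have stP sigma : scaling_function I e sigma ->
    is_stieltjes_measure I sigma (stieltjes I sigma) by exact: stieltjesP.
have FbarE : Fbar = minimal_domain I sbar m.
  exact: (ac_part_closure oI iI Ie mr ss stP mg g0 muE mN NI N0 kN sF).
split; [|exact: FbarE| |].
- exact: (ac_part_scaling oI iI Ie ss stP mg g0 muE mN N0 kN sF).
- move=> u v; rewrite FbarE => -[fu _] [fv _].
  exact: (ac_part_energy oI iI Ie ss stP mg g0 muE mN NI N0 kN sF fu fv).
- split => [core|ac].
    apply: (ac_of_dense oI iI Ie mr ss stP mg g0 muE mN NI N0 kN sF).
    exact: (core_E1_dense (standard_is_core (special_is_standard core))).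
  apply: (Cc_smooth_special_core oI iI Ie sF).
  exact: (dense_of_ac oI iI Ie mr ss stP mg g0 muE mN NI N0 kN sF ac).
Qed.
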